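(* Assume: (Sample) the data are a pooled sample of $N_1$ treated observations $(Y_i,X_i)$, $i\in\mathcal I_1=\{1,\dots,N_1\}$, drawn i.i.d. from the distribution of $(Y,X)\mid W=1$, and $N_0$ control observations $(Y_i,X_i)$, $i\in\mathcal I_0$, drawn i.i.d. from the distribution of $(Y,X)\mid W=0$, the treated and control samples being independent; (CIA) $Y(0)\perp W\mid X$; (Covariates) (i) $X\in\mathbb R^k$ is absolutely continuous; (ii) $\mathbb X_1\subseteq\mathbb X_0$, with $\mathbb X_1$ and $\mathbb X_0$ compact; (iii) $f_1$ and $f_0$ are differentiable at all interior points of their supports and bounded from above on $\mathbb X_1$, and $f_0$ is bounded below by a positive constant on $\mathbb X_1$; (iv) there are $\phi_0>0$ and $\rho_0>0$ such that for every $x\in\mathbb X_1$ and every $0<\rho\le\rho_0$ at least a fraction $\phi_0$ of the volume of the ball of radius $\rho$ around $x$ belongs to $\mathbb X_1$; (Smoothness) for every continuous and bounded $h:\mathbb R\to\mathbb R$, $\tilde h(x)=\mathbb E[h(Y(0))\mid X=x]$ is continuous and bounded; (Homoskedasticity/treatment effect homogeneity) for all $x\in\mathbb X_1$, $(Y(1)-\tau)\mid(X=x,W=1)$ has the same distribution as $Y(0)\mid(X=x,W=0)$; and the distribution of $Y$ is continuous. Let $c\in\mathbb R$ and consider testing $H_0:\tau=c$ with the permutation test $\tilde\phi(\tilde S_{N_0})$ at level $\alpha$. If $H_0$ holds, then for any $\alpha\in(0,1)$, with $N_1$ (and $M$) fixed, $$\limsup_{N_0\to\infty}\mathbb E[\tilde\phi(\tilde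 S_{N_0})]\le\alpha.$$
   Context: $(Y(0),Y(1),X,W)$ is a random vector: $Y(0),Y(1)$ are real-valued potential outcomes, $X\in\mathbb R^k$ covariates, $W\in\{0,1\}$ a treatment indicator, $0<\Pr(W=1)<1$, and $\mathbb E|Y(0)|,\mathbb E|Y(1)|<\infty$. The observed outcome is $Y=WY(1)+(1-W)Y(0)$. For $w\in\{0,1\}$, $\mathbb X_w$ is the support of $X$ given $W=w$ and $f_w:\mathbb X_w\to\mathbb R_+$ the conditional density of $X$ given $W=w$. $\tau=\mathbb E[Y(1)-Y(0)\mid W=1]$. Distance: $d(a,b)=[(a-b)'V(a-b)]^{1/2}$ on $\mathbb R^k$, with $V$ a fixed positive definite matrix. For $i\in\mathcal I_1$ and $1\le m\le M$, $Y^i_{(m)}$ is the outcome of the control observation whose covariate is $m$-th closest to $X_i$ in $d$ among all controls (matching with replacement; $M\in\mathbb N$ fixed). Permutation test of $\tau=c$ at level $\alpha$: let $\tilde S^0_{N_0,i}=Y_i-c$, $\tilde S^m_{N_0,i}=Y^i_{(m)}$ for $m=1,\dots,M$, and $\tilde S_{N_0}=(\tilde S^0_{N_0,1},\dots,\tilde S^M_{N_0,1},\dots,\tilde S^0_{N_0,N_1},\dots,\tilde S^M_{N_0,N_1})'$. Let $\tilde{\mathbf G}$ be the set of all $\pi=(\pi_1,\dots,\pi_{N_1})$ where each $\pi_i$ is a permutation of $\{0,1,\dots,M\}$, and let $\tilde S^\pi_{N_0}$ be the vector with $\tilde S^{m}_{N_0,i}$ replaced by $\tilde S^{\pi_i(m)}_{N_0,i}$.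 The test statistic is $$\tilde T(\tilde S^\pi_{N_0})=\Big|\frac1{N_1}\sum_{i=1}^{N_1}\Big(\tilde S^{\pi_i(0)}_{N_0,i}-\frac1M\sum_{j=1}^M\tilde S^{\pi_i(j)}_{N_0,i}\Big)\Big|.$$ With $\tilde K=|\tilde{\mathbf G}|$, let $\tilde T^{(1)}(\tilde S_{N_0})\le\dots\le\tilde T^{(\tilde K)}(\tilde S_{N_0})$ be the ordered values of $\{\tilde T(\tilde S^\pi_{N_0}):\pi\in\tilde{\mathbf G}\}$ (with multiplicity) and $\tilde k=\lceil\tilde K(1-\alpha)\rceil$. Then $\tilde\phi(\tilde S_{N_0})=1$ if $\tilde T(\tilde S_{N_0})>\tilde T^{(\tilde k)}(\tilde S_{N_0})$ and $0$ otherwise.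
   Formalization: ''The distribution of Y is continuous'' is strengthened to: the conditional distribution of Y given X=x has no atoms, for x in the support of X; with only the unconditional distribution continuous the claim fails (e.g. Y(0)=g(X), g a rapidly oscillating lacunary cosine series). *)

(* Defs.v *)
From HB Require Import structures.
From mathcomp Require Import all_boot all_order all_algebra all_fingroup.
From mathcomp Require Import all_classical all_reals all_analysis.

Set Implicit Arguments.
Unset Strict Implicit.
Unset Printing Implicit Defensive.

Import Order.TTheory GRing.Theory Num.Theory.
Import numFieldNormedType.Exports.

Local Open Scope classical_set_scope.
Local Open Scope ring_scope.

Definition measure_row_display : measure_display -> measure_display.
Proof. exact. Qed.

(* Row vectors carry the product sigma-algebra, generated by the coordinates;
   on 'rV[R]_n it contains the open sets (open_measurable_row), hence it is the
   Borel sigma-algebra of R^n. *)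
Section measurable_row.
Context d (T : measurableType d) (n : nat).

Let coord (j : 'I_n) (v : 'rV[T]_n) : T := v ord0 j.

Let row_set0 : g_sigma_preimage coord set0.
Proof. exact: sigma_algebra0. Qed.

Let row_setC A : g_sigma_preimage coord A -> g_sigma_preimage coord (~` A).
Proof. exact: sigma_algebraC. Qed.

Let row_bigcup (F : (set 'rV[T]_n)^nat) :
  (forall i, g_sigma_preimage coord (F i)) ->
  g_sigma_preimage coord (\bigcup_i (F i)).
Proof. exact: sigma_algebra_bigcup. Qed.

HB.instance Definition _ := @isMeasurable.Build (measure_row_display d)
  'rV[T]_n (g_sigma_preimage coord) row_set0 row_setC row_bigcup.

Lemma measurable_coord (j : 'I_n) :
  measurable_fun [set: 'rV[T]_n] (fun v => v ord0 j).
Proof.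
move=> _ Y mY; rewrite setTI; apply: sub_sigma_algebra => /=.
rewrite -bigcup_seq/=; exists j => /=; first by rewrite mem_index_enum.
by exists Y => //; rewrite setTI.
Qed.

Lemma measurable_fun_rowP d' (T' : measurableType d') (f : T' -> 'rV[T]_n) :
  (forall j, measurable_fun [set: T'] (fun x => f x ord0 j)) ->
  measurable_fun [set: T'] f.
Proof.
move=> mf _ A; rewrite setTI; move: A.
suff H : g_sigma_preimage coord `<=` [set A | measurable (f @^-1` A)].
  by move=> A mA; exact: H.
apply: smallest_sub.
  split=> /=.
  - by rewrite preimage_set0.
  - by move=> A mA; rewrite setTD preimage_setC; exact: measurableC.
  - by move=> F mF; rewrite preimage_bigcup; exact: bigcupT_measurable.
rewrite -bigcup_seq; apply: bigcup_sub => j _ A [B mB <-] /=.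
by rewrite setTI; have := mf j measurableT B mB; rewrite setTI.
Qed.

End measurable_row.

Lemma ball_measurable_row (R : realType) (n : nat) (x : 'rV[R]_n) (e : R) :
  measurable (ball x e).
Proof.
have [e0|e0] := leP e 0.
  suff -> : ball x e = set0 by exact: measurable0.
  by apply/seteqP; split=> // y []; rewrite ltNge e0.
have -> : ball x e =
    \bigcap_(j in [set: 'I_n]) (fun v : 'rV[R]_n => v ord0 j) @^-1` ball (x ord0 j) e.
  apply/seteqP; split=> [y [_ xy] j _|y xy]; first exact: xy.
  by split=> // i j; rewrite (ord1 i); exact: xy.
apply: fin_bigcap_measurable => // j _; rewrite -[X in measurable X]setTI.
by apply: measurable_coord => //; by rewrite ball_itv; exact: measurable_itv.
Qed.

Lemma open_measurable_row (R : realType) (n : nat) (U : set 'rV[R]_n) :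
  open U -> measurable U.
Proof.
move=> oU.
pose q (p : 'rV[rat]_n * nat) : 'rV[R]_n := \row_j ratr (p.1 ord0 j).
pose B (p : 'rV[rat]_n * nat) : set 'rV[R]_n :=
  if `[< ball (q p) (p.2.+1%:R^-1) `<=` U >] then ball (q p) (p.2.+1%:R^-1) else set0.
have -> : U = \bigcup_p B p.
  apply/seteqP; split=> [x Ux|x [p _]]; last first.
    by rewrite /B; case: asboolP => // BU /BU.
  have /nbhs_ballP[e /= e0 eU] := open_nbhs_nbhs (conj oU Ux).
  have [m me] : exists m, (m.+1%:R^-1 : R) < e / 2.
    have [m _ H] := near_infty_natSinv_lt (PosNum (divr_gt0 e0 (ltr0n R 2))).
    by exists m; exact: (H m (leqnn m)).
  have m0 : (0 : R) < m.+1%:R^-1 by rewrite invr_gt0.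
  have /choice[r rP] (j : 'I_n) : exists r : rat,
      `|x ord0 j - ratr r| < m.+1%:R^-1.
    have lt : x ord0 j - m.+1%:R^-1 < x ord0 j + m.+1%:R^-1.
      by rewrite ltrBlDr -addrA ltrDl addr_gt0.
    have [r] := rat_in_itvoo lt; rewrite in_itv/= => /andP[r1 r2]; exists r.
    by rewrite distrC ltr_distl r1 r2.
  exists (\row_j r j, m) => //; rewrite /B.
  have xq : ball (q (\row_j r j, m)) (m.+1%:R^-1) x.
    split=> // i j; rewrite (ord1 i) /q/= !mxE /ball/= distrC; exact: rP.
  rewrite asboolT//= => y qy; apply: eU.
  have := ball_triangle (ball_sym xq) qy.
  by apply: le_ball; rewrite [leRHS]splitr lerD// ltW.
apply: countable_bigcupT_measurable => [|p]; first exact: countableP.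
by rewrite /B; case: ifPn => _; [exact: ball_measurable_row|exact: measurable0].
Qed.

(* lebesgue_measure, which lives on measurableTypeR R, seen as a measure on the
   canonical measurable type R (same sets, another display). *)
Section lebesgue_measure_R.
Variable R : realType.

Definition lebesgue_R : set R -> \bar R := @lebesgue_measure R.

Let lebesgue_R0 : lebesgue_R set0 = 0%E.
Proof. exact: (measure0 (@lebesgue_measure R)). Qed.

Let lebesgue_R_ge0 A : (0 <= lebesgue_R A)%E.
Proof. exact: (measure_ge0 (@lebesgue_measure R)). Qed.

Let lebesgue_R_sigma_additive : semi_sigma_additive lebesgue_R.
Proof.
move=> F mF tF mUF.
exact: (@measure_semi_sigma_additive _ _ _ (@lebesgue_measure R) F mF tF mUF).
Qed.

HB.instance Definition _ := isMeasure.Build _ _ _ lebesgue_R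
  lebesgue_R0 lebesgue_R_ge0 lebesgue_R_sigma_additive.

Let lebesgue_R_sigma_finite : sigma_finite setT lebesgue_R.
Proof.
have [F FT Foo] := sigma_finiteT (@lebesgue_measure R).
by exists F => // i; have [] := Foo i.
Qed.

HB.instance Definition _ := Measure_isSigmaFinite.Build _ _ _ lebesgue_R
  lebesgue_R_sigma_finite.

End lebesgue_measure_R.

(* Lebesgue measure on R^n: R^(n+1) is R x R^n through
   (t, v) |-> row_cons (t, v), and R^0 is a point of mass 1. *)
Section lebesgue_measure_row.
Variable R : realType.

Definition row_cons (n : nat) (p : R * 'rV[R]_n) : 'rV[R]_n.+1 :=
  \row_j (if unlift ord0 j is Some i then p.2 ord0 i else p.1).

Definition row_uncons (n : nat) (v : 'rV[R]_n.+1) : R * 'rV[R]_n :=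
  (v ord0 ord0, \row_j v ord0 (lift ord0 j)).

Lemma row_consK n : cancel (@row_cons n) (@row_uncons n).
Proof.
move=> [t v]; rewrite /row_uncons /row_cons mxE unlift_none; congr pair.
by apply/rowP => j; rewrite !mxE liftK.
Qed.

Lemma row_unconsK n : cancel (@row_uncons n) (@row_cons n).
Proof.
move=> v; apply/rowP => j; rewrite mxE /=.
by case: unliftP => [i|] ->; rewrite ?mxE.
Qed.

Lemma measurable_row_cons n : measurable_fun setT (@row_cons n).
Proof.
apply: measurable_fun_rowP => j; under eq_fun do rewrite mxE.
case: unliftP => [i _|_]; last exact: measurable_fst.
apply: (measurableT_comp (f := fun v : 'rV[R]_n => v ord0 i)) => //.
exact: measurable_coord.
Qed.

Lemma measurable_row_uncons n : measurable_fun setT (@row_uncons n).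
Proof.
apply: measurable_fun_pair => /=; first exact: (@measurable_coord _ R).
apply: measurable_fun_rowP => j; under eq_fun do rewrite mxE.
exact: measurable_coord.
Qed.

Section step.
Variables (n : nat) (mu : {sigma_finite_measure set 'rV[R]_n -> \bar R}).

Definition lebesgue_row_step : set 'rV[R]_n.+1 -> \bar R :=
  pushforward (@lebesgue_R R \x mu)%E (@row_cons n).

Let step0 : lebesgue_row_step set0 = 0%E.
Proof. by rewrite /lebesgue_row_step /pushforward preimage_set0 measure0. Qed.

Let step_ge0 A : (0 <= lebesgue_row_step A)%E.
Proof. exact: (measure_ge0 (@lebesgue_R R \x mu)%E). Qed.

Let step_sigma_additive : semi_sigma_additive lebesgue_row_step.
Proof.
rewrite /lebesgue_row_step; apply: measure_semi_sigma_additive.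
exact: measurable_row_cons.
Qed.

HB.instance Definition _ := isMeasure.Build _ _ _ lebesgue_row_step
  step0 step_ge0 step_sigma_additive.

Let step_sigma_finite : sigma_finite setT lebesgue_row_step.
Proof.
have /sigma_finiteP[F [TF ndF Foo]] := sigma_finiteT (@lebesgue_R R).
have /sigma_finiteP[G [TG ndG Goo]] := sigma_finiteT mu.
exists (fun i => @row_uncons n @^-1` (F i `*` G i)).
  rewrite -preimage_bigcup (_ : \bigcup_i _ = setT) ?preimage_setT//.
  apply/seteqP; split=> // -[x y] _.
  have [i _ Fx] : (\bigcup_i F i) x by rewrite -TF.
  have [j _ Gy] : (\bigcup_i G i) y by rewrite -TG.
  exists (maxn i j) => //; split => /=.
    by move: x Fx; exact/subsetPset/ndF/leq_maxl.
  by move: y Gy; exact/subsetPset/ndG/leq_maxr.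
move=> i; have [mF Fi] := Foo i; have [mG Gi] := Goo i; split.
  rewrite -[X in measurable X]setTI.
  by apply: measurable_row_uncons => //; exact: measurableX.
rewrite /lebesgue_row_step /pushforward -comp_preimage.
rewrite (_ : _ \o _ = id); last by apply/funext => p /=; rewrite row_consK.
by rewrite preimage_id product_measure1E// lte_mul_pinfty// ge0_fin_numE.
Qed.

HB.instance Definition _ := Measure_isSigmaFinite.Build _ _ _ lebesgue_row_step
  step_sigma_finite.

End step.

Fixpoint lebesgue_row (n : nat) : {sigma_finite_measure set 'rV[R]_n -> \bar R} :=
  if n is m.+1 then lebesgue_row_step (lebesgue_row m) else \d_(0 : 'rV[R]_0).

End lebesgue_measure_row.

Section conditioning.
Context d (Omega : measurableType d) (R : realType) (P : probability Omega R).

Lemma measurable_event (W : {mfun Omega >-> bool}) (w : bool) :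
  measurable (W @^-1` [set w]).
Proof. exact: measurable_funPTI. Qed.

(* P( . | W = w); the fallback P of mnormalize is used only if P (W = w) = 0. *)
Definition cond_prob (W : {mfun Omega >-> bool}) (w : bool) :
    probability Omega R :=
  mnormalize (mrestr P (measurable_event W w)) P.

Context d' (T : measurableType d') (X : {mfun Omega >-> T}).

(* g is a version of x |-> E[Z | X = x]. *)
Definition is_cond_expectation (Z : Omega -> R) (g : T -> R) : Prop :=
  [/\ measurable_fun setT g,
      (distribution P X).-integrable setT (EFin \o g) &
      forall B, measurable B ->
        (\int[P]_(w in X @^-1` B) (Z w)%:E =
         \int[distribution P X]_(x in B) (g x)%:E)%E].

(* kappa is a regular conditional distribution of Z given X. *)
Definition is_cond_distribution (Z : Omega -> R) (kappa : R.-pker T ~> R) :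
    Prop :=
  forall (B : set T) (A : set R), measurable B -> measurable A ->
    (P (X @^-1` B `&` Z @^-1` A) = \int[distribution P X]_(x in B) kappa x A)%E.

(* Y and W are independent given X: P(Y in A, W in B | X) =
   P(Y in A | X) P(W in B | X) almost surely. *)
Definition cond_independent d1 d2 (T1 : measurableType d1)
    (T2 : measurableType d2) (Y : Omega -> T1) (W : Omega -> T2) : Prop :=
  forall (A : set T1) (B : set T2), measurable A -> measurable B ->
  exists pA pB pAB : T -> R,
    [/\ is_cond_expectation \1_(Y @^-1` A) pA,
        is_cond_expectation \1_(W @^-1` B) pB,
        is_cond_expectation \1_(Y @^-1` A `&` W @^-1` B) pAB &
        {ae distribution P X, forall x, pAB x = pA x * pB x}].

Definition mutually_independent (I : eqType) (Z : I -> Omega -> T) : Prop :=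
  forall (s : seq I) (B : I -> set T), uniq s ->
    (forall i, measurable (B i)) ->
    (P (\bigcap_(i in [set` s]) Z i @^-1` B i) =
     \big[*%E/1%E]_(i <- s) P (Z i @^-1` B i))%E.

End conditioning.

Section population.
Context (R : realType) d (Omega : measurableType d) (P : probability Omega R).
Variables (k : nat) (X : {mfun Omega >-> 'rV[R]_k}).
Variables (W : {mfun Omega >-> bool}) (Y0 Y1 : Omega -> R).

Definition observed (w : Omega) : R :=
  (W w)%:R * Y1 w + (1 - (W w)%:R) * Y0 w.

Definition att : R := fine 'E_(cond_prob P W true)[fun w => Y1 w - Y0 w].

Definition msupport (mu : set 'rV[R]_k -> \bar R) : set 'rV[R]_k :=
  [set x | forall U, open U -> U x -> (0 < mu U)%E].

Definition cond_support (w : bool) : set 'rV[R]_k :=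
  msupport (distribution (cond_prob P W w) X).

(* f is a density of mu on its support D; f matters only on D. *)
Definition is_density (mu : set 'rV[R]_k -> \bar R) (D : set 'rV[R]_k)
    (f : 'rV[R]_k -> R) : Prop :=
  [/\ measurable_fun D f, forall x, D x -> 0 <= f x &
      forall A, measurable A ->
        mu A = (\int[lebesgue_row R k]_(x in A `&` D) (f x)%:E)%E].

End population.

Section matching.
Context (R : realType) (k : nat).

Definition posdef (V : 'M[R]_k) : Prop :=
  V^T = V /\ forall v : 'rV[R]_k, v != 0 -> 0 < (v *m V *m v^T) ord0 ord0.

Definition mdist (V : 'M[R]_k) (a b : 'rV[R]_k) : R :=
  Num.sqrt (((a - b) *m V *m (a - b)^T) ord0 ord0).

(* The balls of the normed module 'rV[R]_k are cubes, since its norm is the sup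
   norm. *)
Definition euclidean_ball (x : 'rV[R]_k) (rho : R) : set 'rV[R]_k :=
  [set y | mdist 1%:M x y <= rho].

Definition uniformly_thick (D : set 'rV[R]_k) (phi0 rho0 : R) : Prop :=
  forall x rho, D x -> 0 < rho <= rho0 ->
    (phi0%:E * lebesgue_row R k (euclidean_ball x rho) <=
     lebesgue_row R k (euclidean_ball x rho `&` D))%E.

(* Indices of the first N0 controls by increasing distance to x; the sort is
   stable, so ties go to the smaller index. *)
Definition neighbours (V : 'M[R]_k) (x : 'rV[R]_k)
    (z0 : nat -> R * 'rV[R]_k) (N0 : nat) : seq nat :=
  sort (fun j l => mdist V x (z0 j).2 <= mdist V x (z0 l).2) (iota 0 N0).

(* Row i is (Y_i - c, Y^i_(1), ..., Y^i_(M)); the default index of nth is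
   reached only if N0 < M. *)
Definition matched_sample (V : 'M[R]_k) (M N1 : nat) (c : R)
    (z1 : 'I_N1 -> R * 'rV[R]_k) (z0 : nat -> R * 'rV[R]_k) (N0 : nat) :
    'M[R]_(N1, M.+1) :=
  \matrix_(i, m)
    if val m is m'.+1
    then (z0 (nth 0%N (neighbours V (z1 i).2 z0 N0) m')).1
    else (z1 i).1 - c.

End matching.

Section permutation_test.
Context (R : realType) (N1 M : nat).

Definition group_perm := {ffun 'I_N1 -> {perm 'I_M.+1}}.

Definition permuted (s : 'M[R]_(N1, M.+1)) (pi : group_perm) :
    'M[R]_(N1, M.+1) :=
  \matrix_(i, m) s i (pi i m).

Definition test_stat (s : 'M[R]_(N1, M.+1)) : R :=
  `| N1%:R^-1 *
     \sum_(i < N1) (s i ord0 - M%:R^-1 * \sum_(j < M) s i (lift ord0 j)) |.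

Definition ordered_stats (s : 'M[R]_(N1, M.+1)) : seq R :=
  sort <=%R [seq test_stat (permuted s pi) | pi : group_perm].

Definition critical_rank (alpha : R) : nat :=
  `|Num.ceil (#|{: group_perm}|%:R * (1 - alpha))|%N.

(* Order statistics are numbered from 1 and nth from 0. *)
Definition perm_test (alpha : R) (s : 'M[R]_(N1, M.+1)) : bool :=
  nth 0 (ordered_stats s) (critical_rank alpha).-1 < test_stat s.

End permutation_test.

(* Main.v *)
Require Import Defs.
From HB Require Import structures.
From mathcomp Require Import all_boot all_order all_algebra all_fingroup.
From mathcomp Require Import all_classical all_reals all_analysis measurable_realfun.
From mathcomp Require Import ring lra.

Set Implicit Arguments.
Unset Strict Implicit.
Unset Printing Implicit Defensive.

Import Order.TTheory GRing.Theory Num.Theory.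
Import numFieldNormedType.Exports.

Local Open Scope classical_set_scope.
Local Open Scope ring_scope.

(** Fix the covariates of all the observations. By CIA, by the homogeneity
    assumption and because [f1 / f0] is a density ratio on the support of the
    treated, the shifted treated outcomes [Y_i - c] and the control outcomes
    have, for every test function [h], the same regression [hh] on the
    covariates, and [hh] is continuous on the support of [X]. Almost surely the
    controls visit every neighbourhood of every treated covariate infinitely
    often, so that the [M] nearest neighbours of [X_i] converge to [X_i]; as the
    treated covariates are distinct, the matches of distinct treated units are
    eventually distinct. Hence the joint moments
    [E (\prod_(i, m) h_(i, m) (S_(i, m)))] of the matched sample converge to
    [E (\prod_(i, m) hh_(i, m) (X_i))], which does not change when each row is
    permuted: the matched sample is asymptotically exchangeable within rows.
    For a rowwise exchangeable sample the test has level [alpha] by counting.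
    The test is not a continuous function of the sample, but it lies above a
    Lipschitz approximation from which it differs only if two values of the
    statistic are close. This forces a linear form involving some treated
    outcome to be small, and this has small probability because the conditional
    law of the outcome is atomless. *)

(** * Weighted laws and independence *)

(** Nothing is conditioned on directly. The matching is a function of the covariates, so each event
    on which it equals a given finite map lies in the sigma-algebra generated by the covariates, and
    replacing outcomes by regressions only requires equal integrals over such events. The
    replacement fails when a control serves two cells, since the regression of a product is in
    general not the product of the regressions; hence the restriction to injective matchings. The
    smoothing is used asymmetrically: the counting bound is applied to the permuted samples, where
    the smooth test lies below the test, and the opposite comparison, with its error, only concerns
    the original sample. That error must be bounded uniformly in the number of controls. Treated
    outcomes allow this, because a form whose coefficients at all treated outcomes vanish is
    identically zero, and then the two statistics are equal; otherwise the bound is the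
    concentration function of the law of the outcome given the covariates, integrated over the
    covariates. *)

Section weighted_law.
Import HBSimple HBNNSimple.
Context (R : realType) d1 d2 d (S1 : measurableType d1) (S2 : measurableType d2)
  (T : measurableType d).
Context (mu1 : {measure set S1 -> \bar R}) (mu2 : {measure set S2 -> \bar R}).
Context (g1 : S1 -> R) (g2 : S2 -> R) (Z1 : S1 -> T) (Z2 : S2 -> T).
Hypotheses (mg1 : measurable_fun setT g1) (mg2 : measurable_fun setT g2).
Hypotheses (mZ1 : measurable_fun setT Z1) (mZ2 : measurable_fun setT Z2).
Hypotheses (g1_ge0 : forall x, 0 <= g1 x) (g2_ge0 : forall x, 0 <= g2 x).

(** Equality on indicators passes to simple functions by linearity and to [h] by monotone
    convergence. The two sides may live on different spaces, and the weights carry whatever else is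
    multiplied with [h]. *)
Lemma weighted_law_ext (h : T -> R) :
  measurable_fun setT h -> (forall z, 0 <= h z) ->
  (forall A, measurable A -> (\int[mu1]_x (g1 x * \1_A (Z1 x))%:E =
                              \int[mu2]_x (g2 x * \1_A (Z2 x))%:E)%E) ->
  (\int[mu1]_x (g1 x * h (Z1 x))%:E = \int[mu2]_x (g2 x * h (Z2 x))%:E)%E.
Proof.
move=> mh h0 H.
have mEh : measurable_fun setT (EFin \o h : T -> \bar R) by exact/measurable_EFinP.
pose hn := nnsfun_approx measurableT mEh.
have E0 (x : T) : [set: T] x -> (0 <= (EFin \o h) x)%E.
  by move=> _; rewrite lee_fin.
have cvh z : EFin (hn n z) @[n --> \oo] --> (h z)%:E.
  exact: (cvg_nnsfun_approx measurableT mEh E0).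
have ndh z : {homo (fun n => hn n z) : n m / (n <= m)%N >-> (n <= m)%R}.
  by move=> n m nm; exact/lefP/nd_nnsfun_approx.
have step d0 (S0 : measurableType d0) (mu0 : {measure set S0 -> \bar R})
    (g0 : S0 -> R) (Z0 : S0 -> T) : measurable_fun setT g0 ->
    measurable_fun setT Z0 -> (forall x, 0 <= g0 x) -> forall n,
    (\int[mu0]_x (g0 x * hn n (Z0 x))%:E =
     \sum_(y \in range (hn n)) (y%:E *
        \int[mu0]_x (g0 x * \1_(hn n @^-1` [set y]) (Z0 x))%:E))%E.
  move=> mg mZ g0_ge0 n.
  have mI A : measurable A -> measurable_fun setT (fun x => g0 x * \1_A (Z0 x)).
    move=> mA; apply: measurable_funM => //.
    exact: (measurableT_comp (measurable_indic mA)).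
  transitivity (\int[mu0]_x (\sum_(y \in range (hn n))
      (y * (g0 x * \1_(hn n @^-1` [set y]) (Z0 x)))%:E))%E.
    apply: eq_integral => x _; rewrite fsumEFin; last exact: fimfunP.
    congr EFin; rewrite (fimfunE (hn n)).
    rewrite [LHS](mulr_fsumr (g0 x)); apply: eq_fsbigr => y _.
    by rewrite mulrCA.
  rewrite ge0_integral_fsum//; last 2 first.
  - move=> y; apply/measurable_EFinP; apply: measurable_funM => //.
    exact: mI.
  - move=> y x _; rewrite lee_fin; have [y0|y0] := leP 0 y.
      by rewrite !mulr_ge0// indicE.
    rewrite indicE; case: (boolP (_ \in _)) => [|_]; last by rewrite !mulr0.
    rewrite inE/= => E; move: y0; rewrite -E ltNge.
    by rewrite (_ : 0 <= _)//; exact: fun_ge0.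
  apply: eq_fsbigr => y; rewrite inE => -[t _ ht].
  rewrite -ge0_integralZl//.
  - by apply/measurable_EFinP; exact: mI.
  - by move=> x _; rewrite lee_fin mulr_ge0// indicE.
  - by rewrite lee_fin -ht; exact: fun_ge0.
have key d0 (S0 : measurableType d0) (mu0 : {measure set S0 -> \bar R})
    (g0 : S0 -> R) (Z0 : S0 -> T) : measurable_fun setT g0 ->
    measurable_fun setT Z0 -> (forall x, 0 <= g0 x) ->
    (\int[mu0]_x (g0 x * h (Z0 x))%:E =
     limn (fun n => \int[mu0]_x (g0 x * hn n (Z0 x))%:E))%E.
  move=> mg mZ g0_ge0; rewrite -monotone_convergence//.
  - apply: eq_integral => x _; apply/esym/cvg_lim => //.
    under eq_fun do rewrite EFinM.
    rewrite EFinM; apply: cvgeZl => //; exact: cvh.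
  - move=> n; apply/measurable_EFinP; apply: measurable_funM => //.
    exact: measurableT_comp.
  - by move=> n x _; rewrite lee_fin mulr_ge0//; exact: fun_ge0.
  - by move=> x _ n m nm; rewrite lee_fin ler_wpM2l// ndh.
rewrite !key//; congr (limn _); apply/funext => n.
rewrite !step//; apply: eq_fsbigr => y _; rewrite H//.
Qed.

End weighted_law.

Section weighted_measure.
Context d (T : measurableType d) (R : realType) (mu : {measure set T -> \bar R}).
Variables (f : T -> R) (mf : measurable_fun setT f) (f0 : forall x, 0 <= f x).

(** The measure with density [f] with respect to [mu]. The two proofs are arguments so that the
    measure structure can be attached to the constant. *)
Definition weighted of measurable_fun setT f & (forall x, 0 <= f x) :
  set T -> \bar R := fun A => (\int[mu]_(x in A) (f x)%:E)%E.

Local Notation nu := (weighted mf f0).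

Let weighted0 : nu set0 = 0%E. Proof. exact: integral_set0. Qed.

Let weighted_ge0 A : (0 <= nu A)%E.
Proof. by apply: integral_ge0 => x _; rewrite lee_fin. Qed.

Let weighted_sigma_additive : semi_sigma_additive nu.
Proof.
apply: semi_sigma_additive_nng_induced; first exact/measurable_EFinP.
by move=> x; rewrite lee_fin.
Qed.

HB.instance Definition _ := isMeasure.Build _ _ _ nu
  weighted0 weighted_ge0 weighted_sigma_additive.

End weighted_measure.

Lemma integral_indicM d (T : measurableType d) (R : realType)
    (mu : {measure set T -> \bar R}) (f : T -> R) (A : set T) :
  (\int[mu]_x (f x * \1_A x)%:E = \int[mu]_(x in A) (f x)%:E)%E.
Proof.
rewrite [RHS]integral_mkcond; apply: eq_integral => x _.
rewrite patchE indicE; case: ifPn; rewrite ?mulr1 ?mulr0//.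
Qed.

Section independence.
Context (R : realType) d d' (S : measurableType d) (T : measurableType d').
Context (Q : probability S R) (I : choiceType) (Z : I -> {RV Q >-> T}).
Hypothesis indep : mutually_independent Q (fun i => Z i : S -> T).

Lemma prod_indic (s : seq I) (A : I -> set S) x :
  \prod_(i <- s) \1_(A i) x = \1_(\bigcap_(i in [set` s]) A i) x :> R.
Proof.
rewrite bigcap_seq; elim: s => [|a s IH]; first by rewrite !big_nil indicT.
by rewrite !big_cons IH indicI.
Qed.

(** Independence is given for events only. The induction turns the functions indexed by [s2] into
    indicators one at a time: if [g a] is an indicator, its index moves to [s1] and the induction
    hypothesis applies; the general [g a] follows by [weighted_law_ext], the other factors being the
    weight. *)
Lemma integral_prod_independent (s1 s2 : seq I) (B : I -> set T)
    (g : I -> T -> R) (e : I -> R) :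
  uniq (s1 ++ s2) -> (forall i, measurable (B i)) ->
  (forall i, measurable_fun setT (g i)) -> (forall i z, 0 <= g i z) ->
  (forall i, (\int[Q]_x (g i (Z i x))%:E = (e i)%:E)%E) ->
  (\int[Q]_x (\prod_(i <- s1) \1_(B i) (Z i x) *
     \prod_(i <- s2) g i (Z i x))%:E =
   (\prod_(i <- s1) fine (Q (Z i @^-1` B i)) * \prod_(i <- s2) e i)%:E)%E.
Proof.
move=> + + mg g0 ge; have e0 i : 0 <= e i.
  by rewrite -lee_fin -ge; apply: integral_ge0 => x _; rewrite lee_fin.
have mI i A : measurable A -> measurable_fun setT (fun x => \1_A (Z i x) : R).
  by move=> mA; apply: (measurableT_comp (measurable_indic mA)).
elim: s2 s1 B => [|a s2 IH] s1 B.
  rewrite cats0 => us mB; rewrite big_nil mulr1.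
  under eq_integral.
    move=> x _; rewrite big_nil mulr1.
    have -> : \prod_(i <- s1) \1_(B i) (Z i x) =
      \prod_(i <- s1) \1_(Z i @^-1` B i) x :> R by [].
    rewrite prod_indic; over.
  rewrite integral_indic//; last first.
    by apply: fin_bigcap_measurable => // i _; exact: measurable_funPTI.
  rewrite setIT [LHS](indep us mB); elim: (s1) => [|b s IHs]; first by rewrite !big_nil.
  rewrite !big_cons IHs EFinM fineK// fin_num_measure//.
  exact: measurable_funPTI.
move=> us mB; set C := (\prod_(i <- s1) fine (Q (Z i @^-1` B i)) *
  \prod_(i <- s2) e i).
have C0 : 0 <= C by apply: mulr_ge0; apply: prodr_ge0 => i _ //; exact: fine_ge0.
pose g1 x := \prod_(i <- s1) \1_(B i) (Z i x) * \prod_(i <- s2) g i (Z i x).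
have mg1 : measurable_fun setT g1.
  apply: measurable_funM; apply: measurable_prod => i _.
    exact: mI.
  exact: measurableT_comp.
have g10 x : 0 <= g1 x.
  by apply: mulr_ge0; apply: prodr_ge0.
have := @weighted_law_ext _ _ _ _ _ _ _ Q Q g1 (cst C) (Z a) (Z a) mg1
  (measurable_cst _) (measurable_funPT (Z a)) (measurable_funPT (Z a)) g10 (fun=> C0)
  (g a) (mg a) (g0 a).
move=> H; transitivity (\int[Q]_x (g1 x * g a (Z a x))%:E)%E.
  apply: eq_integral => x _; rewrite big_cons /g1; congr EFin.
  by rewrite -!mulrA [X in _ = _ * X]mulrC.
rewrite H.
  under eq_integral do rewrite /= EFinM.
  rewrite ge0_integralZl//; last 2 first.
  - by apply/measurable_EFinP; exact: measurableT_comp.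
  - by move=> x _; rewrite lee_fin.
  by rewrite ge -EFinM /C big_cons -!mulrA [X in (_ * X)%:E]mulrC.
move=> A mA.
have un : uniq ((a :: s1) ++ s2) by rewrite -(perm_uniq (_ : perm_eq (s1 ++ a :: s2) _))// cat_cons perm_catC/= perm_cons perm_catC.
(* Since [a] does not occur in [s1], the new event at [a] leaves the other factors unchanged. *)
pose B' i := if i == a then A else B i.
have B's1 i : i \in s1 -> B' i = B i.
  rewrite /B'; case: eqP => // -> as1; move: un.
  by rewrite cat_cons/= mem_cat as1.
have mB' i : measurable (B' i) by rewrite /B'; case: ifP.
have E := IH (a :: s1) B' un mB'.
transitivity (\int[Q]_x (\prod_(i <- a :: s1) \1_(B' i) (Z i x) * \prod_(i <- s2) g i (Z i x))%:E)%E.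
  apply: eq_integral => x _; congr EFin.
  rewrite big_cons (_ : B' a = A); last by rewrite /B' eqxx.
  rewrite (_ : \prod_(i <- s1) \1_(B' i) (Z i x) = \prod_(i <- s1) \1_(B i) (Z i x)).
    by rewrite -mulrA mulrC.
  by apply: eq_big_seq => i /B's1 ->.
rewrite E big_cons (_ : B' a = A); last by rewrite /B' eqxx.
rewrite (_ : \prod_(i <- s1) _ = \prod_(i <- s1) fine (Q (Z i @^-1` B i))); last first.
  by apply: eq_big_seq => i /B's1 ->.
rewrite -mulrA -/C.
under [RHS]eq_integral do rewrite /= EFinM.
rewrite ge0_integralZl//; last first.
  by apply/measurable_EFinP; exact: mI.
rewrite (_ : (fun x => (\1_A (Z a x))%:E) = (fun x => (\1_(Z a @^-1` A) x)%:E))//.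
rewrite integral_indic//; last exact: measurable_funPTI.
rewrite setIT [RHS]muleC EFinM fineK// fin_num_measure//.
exact: measurable_funPTI.
Qed.

End independence.

Section integral_unit.
Context d (T : measurableType d) (R : realType) (P : probability T R) (f : T -> R).
Hypotheses (mf : measurable_fun setT f) (f01 : forall x, 0 <= f x <= 1).

Lemma integral_unit_le1 : (\int[P]_x (f x)%:E <= 1)%E.
Proof.
have -> : 1%E = (\int[P]_x (cst 1%E x))%E.
  by rewrite integral_cst// mul1e; apply/esym/probability_setT.
apply: ge0_le_integral => //.
- by move=> x _; rewrite lee_fin; case/andP: (f01 x).
- exact/measurable_EFinP.
- by move=> x _; rewrite lee_fin; case/andP: (f01 x).
Qed.

Lemma integral_unit_fin_num : (\int[P]_x (f x)%:E)%E \is a fin_num.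
Proof.
rewrite ge0_fin_numE; first exact: (le_lt_trans integral_unit_le1 (ltry 1)).
by apply: integral_ge0 => x _; rewrite lee_fin; case/andP: (f01 x).
Qed.

End integral_unit.

(** * Integrals over events generated by the covariates *)

Section conditional_independence.
Context (R : realType) d d1 d2 (S : measurableType d) (T : measurableType d1)
  (T' : measurableType d2) (Q : probability S R) (I : finType).
Context (Z : I -> {RV Q >-> T}) (pX : I -> T -> T') (mpX : forall i, measurable_fun setT (pX i)).
Hypothesis indep : mutually_independent Q (fun i => Z i : S -> T).

Definition rectangles : set (set S) :=
  [set A | exists2 B : I -> set T', (forall i, measurable (B i)) &
    A = \bigcap_(i in [set: I]) ((pX i \o Z i) @^-1` B i)].

(** [S] with the sigma-algebra generated by the [pX i \o Z i]. Being an event of the covariates is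
    measurability in this type, so that lemmas about arbitrary measurable types apply to it. *)
Definition cov_space := g_sigma_algebraType rectangles.

Lemma measurable_cov i : measurable_fun [set: cov_space] (pX i \o Z i : cov_space -> T').
Proof.
move=> _ B mB; rewrite setTI; apply: sub_sigma_algebra.
exists (fun j => if j == i then B else setT) => [j|]; first by case: ifP.
apply/seteqP; split=> [x Bx j _|x /(_ i Logic.I)]; last by rewrite /= eqxx; apply.
by rewrite /preimage/=; case: eqP => // ->.
Qed.

Lemma cov_space_measurable (A : set S) : measurable (A : set cov_space) -> measurable A.
Proof.
apply: smallest_sub; first exact: sigma_algebra_measurable.
move=> _ [B mB ->]; apply: fin_bigcap_measurable => // i _.
rewrite -[X in measurable X]setTI; exact: (measurableT_comp (mpX i)).
Qed.

Variables a b : I -> T -> R.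
Hypotheses (ma : forall i, measurable_fun setT (a i))
  (mb : forall i, measurable_fun setT (b i)).
Hypotheses (a01 : forall i z, 0 <= a i z <= 1) (b01 : forall i z, 0 <= b i z <= 1).
Hypothesis ab : forall i (B : set T'), measurable B ->
  (\int[Q]_x (a i (Z i x) * \1_B (pX i (Z i x)))%:E =
   \int[Q]_x (b i (Z i x) * \1_B (pX i (Z i x)))%:E)%E.

(** The hypothesis [ab] says that [a i] and [b i] have the same conditional expectation given the
    covariate of [i]. By independence the integrals factor over rectangles, so the two sides are
    finite measures that agree on a pi-system generating the sigma-algebra. *)
Lemma integral_prod_conditional (A : set S) : measurable (A : set cov_space) ->
  (\int[Q]_x ((\prod_i a i (Z i x)) * \1_A x)%:E =
   \int[Q]_x ((\prod_i b i (Z i x)) * \1_A x)%:E)%E.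
Proof.
have mp (f : I -> T -> R) : (forall i, measurable_fun setT (f i)) ->
    measurable_fun setT (fun x => \prod_i f i (Z i x)).
  by move=> mf; apply: measurable_prod => i _; exact: measurableT_comp.
have ge0 (f : I -> T -> R) : (forall i z, 0 <= f i z <= 1) ->
    forall x, 0 <= \prod_i f i (Z i x).
  by move=> f01 x; apply: prodr_ge0 => i _; case/andP: (f01 i (Z i x)).
have le1 (f : I -> T -> R) : (forall i z, 0 <= f i z <= 1) ->
    forall x, \prod_i f i (Z i x) <= 1.
  by move=> f01 x; apply: prodr_ile1 => i _; exact: f01.
move=> mA; rewrite !integral_indicM.
pose m1 := weighted Q (mp _ ma) (ge0 _ a01).
pose m2 := weighted Q (mp _ mb) (ge0 _ b01).
apply: (@g_sigma_algebra_measure_unique _ R S rectangles _ (fun=> setT) _ _ m1 m2).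
- move=> B GB; apply: cov_space_measurable; exact: sub_sigma_algebra.
- move=> _; exists (fun=> setT) => //.
  by apply/seteqP; split.
- by rewrite bigcup_const.
- move=> _ _ [B mB ->] [C mC ->]; exists (fun i => B i `&` C i).
    by move=> i; exact: measurableI.
  by rewrite -bigcapI.
- move=> _ [B mB ->]; apply: (etrans (esym (integral_indicM Q (fun x => \prod_i a i (Z i x)) _))).
  apply: (etrans _ (integral_indicM Q (fun x => \prod_i b i (Z i x)) _)).
  have E (f : I -> T -> R) x : (\prod_i f i (Z i x)) *
      \1_(\bigcap_(i in [set: I]) ((pX i \o Z i) @^-1` B i)) x =
      \prod_i (f i (Z i x) * \1_(B i) (pX i (Z i x))).
    rewrite big_split/=; congr (_ * _).
    rewrite (_ : [set: I] = [set` index_enum I]).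
      by rewrite -prod_indic.
    by apply/seteqP; split=> // i _ /=; rewrite mem_index_enum.
  under eq_integral do rewrite E.
  under [RHS]eq_integral do rewrite E.
  have mfB (f : I -> T -> R) i : measurable_fun setT (f i) ->
      measurable_fun setT (fun z => f i z * \1_(B i) (pX i z)).
    by move=> mf; apply: measurable_funM => //; exact: (measurableT_comp (measurable_indic (mB i))).
  have f0 (f : I -> T -> R) : (forall i z, 0 <= f i z <= 1) -> forall i z,
      0 <= f i z * \1_(B i) (pX i z) <= 1.
    move=> f01 i z; have /andP[? ?] := f01 i z; rewrite indicE.
    by case: (_ \in _); rewrite ?mulr1 ?mulr0 ?lexx ?ler01 ?f01.
  have fin (f : I -> T -> R) : (forall i, measurable_fun setT (f i)) -> (forall i z, 0 <= f i z <= 1) -> forall i,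
      (\int[Q]_x (f i (Z i x) * \1_(B i) (pX i (Z i x)))%:E =
      (fine (\int[Q]_x (f i (Z i x) * \1_(B i) (pX i (Z i x)))%:E))%:E)%E.
    move=> mf f01 i; rewrite fineK//.
    apply: (integral_unit_fin_num Q (f := fun x => f i (Z i x) * \1_(B i) (pX i (Z i x)))) => [|x]; last exact: f0.
    exact: (measurableT_comp (mfB f i (mf i))).
  have main (f : I -> T -> R) : (forall i, measurable_fun setT (f i)) -> (forall i z, 0 <= f i z <= 1) ->
     (\int[Q]_x (\prod_i (f i (Z i x) * \1_(B i) (pX i (Z i x))))%:E =
      (\prod_i fine (\int[Q]_x (f i (Z i x) * \1_(B i) (pX i (Z i x)))%:E))%:E)%E.
    move=> mf f01.
    have pos i z : 0 <= f i z * \1_(B i) (pX i z) by case/andP: (f0 f f01 i z).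
    have E0 := @integral_prod_independent R _ _ S T Q I Z indep [::]
      (index_enum I) (fun=> setT) (fun i z => f i z * \1_(B i) (pX i z)) _
      (index_enum_uniq I) (fun=> measurableT) (fun i => mfB f i (mf i)) pos
      (fin f mf f01).
    rewrite [in RHS]big_nil mul1r in E0; rewrite -E0.
    by apply: eq_integral => x _; rewrite big_nil mul1r.
  rewrite !main//; congr EFin; apply: eq_bigr => i _; rewrite ab//.
- move=> k; rewrite /m1 /weighted; apply: le_lt_trans (ltry 1).
  apply: (integral_unit_le1 Q (f := fun x => \prod_i a i (Z i x))) => [|x]; first exact (mp _ ma).
  by apply/andP; split; [exact (ge0 _ a01 x)|exact (le1 _ a01 x)].
- exact: mA.
Qed.

End conditional_independence.

(** * Concentration of atomless kernels *)

Section concentration.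
Context (R : realType) (P : probability R R).
Hypothesis P_atomless : forall y : R, P [set y] = 0%E.

Let D (m : nat) : set (R * R) := [set z | `|z.1 - z.2| < 4 * m.+1%:R^-1].

Let mD m : measurable (D m).
Proof.
rewrite -[D m]setTI (_ : D m = (fun z : R * R => `|z.1 - z.2|) @^-1` `]-oo, (4 * m.+1%:R^-1)[).
  by apply: (measurableT_comp (@normr_measurable R setT)) => //; apply: measurable_funB.
by apply/seteqP; split=> z /=; rewrite in_itv.
Qed.

Let PPfin A : measurable A -> (P \x P)%E A \is a fin_num.
Proof.
move=> mA; rewrite ge0_fin_numE//; apply: (@le_lt_trans _ _ 1%E); last exact: ltry.
have -> : 1%E = (P \x P)%E [set: R * R].
  by rewrite -setXTT product_measure1E// -[LHS]mule1 -{1}(probability_setT P) -(probability_setT P).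
by apply: le_measure; rewrite ?inE.
Qed.

(** By Fubini the diagonal has mass zero, its sections being points; the strips [D m] decrease to
    it. *)
Let D_cvg : (fun m => (P \x P)%E (D m)) @ \oo --> 0%E.
Proof.
have mcap : measurable (\bigcap_m D m) by exact: bigcapT_measurable.
have -> : 0%E = (P \x P)%E (\bigcap_m D m).
  apply/esym/integral0_eq => x _ /=.
  apply/eqP; rewrite eq_le measure_ge0 andbT -(P_atomless x).
  apply: le_measure; rewrite ?inE//; first exact: (measurable_xsection x mcap).
  move=> y; rewrite /xsection/= inE/= => xy.
  apply/eqP; rewrite eq_sym -subr_eq0 -normr_le0; apply/ler_addgt0Pl => e e0.
  rewrite addr0.
  have [m _ /(_ m (leqnn m)) H] := near_infty_natSinv_lt (PosNum (divr_gt0 e0 (ltr0n R 4))).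
  have := xy m Logic.I; rewrite /D/= => /ltW/le_trans; apply.
  by rewrite mulrC -ler_pdivlMr ?ltW.
apply: nonincreasing_cvg_mu => //.
  by rewrite ltey_eq PPfin.
move=> m n mn; apply/subsetPset => z; rewrite /D/= => /lt_le_trans; apply.
by rewrite ler_pM2l// lef_pV2 ?posrE// ler_nat.
Qed.

(** The bound is uniform in the centre because the square of any ball of radius [2 / (m + 1)] lies
    in the strip [D m], so that the squared mass of the ball is at most the mass of the strip. *)
Lemma atomless_concentration (e : R) : 0 < e ->
  \forall m \near \oo, forall c, (P (ball c (2 * m.+1%:R^-1)) <= e%:E)%E.
Proof.
move=> e0.
have ee0 : 0 < e * e by rewrite mulr_gt0.
have /fine_cvgP[_ /cvgrPdist_lt/(_ _ ee0)] := D_cvg.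
move=> [m0 _ mP]; exists m0 => // m m0m c.
have := mP m m0m; rewrite sub0r normrN => Dlt.
have fD : ((P \x P)%E (D m)) \is a fin_num by rewrite PPfin.
rewrite ger0_norm ?fine_ge0// in Dlt.
set B := ball c _; have mB : measurable B by exact: measurable_ball.
have fB : P B \is a fin_num by rewrite fin_num_measure.
have : ((P \x P)%E (B `*` B) <= (P \x P)%E (D m))%E.
  apply: le_measure; rewrite ?inE//; first exact: measurableX.
  move=> [x y] []; rewrite /B /ball/= /D/= => xc yc.
  rewrite (_ : x - y = (c - y) - (c - x)); last by ring.
  apply: (le_lt_trans (ler_normB _ _)).
  by move: xc yc; set t := (_^-1) => xc yc; lra.
have -> : (P \x P)%E (B `*` B) = (fine (P B) * fine (P B))%:E.
  by transitivity (P B * P B)%E; [exact: product_measure1E|rewrite EFinM fineK].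
rewrite -(fineK fB) -(fineK fD) !lee_fin => H.
rewrite leNgt; apply/negP => eP; move: (le_lt_trans H Dlt).
by apply/negP; rewrite -leNgt ler_pM// ltW.
Qed.

End concentration.

Lemma unit_dominated_cvg d (T : measurableType d) (R : realType)
    (P : probability T R) (f_ : nat -> T -> R) (f : T -> R) :
  (forall n, measurable_fun setT (f_ n)) -> measurable_fun setT f ->
  (forall n x, 0 <= f_ n x <= 1) ->
  {ae P, forall x, f_ n x @[n --> \oo] --> f x} ->
  (\int[P]_x (f_ n x)%:E)%E @[n --> \oo] --> (\int[P]_x (f x)%:E)%E.
Proof.
move=> mf_ mf f01 ff.
have [//|||||_ _] := @dominated_convergence _ T R P setT measurableT
  (fun n x => (f_ n x)%:E) (fun x => (f x)%:E) (cst 1%E).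
- by move=> n; exact/measurable_EFinP.
- exact/measurable_EFinP.
- by apply: filterS ff => x fx _; apply/fine_cvgP; split; [exact: nearW|exact: fx].
- exact: (finite_measure_integrable_cst P 1 measurableT).
- apply: aeW => x n _; have /andP[? ?] := f01 n x.
  by rewrite abse_EFin lee_fin ger0_norm.
- by [].
Qed.

Section pker_at.
Context d (V : measurableType d) d' (T : measurableType d') (R : realType).
Variables (kappa : R.-pker V ~> T) (x : V).

(** [kappa x] under a name of its own, to which the structure of a probability can be attached. *)
Definition pker_at : set T -> \bar R := kappa x.

HB.instance Definition _ := Measure.on pker_at.

Let pker_at_setT : pker_at setT = 1%E. Proof. exact: prob_kernel. Qed.

HB.instance Definition _ := Measure_isProbability.Build _ _ _ pker_at
  pker_at_setT.

End pker_at.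

Section conditional_concentration.
Context (R : realType) d (Omega : measurableType d) (P : probability Omega R)
  d' (V : measurableType d') (X : {mfun Omega >-> V}) (Y : Omega -> R)
  (mY : measurable_fun setT Y) (kappa : R.-pker V ~> R).
Hypothesis YX : is_cond_distribution P X Y kappa.

(** With centres at the multiples of [e] and radius [2 * e], every ball of radius [e] lies in some
    grid ball. The grid is countable, which makes the supremum below measurable in [x]. Indices that
    do not code an integer give the empty set. *)
Definition grid_ball (e : R) (n : nat) : set R :=
  if pickle_inv n is Some z then ball (z%:~R * e) (2 * e) else set0.

(** The Levy concentration function of [kappa x], taken over grid balls. *)
Definition concentration (e : R) (x : V) : \bar R :=
  esups (fun n => kappa x (grid_ball e n)) 0.

Lemma measurable_grid_ball e n : measurable (grid_ball e n).
Proof.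
by rewrite /grid_ball; case: pickle_inv => [z|//]; exact: measurable_ball.
Qed.

Lemma measurable_concentration e : measurable_fun setT (concentration e).
Proof.
apply: measurable_fun_esups => n.
exact: (measurable_kernel kappa (grid_ball e n) (measurable_grid_ball e n)).
Qed.

Lemma le_concentration e n x : (kappa x (grid_ball e n) <= concentration e x)%E.
Proof. by apply: ereal_sup_ubound; exists n. Qed.

Lemma concentration01 e x : (0 <= concentration e x <= 1)%E.
Proof.
apply/andP; split; first exact: le_trans (le_concentration e 0 x).
apply: ge_ereal_sup => _ [n _ <-].
rewrite -(@prob_kernel _ _ _ _ _ kappa x).
by apply: le_measure; rewrite ?inE//; exact: measurable_grid_ball.
Qed.

(** The centre [r (X w)] is random, but where [Num.floor (r x / e)] is fixed a single grid ball
    contains the whole window. These cells are disjoint in [x], so summing over them gives the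
    integral. *)
Lemma concentration_bound (r : V -> R) (e : R) : 0 < e -> measurable_fun setT r ->
  (P [set w | (`|Y w - r (X w)| < e)%R] <=
   \int[distribution P X]_x concentration e x)%E.
Proof.
move=> e0 mr.
pose D n := if pickle_inv n is Some z then [set x | Num.floor (r x / e) = z] else set0.
have mD n : measurable (D n).
  rewrite /D; case: pickle_inv => [z|//].
  rewrite (_ : [set x | _] = r @^-1` [set` `[z%:~R * e, (z + 1)%:~R * e[]).
    by rewrite -[X in measurable X]setTI; apply: mr.
  apply/seteqP; split=> x /=; rewrite in_itv/= -ler_pdivlMr// -ltr_pdivrMr//.
    by move=> <-; rewrite floor_le floorD1_gt.
  by rewrite -floor_ge_int -floor_lt_int ltzD1 => H; apply/eqP; rewrite eq_le andbC.
pose E n := X @^-1` D n `&` Y @^-1` grid_ball e n.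
have mE n : measurable (E n).
  apply: measurableI; first exact: measurable_funPTI.
  by rewrite -[X in measurable X]setTI; apply: mY => //; exact: measurable_grid_ball.
have mS : measurable [set w | `|Y w - r (X w)| < e].
  rewrite (_ : [set w | _] = (fun w => `|Y w - r (X w)|) @^-1` [set` `]-oo, e[]).
    rewrite -[X in measurable X]setTI.
    apply: (measurableT_comp (@normr_measurable R setT)) => //; apply: measurable_funB => //.
    exact: measurableT_comp.
  by apply/seteqP; split=> w /=; rewrite in_itv.
have sub : [set w | `|Y w - r (X w)| < e] `<=` \bigcup_n E n.
  move=> w /= we; pose z := Num.floor (r (X w) / e).
  have [n nz] : exists n, pickle_inv n = Some z by exists (pickle z); rewrite pickleK_inv.
  exists n => //; split; rewrite /preimage /D /grid_ball nz//= /ball/=.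
  have : z%:~R * e <= r (X w) < (z + 1)%:~R * e.
    by rewrite -ler_pdivlMr// -ltr_pdivrMr// floor_le floorD1_gt.
  rewrite intrD mulrDl mul1r; move: we; set a := z%:~R * e.
  by rewrite !ltr_norml => /andP[? ?] /andP[? ?]; apply/andP; split; lra.
have le1 : (P [set w | (`|Y w - r (X w)| < e)%R] <= \sum_(n <oo) P (E n))%E.
  exact: measure_sigma_subadditive.
apply: (le_trans le1).
have tD : trivIset setT D.
  move=> i j _ _ [x []]; rewrite /D.
  have := @pickle_invK int i; have := @pickle_invK int j.
  case: pickle_inv => [zj|] //=; case: pickle_inv => [zi|] //= <- <- <- <-//.
have mcD : measurable (\bigcup_n D n) by exact: bigcupT_measurable.
apply: (@le_trans _ _ (\int[distribution P X]_(x in \bigcup_n D n) concentration e x)%E); last first.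
  apply: ge0_subset_integral => //; first exact: measurable_concentration.
  by move=> x _; case/andP: (concentration01 e x).
rewrite ge0_integral_bigcup//.
- apply: lee_nneseries => n _//; rewrite /E YX//; last exact: measurable_grid_ball.
  apply: ge0_le_integral => //.
  + apply: measurable_funTS.
    exact: (measurable_kernel kappa (grid_ball e n) (measurable_grid_ball e n)).
  + exact: measurable_funTS (measurable_concentration _).
  + by move=> x _; exact: le_concentration.
- exact: measurable_funTS (measurable_concentration _).
- by move=> x _; case/andP: (concentration01 e x).
Qed.

Hypothesis kappa_atomless :
  {ae distribution P X, forall x, forall y : R, kappa x [set y] = 0%E}.

(** For [e = 1 / (m + 1)] the grid balls have the radius of [atomless_concentration], which gives
    the pointwise limit; the bound by [1] gives domination. *)
Lemma concentration_cvg0 :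
  (\int[distribution P X]_x concentration m.+1%:R^-1 x)%E @[m --> \oo] --> 0%E.
Proof.
have fK e x : (fine (concentration e x))%:E = concentration e x.
  rewrite fineK// fin_real//; have /andP[c0 c1] := concentration01 e x.
  by rewrite (lt_le_trans _ c0)// (le_lt_trans c1)// ltry.
have := @unit_dominated_cvg _ _ _ (distribution P X)
  (fun m x => fine (concentration m.+1%:R^-1 x)) (cst 0).
rewrite (_ : \int[distribution P X]_x (cst 0 x)%:E = 0)%E; last exact: integral0.
rewrite (_ : (fun n => \int[_]_x _)%E =
    (fun m => \int[distribution P X]_x concentration m.+1%:R^-1 x)%E); last first.
  by apply/funext => m; apply: eq_integral => x _; rewrite fK.
apply.
- move=> n; apply: measurableT_comp => //; exact: measurable_concentration.
- exact: measurable_cst.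
- by move=> n x; rewrite -!lee_fin fK; exact: concentration01.
apply: filterS kappa_atomless => x kx.
apply/cvgrPdist_le => e e0.
apply: filterS (atomless_concentration (P := pker_at kappa x) kx e0) => m me.
rewrite sub0r normrN ger0_norm; last first.
  by rewrite fine_ge0//; case/andP: (concentration01 m.+1%:R^-1 x).
rewrite -lee_fin fK; apply: ge_ereal_sup => _ [n _ <-].
rewrite /grid_ball; case: pickle_inv => [z|]; first exact: me.
by rewrite measure0 lee_fin ltW.
Qed.

End conditional_concentration.

Lemma probability_integral_cst d (T : measurableType d) (R : realType)
  (P : probability T R) (c : \bar R) : (\int[P]_x c = c)%E.
Proof.
rewrite integral_cst//; transitivity (c * 1)%E; last exact: mule1.
congr (_ * _)%E; exact: probability_setT.
Qed.

(** * Independence of one observation from the others *)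

Section independent_section.
Context (R : realType) d d1 (S : measurableType d) (T : measurableType d1)
  (Q : probability S R) (I : finType).
Context (Z : I -> {RV Q >-> T}) (i0 : I) (t0 : T).
Hypothesis indep : mutually_independent Q (fun i => Z i : S -> T).

Definition forget (i : I) (z : T) : T := if i == i0 then t0 else z.

(* As [forget] is constant at [i0], this is the sigma-algebra of the other [Z i]. *)
Definition others := cov_space Z forget.

Lemma measurable_forget i : measurable_fun setT (forget i).
Proof. by rewrite /forget; case: eqP. Qed.

Lemma measurable_others i : i != i0 -> measurable_fun [set: others] (Z i : others -> T).
Proof.
move=> ii0; have := measurable_cov (Z := Z) (pX := forget) i.
by rewrite (_ : _ \o _ = Z i)// /forget (negbTE ii0).
Qed.

(** The case of [integral_prod_conditional] in which only the factor at [i0] is nontrivial: [forget]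
    is constant there, so the indicator of [B] can be replaced by its probability. *)
Lemma others_independent (A : set S) (B : set T) :
  measurable (A : set others) -> measurable B ->
  (Q (A `&` Z i0 @^-1` B) = Q A * Q (Z i0 @^-1` B))%E.
Proof.
move=> mA mB; have mZB : measurable (Z i0 @^-1` B) by exact: measurable_funPTI.
have mA' := cov_space_measurable measurable_forget mA.
set q := Q (Z i0 @^-1` B); have fq : q \is a fin_num by rewrite fin_num_measure.
have q01 : 0 <= fine q <= 1.
  by rewrite -!lee_fin fineK// measure_ge0 probability_le1.
pose a (i : I) (z : T) : R := if i == i0 then \1_B z else 1.
pose b (i : I) (z : T) : R := if i == i0 then fine q else 1.
have ma i : measurable_fun setT (a i) by rewrite /a; case: eqP => // _; exact: measurable_indic.
have mb i : measurable_fun setT (b i) by rewrite /b; case: eqP.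
have a01 i z : 0 <= a i z <= 1.
  by rewrite /a; case: eqP => // _; rewrite ?ler01 ?lexx// indicE; case: (_ \in _); rewrite ?lexx ?ler01.
have b01 i z : 0 <= b i z <= 1 by rewrite /b; case: eqP => // _; rewrite ?ler01 ?lexx.
have ZB : (\int[Q]_s (\1_B (Z i0 s))%:E = q)%E.
  by rewrite (_ : (fun s => _) = (fun s => (\1_(Z i0 @^-1` B) s)%:E))// integral_indic// setIT.
have ab i (C : set T) : measurable C ->
    (\int[Q]_s (a i (Z i s) * \1_C (forget i (Z i s)))%:E =
     \int[Q]_s (b i (Z i s) * \1_C (forget i (Z i s)))%:E)%E.
  move=> mC; rewrite /a /b /forget; case: eqP => // ->.
  under eq_integral do rewrite mulrC EFinM.
  rewrite ge0_integralZl//; last first.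
    by apply/measurable_EFinP; exact: (measurableT_comp (measurable_indic mB)).
  rewrite ZB; under [RHS]eq_integral do rewrite mulrC.
  by rewrite probability_integral_cst EFinM fineK// muleC.
have Ea s : \prod_i a i (Z i s) = \1_B (Z i0 s).
  by rewrite (bigD1 i0)//= /a eqxx big1 ?mulr1// => i /negbTE ->.
have Eb s : \prod_i b i (Z i s) = fine q.
  by rewrite (bigD1 i0)//= /b eqxx big1 ?mulr1// => i /negbTE ->.
have := @integral_prod_conditional R _ _ _ S T T Q I Z forget measurable_forget indep
  a b ma mb a01 b01 ab A mA.
under eq_integral do rewrite Ea.
under [X in _ = X -> _]eq_integral do rewrite Eb.
under [X in _ = X -> _]eq_integral do rewrite EFinM.
rewrite ge0_integralZl//; last 2 first.
- by apply/measurable_EFinP; exact: measurable_indic.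
- by rewrite lee_fin; case/andP: q01.
rewrite integral_indic// setIT fineK// [X in _ = X -> _]muleC => <-.
rewrite (_ : (fun x => _) = (fun x => (\1_(A `&` Z i0 @^-1` B) x)%:E)).
  by rewrite integral_indic ?setIT//; exact: measurableI.
by apply/funext => s; rewrite indicI mulrC.
Qed.

(** The identity, typed so that [distribution Q idO] is the restriction of [Q] to the sigma-algebra
    of the other observations. *)
Let idO : S -> others := id.

Let m_idO : measurable_fun [set: S] idO.
Proof.
by move=> _ A mA; rewrite setTI; exact (cov_space_measurable measurable_forget mA).
Qed.

HB.instance Definition _ := isMeasurableFun.Build _ _ _ _ idO m_idO.

Let pairO (s : S) : others * T := (idO s, Z i0 s).

Let m_pairO : measurable_fun [set: S] pairO.
Proof. exact: measurable_fun_pair. Qed.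

HB.instance Definition _ := isMeasurableFun.Build _ _ _ _ pairO m_pairO.

(** The other observations and [Z i0] have a product law, so the probability of [E] is the integral
    of the probabilities of its sections. *)
Lemma independent_section_le (E : set (others * T)) (c : \bar R) :
  measurable E -> (forall s, (Q (Z i0 @^-1` xsection E s) <= c)%E) ->
  (Q [set s | E (s, Z i0 s)] <= c)%E.
Proof.
move=> mE Ec.
have := @product_measure_unique _ _ _ _ R (distribution Q idO) (distribution Q (Z i0))
  (distribution Q pairO) _ E mE.
move=> H; rewrite [leLHS](_ : _ = distribution Q pairO E)// -H; last first.
  by move=> A B mA mB; exact: others_independent.
rewrite /product_measure1.
apply: (@le_trans _ _ (\int[distribution Q idO]_x (cst c x))%E).
  apply: ge0_le_integral => //.
  - exact: measurable_fun_xsection.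
  - by move=> x _; exact: Ec.
by rewrite probability_integral_cst.
Qed.

End independent_section.

(** * Level of the permutation test over all permutations *)

Section order_statistics.
Context (R : realDomainType).
Implicit Types (s : seq R) (t : R) (k : nat).

Let L s := sort <=%R s.

Let L_nth s i j : (i <= j < size s)%N -> nth 0 (L s) i <= nth 0 (L s) j.
Proof.
move=> /andP[ij js]; apply: (sorted_leq_nth le_trans le_refl) => //.
- exact: sort_le_sorted.
- by rewrite inE size_sort (leq_ltn_trans ij).
- by rewrite inE size_sort.
Qed.

(** Trades an order statistic for a count, which does not depend on the order of the sequence. It
    serves both for the critical value and for the nearest neighbours. *)
Lemma nth_sort_lt s t k : (0 < k <= size s)%N ->
  (nth 0 (sort <=%R s) k.-1 < t) = (k <= count (< t) s)%N.
Proof.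
case: k => // k /= ks; rewrite -(seq.permP (permEl (perm_sort <=%R s))) -/(L s).
have sL : size (L s) = size s by rewrite size_sort.
apply/idP/idP => [kt|].
  rewrite -(cat_take_drop k.+1 (L s)) count_cat.
  rewrite (_ : count _ (take _ _) = k.+1) ?leq_addr//.
  rewrite -[RHS](size_takel (s := L s)) ?sL//; apply/eqP; rewrite -all_count.
  apply/(all_nthP 0) => i; rewrite size_takel ?sL// => ik; rewrite nth_take//=.
  by apply: le_lt_trans kt; apply: L_nth; rewrite -ltnS ik.
apply: contraTT; rewrite -leNgt -ltnNge ltnS => tk.
rewrite -(cat_take_drop k (L s)) count_cat.
rewrite (_ : count _ (drop _ _) = 0%N) ?addn0.
  by apply: leq_trans (count_size _ _) _; rewrite size_take_min geq_minl.
apply/eqP; rewrite -leqn0 leqNgt -has_count; apply/(has_nthP 0) => -[i].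
rewrite size_drop ltn_subRL sL nth_drop/= => ik; apply/negP; rewrite -leNgt.
by apply: (le_trans tk); apply: L_nth; rewrite leq_addr.
Qed.

Lemma count_gt_nth_sort s k : (0 < k <= size s)%N ->
  (count (> nth 0 (sort <=%R s) k.-1)%R s <= size s - k)%N.
Proof.
case: k => // k /= ks; rewrite -(seq.permP (permEl (perm_sort <=%R s))) -/(L s).
have sL : size (L s) = size s by rewrite size_sort.
set u := nth 0 _ _; rewrite -(cat_take_drop k.+1 (L s)) count_cat.
rewrite (_ : count _ (take _ _) = 0%N).
  by apply: leq_trans (count_size _ _) _; rewrite size_drop sL.
apply/eqP; rewrite -leqn0 leqNgt -has_count; apply/(has_nthP 0) => -[i].
rewrite size_takel ?sL// => ik; rewrite nth_take//=; apply/negP; rewrite -leNgt.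
by apply: L_nth; rewrite -ltnS ik.
Qed.

End order_statistics.

Section permutation_test.
Context (R : realType) (N1 M : nat).
Implicit Types (s : 'M[R]_(N1, M.+1)) (pi sigma : group_perm N1 M).

(** A product of permutations applies its left factor first, hence the order [pi i * sigma i]. *)
Lemma permuted_permuted s pi sigma :
  permuted (permuted s sigma) pi = permuted s [ffun i => (pi i * sigma i)%g].
Proof. by apply/matrixP => i j; rewrite !mxE ffunE permM. Qed.

Variable alpha : R.
Hypothesis alpha01 : 0 < alpha < 1.

Local Notation K := #|{: group_perm N1 M}|.
Local Notation k := (critical_rank N1 M alpha).

Let K_gt0 : (0 < K)%N.
Proof. by apply/card_gt0P; exists [ffun=> 1%g]. Qed.

Lemma critical_rank_ge : K%:R * (1 - alpha) <= k%:R.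
Proof.
rewrite /critical_rank; apply: le_trans (ceil_ge _) _.
by rewrite [leRHS](_ : _ = `|Num.ceil (K%:R * (1 - alpha))|%:~R)// ler_int ler_norm.
Qed.

(** Makes the default value of [nth] and the predecessor in [perm_test] harmless. *)
Lemma critical_rank_bounds : (0 < k <= K)%N.
Proof.
have /andP[a0 a1] := alpha01; apply/andP; split.
  rewrite -(ltr_nat R); apply: lt_le_trans critical_rank_ge.
  by rewrite mulr_gt0 ?ltr0n// subr_gt0.
rewrite /critical_rank -lez_nat gez0_abs.
  rewrite ceil_le_int -pmulrn -[leRHS]mulr1 ler_pM2l ?ltr0n//.
  by rewrite gerBl ltW.
by rewrite ceil_ge0 (@lt_le_trans _ _ 0)// ?ltrN10// mulr_ge0// subr_ge0 ltW.
Qed.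

Let size_stats s :
  size [seq test_stat (permuted s pi) | pi : group_perm N1 M] = K.
Proof. by rewrite size_map -cardE. Qed.

Lemma perm_testE s : perm_test alpha s =
  (k <= \sum_(pi : group_perm N1 M) (test_stat (permuted s pi) < test_stat s)%R)%N.
Proof.
rewrite /perm_test /ordered_stats nth_sort_lt ?size_stats ?critical_rank_bounds//.
by rewrite count_map -sum1_count big_enum_cond/= big_mkcond/=; congr (_ <= _)%N; apply: eq_bigr => pi _; case: ifP.
Qed.

(** As the permutations form a group, the permuted samples of [s] all have the same list of
    statistics up to order, hence the same critical value. The left side then counts the entries of
    one list that exceed its [k]-th smallest value, and there are at most [K - k] of them. *)
Lemma sum_perm_test_le s :
  \sum_(sigma : group_perm N1 M) (perm_test alpha (permuted s sigma))%:R <= K%:R * alpha :> R.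
Proof.
pose T := [seq test_stat (permuted s pi) | pi : group_perm N1 M].
have E sigma : perm_test alpha (permuted s sigma) =
    (nth 0 (sort <=%R T) k.-1 < test_stat (permuted s sigma)).
  rewrite perm_testE nth_sort_lt ?size_stats ?critical_rank_bounds//.
  rewrite /T count_map -sum1_count big_enum_cond/= [in RHS]big_mkcond/=; congr (_ <= _)%N.
  pose h (pi : group_perm N1 M) : group_perm N1 M := [ffun i => (pi i * (sigma i)^-1)%g].
  pose g (pi : group_perm N1 M) : group_perm N1 M := [ffun i => (pi i * sigma i)%g].
  rewrite [in RHS](reindex g)/=; last first.
    by exists h => pi _; apply/ffunP => i; rewrite !ffunE ?mulgK ?mulgKV.
  by apply: eq_bigr => pi _; rewrite permuted_permuted; case: ifP.
under eq_bigr do rewrite E.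
rewrite -natr_sum; set c := (\sum_ _ _)%N.
have : (c <= K - k)%N.
  have := @count_gt_nth_sort R T k; rewrite size_stats critical_rank_bounds => /(_ isT).
  apply: leq_trans; rewrite count_map -sum1_count big_enum_cond/= [in leqRHS]big_mkcond/= /c.
  by apply: leq_sum => pi _; case: ifP => //; case: ltP.
rewrite -(ler_nat R) => /le_trans; apply.
rewrite natrB; last by case/andP: critical_rank_bounds.
by have := critical_rank_ge; rewrite mulrBr mulr1; lra.
Qed.

End permutation_test.

(** * Lipschitz approximation of the test *)

Section clamp.
Context (R : realFieldType).
Implicit Types x y : R.

Definition clamp01 x : R := Num.max 0 (Num.min 1 x).

Lemma clamp01_ge0 x : 0 <= clamp01 x.
Proof. by rewrite /clamp01 le_max lexx. Qed.

Lemma clamp01_le1 x : clamp01 x <= 1.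
Proof. by rewrite /clamp01 ge_max ler01 ge_min lexx. Qed.

Lemma clamp01_itv x : 0 <= clamp01 x <= 1.
Proof. by rewrite clamp01_ge0 clamp01_le1. Qed.

Lemma clamp01_le0 x : x <= 0 -> clamp01 x = 0.
Proof. by move=> x0; apply/max_idPl; rewrite ge_min x0 orbT. Qed.

Lemma clamp01_ge1 x : 1 <= x -> clamp01 x = 1.
Proof. by move=> x1; rewrite /clamp01 (min_idPl x1) (max_idPr ler01). Qed.

Lemma clamp01_id x : 0 <= x <= 1 -> clamp01 x = x.
Proof. by case/andP=> x0 x1; rewrite /clamp01 (min_idPr x1) (max_idPr x0). Qed.

Lemma clamp01_le_gt0 x : clamp01 x <= (0 < x)%R%:R.
Proof. by case: ltP => [_|/clamp01_le0 ->//]; exact: clamp01_le1. Qed.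

Lemma clamp01_lip x y : `|clamp01 x - clamp01 y| <= `|x - y|.
Proof.
have cases z : [\/ clamp01 z = 0 /\ z <= 0, clamp01 z = z /\ 0 <= z <= 1 | clamp01 z = 1 /\ 1 <= z].
  have [z0|z0] := leP z 0; first by constructor 1; rewrite clamp01_le0.
  have [z1|z1] := leP 1 z; first by constructor 3; rewrite clamp01_ge1.
  by constructor 2; rewrite clamp01_id ?(ltW z0) ?(ltW z1).
wlog xy : x y / x <= y => [H|].
  by have [/H//|/ltW/H] := leP x y; rewrite distrC [leRHS]distrC.
rewrite distrC [leRHS]distrC [leRHS]ger0_norm ?subr_ge0//.
by case: (cases x) => -[-> hx]; case: (cases y) => -[-> hy]; rewrite ler_norml; lra.
Qed.

End clamp.

Section smooth_test.
Context (R : realType) (N1 M : nat) (N1_gt0 : (0 < N1)%N) (M_gt0 : (0 < M)%N).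
Implicit Types (s : 'M[R]_(N1, M.+1)) (pi : group_perm N1 M).

Definition contrast s : R :=
  N1%:R^-1 * \sum_(i < N1) (s i ord0 - M%:R^-1 * \sum_(j < M) s i (lift ord0 j)).

Lemma test_statE s : test_stat s = `|contrast s|. Proof. by []. Qed.

(** Once the row total, which no permutation changes, is separated, the contrast depends on [pi]
    only through the entries [pi i ord0]. *)
Lemma contrastE s pi : contrast (permuted s pi) =
  N1%:R^-1 * \sum_(i < N1) ((1 + M%:R^-1) * s i (pi i ord0) - M%:R^-1 * \sum_m s i m).
Proof.
congr (_ * _); apply: eq_bigr => i _; rewrite !mxE.
have -> : \sum_m s i m = s i (pi i ord0) + \sum_(j < M) permuted s pi i (lift ord0 j).
  rewrite (reindex_perm (pi i)) big_ord_recl; congr (_ + _).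
  by apply: eq_bigr => j _; rewrite mxE.
by rewrite mulrDr mulrDl mul1r opprD addrA addrK.
Qed.

Lemma contrastD s s' : contrast (s + s') = contrast s + contrast s'.
Proof.
rewrite /contrast -[RHS]mulrDr -big_split/=; apply: congr1; apply: eq_bigr => i _.
rewrite mxE (eq_bigr (fun j => s i (lift ord0 j) + s' i (lift ord0 j))).
  by rewrite big_split/= mulrDr; ring.
by move=> j _; rewrite mxE.
Qed.

Lemma contrastZ a s : contrast (a *: s) = a * contrast s.
Proof.
rewrite /contrast [RHS]mulrCA [in RHS]mulr_sumr; congr (_ * _); apply: eq_bigr => i _.
rewrite mxE (eq_bigr (fun j => a * s i (lift ord0 j))); last by move=> j _; rewrite mxE.
by rewrite -mulr_sumr; ring.
Qed.

Lemma permutedD s s' pi : permuted (s + s') pi = permuted s pi + permuted s' pi.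
Proof. by apply/matrixP => i j; rewrite !mxE. Qed.

Lemma permutedZ a s pi : permuted (a *: s) pi = a *: permuted s pi.
Proof. by apply/matrixP => i j; rewrite !mxE. Qed.

(* The values of the statistics of [s] and of [permuted s pi] can only be close
   if one of these two linear forms is small. *)
Definition contrast_pm (b : bool) pi s : R :=
  contrast s + (-1) ^+ b * contrast (permuted s pi).

Lemma contrast_pmD b pi s s' :
  contrast_pm b pi (s + s') = contrast_pm b pi s + contrast_pm b pi s'.
Proof. by rewrite /contrast_pm permutedD !contrastD; ring. Qed.

Lemma contrast_pmZ b pi a s : contrast_pm b pi (a *: s) = a * contrast_pm b pi s.
Proof. by rewrite /contrast_pm permutedZ !contrastZ; ring. Qed.

Lemma permuted1 s : permuted s [ffun=> 1%g] = s.
Proof. by apply/matrixP => i j; rewrite mxE ffunE perm1. Qed.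

Lemma contrast_delta pi i : contrast (permuted (delta_mx i ord0) pi) =
  N1%:R^-1 * ((1 + M%:R^-1) * (pi i ord0 == ord0)%:R - M%:R^-1).
Proof.
rewrite contrastE (bigD1 i)//= [X in _ + X]big1 => [|j ji]; last first.
  rewrite !mxE (negbTE ji) mulr0 big1 ?mulr0 ?subr0// => m _.
  by rewrite mxE (negbTE ji).
rewrite addr0 mxE eqxx/=; congr (_ * (_ - _)).
rewrite (bigD1 ord0)//= big1 => [|m m0]; last first.
  by rewrite mxE (negbTE m0) andbF.
by rewrite mxE !eqxx addr0 mulr1.
Qed.

(** If [pi i] fixes [0], the treated outcome of row [i] has the same coefficient in both contrasts;
    otherwise its coefficient is multiplied by [- 1 / M]. In a difference all these coefficients
    vanish only if every [pi i] fixes [0], and then the contrasts coincide; in a sum, only if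
    [M = 1] and every [pi i] exchanges the two entries, and then they are opposite. *)
Lemma contrast_pm_eq0 b pi s :
  (forall i, contrast_pm b pi (delta_mx i ord0) = 0) -> contrast_pm b pi s = 0.
Proof.
move=> H; have N0 : N1%:R^-1 != 0 :> R by rewrite invr_eq0 pnatr_eq0 -lt0n.
have M0 : M%:R^-1 > 0 :> R by rewrite invr_gt0 ltr0n.
have {}H i : 1 + (-1) ^+ b * ((1 + M%:R^-1) * (pi i ord0 == ord0)%:R - M%:R^-1) = 0 :> R.
  have := H i; rewrite /contrast_pm -[X in contrast X + _]permuted1 !contrast_delta.
  rewrite ffunE perm1 eqxx mulr1 addrK mulrCA -mulrDr => /eqP.
  by rewrite mulf_eq0 (negbTE N0)/= => /eqP.
rewrite /contrast_pm -[X in contrast X + _]permuted1 !contrastE mulrCA -mulrDr.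
rewrite mulr_sumr -big_split/= big1 ?mulr0// => i _; rewrite ffunE perm1.
have := H i; case: b H => H.
  rewrite expr1; case: eqP => [-> _|_]; first by rewrite mulN1r subrr.
  by rewrite mulr0 sub0r mulN1r opprK => H'; lra.
rewrite expr0 !mul1r; case: eqP => [_|/eqP pi0]; first by rewrite mulr1 addrK => H'; lra.
rewrite mulr0 sub0r => /eqP; rewrite subr_eq0 => /eqP M1.
have -> : \sum_m s i m = s i ord0 + s i (pi i ord0).
  rewrite (bigD1 ord0)//= (bigD1 (pi i ord0))//= big1 ?addr0// => m /andP[m0 mp].
  have {}M1 : M = 1%N by apply/eqP; rewrite -(eqr_nat R) -[M%:R]invrK -M1 invr1.
  exfalso; move: pi0 m0 mp; rewrite -!val_eqE/=.
  by case: (pi i ord0) => p /=; case: m => m /=; rewrite M1; case: p => [|[]]//; case: m => [|[]].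
by rewrite -M1; ring.
Qed.

Definition zap (i : 'I_N1) s : 'M[R]_(N1, M.+1) := s - s i ord0 *: delta_mx i ord0.

(* If a linear form has a nonzero coefficient at the treated outcome of row [i],
   then it is small only if this outcome lies in a short interval determined by
   the rest of the sample. *)
Definition small_form (e : R) (b : bool) pi (i : 'I_N1) s : bool :=
  (contrast_pm b pi (delta_mx i ord0) != 0) &&
  (`|s i ord0 * contrast_pm b pi (delta_mx i ord0) + contrast_pm b pi (zap i s)| < e).

(** A difference of absolute values is, up to sign, the sum or the difference of the two contrasts.
    It is nonzero here, so by [contrast_pm_eq0] the form has a nonzero coefficient at some treated
    outcome. *)
Lemma close_stats e pi s : 0 < test_stat s - test_stat (permuted s pi) < e ->
  exists b i, small_form e b pi i s.
Proof.
move=> H.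
have [b [pm0 pme]] : exists b, contrast_pm b pi s != 0 /\ `|contrast_pm b pi s| < e.
  move: H; rewrite !test_statE /contrast_pm; set x := contrast s; set y := contrast _.
  case: (ler0P x) => x0; case: (ler0P y) => y0 /andP[h1 h2].
  - exists true; rewrite expr1 mulN1r ler0_norm; last lra.
    split; last lra. by apply/eqP; lra.
  - exists false; rewrite expr0 mul1r ler0_norm; last lra.
    split; last lra. by apply/eqP; lra.
  - exists false; rewrite expr0 mul1r ger0_norm; last lra.
    split; last lra. by apply/eqP; lra.
  - exists true; rewrite expr1 mulN1r ger0_norm; last lra.
    split; last lra. by apply/eqP; lra.
have [i pi0] : exists i, contrast_pm b pi (delta_mx i ord0) != 0.
  apply: contrapT => /forallNP H'; move/eqP: pm0; apply; apply: contrast_pm_eq0 => i.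
  by apply/eqP/negPn/negP; exact: H'.
exists b, i; rewrite /small_form pi0/= /zap.
by rewrite -contrast_pmZ -contrast_pmD addrC subrK.
Qed.

Variable alpha : R.
Hypothesis alpha01 : 0 < alpha < 1.

(** The test rejects if at least [critical_rank] permuted statistics are strictly below the observed
    one. Each strict comparison is softened on the scale [e]; the outer clamp is [0] for a count of
    at most the rank minus one, and [1] from the rank on. *)
Definition smooth_test (e : R) s : R :=
  clamp01 (\sum_(pi : group_perm N1 M)
      clamp01 ((test_stat s - test_stat (permuted s pi)) / e) -
    ((critical_rank N1 M alpha)%:R - 1)).

Lemma smooth_test_le (e : R) s : 0 < e -> smooth_test e s <= (perm_test alpha s)%:R.
Proof.
move=> e0; rewrite perm_testE//; case: leqP => [_|]; first exact: clamp01_le1.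
set c := (\sum_ _ _)%N => ck; rewrite /smooth_test clamp01_le0//.
rewrite subr_le0; apply: (@le_trans _ _ c%:R).
  rewrite natr_sum; apply: ler_sum => pi _; apply: le_trans (clamp01_le_gt0 _) _.
  by rewrite ler_nat pmulr_lgt0 ?invr_gt0// subr_gt0.
by rewrite lerBrDr natr1 ler_nat.
Qed.

(** If no permuted statistic is below the observed one by a positive amount less than [e], every
    strict comparison counts fully in the softened count. If there is one, some [small_form] already
    contributes [1]. *)
Lemma perm_test_le_smooth (e : R) s : 0 < e ->
  (perm_test alpha s)%:R <= smooth_test e s +
    \sum_(pi : group_perm N1 M) \sum_(b : bool) \sum_(i < N1) (small_form e b pi i s)%:R.
Proof.
move=> e0.
have S0 : 0 <= \sum_(pi : group_perm N1 M) \sum_(b : bool) \sum_(i < N1) (small_form e b pi i s)%:R :> R.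
  by do 3 (apply: sumr_ge0 => ? _).
have [[pi Hpi]|/forallNP H] := pselect (exists pi, 0 < test_stat s - test_stat (permuted s pi) < e).
  have [b [i bi]] := close_stats Hpi.
  apply: (@le_trans _ _ 1); first by rewrite lern1 leq_b1.
  rewrite (bigD1 pi)//= (bigD1 b)//= (bigD1 i)//= bi.
  rewrite -!addrA [leRHS]addrCA lerDl !addr_ge0 ?clamp01_ge0//.
  - by apply: sumr_ge0.
  - by apply: sumr_ge0 => ? _; apply: sumr_ge0.
  - by do 3 (apply: sumr_ge0 => ? _).
rewrite perm_testE//; case: leqP => [kc|_]; last by rewrite addr_ge0// clamp01_ge0.
rewrite /smooth_test clamp01_ge1 ?lerDl//.
rewrite lerBrDr addrC subrK.
move: kc; rewrite -(ler_nat R) => /le_trans; apply.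
rewrite natr_sum; apply: ler_sum => pi _.
case: ltP => [tpi|_]; last exact: clamp01_ge0.
rewrite clamp01_ge1// ler_pdivlMr// mul1r leNgt.
by apply/negP => te; apply: (H pi); rewrite te subr_gt0 tpi.
Qed.

Definition entrywise_lipschitz (F : 'M[R]_(N1, M.+1) -> R) : Prop :=
  exists2 C, 0 <= C & forall s s' e,
    (forall i m, `|s i m - s' i m| <= e) -> `|F s - F s'| <= C * e.

Lemma contrast_lipschitz : entrywise_lipschitz contrast.
Proof.
exists (N1%:R^-1 * \sum_(i < N1) (1 + M%:R^-1 * \sum_(j < M) 1)).
  rewrite mulr_ge0// sumr_ge0// => i _; rewrite addr_ge0// mulr_ge0// sumr_ge0//.
move=> s s' e se; rewrite /contrast -mulrBr normrM ger0_norm// -mulrA ler_wpM2l//.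
rewrite -sumrB mulr_suml; apply: (le_trans (ler_norm_sum _ _ _)).
apply: ler_sum => i _.
rewrite (_ : _ - _ = (s i ord0 - s' i ord0) - M%:R^-1 * \sum_(j < M) (s i (lift ord0 j) - s' i (lift ord0 j))).
  apply: (le_trans (ler_normB _ _)); rewrite mulrDl mul1r lerD//.
  rewrite normrM ger0_norm// -mulrA ler_wpM2l// mulr_suml.
  apply: (le_trans (ler_norm_sum _ _ _)); apply: ler_sum => j _.
  by rewrite mul1r.
by rewrite sumrB; ring.
Qed.

Lemma test_stat_permuted_lipschitz pi :
  entrywise_lipschitz (fun s => test_stat (permuted s pi)).
Proof.
have [C C0 HC] := contrast_lipschitz; exists C => // s s' e se.
rewrite !test_statE; apply: le_trans (ler_dist_dist _ _) _; apply: HC => i m.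
by rewrite !mxE.
Qed.

Lemma smooth_test_lipschitz e : 0 < e -> entrywise_lipschitz (smooth_test e).
Proof.
move=> e0; have /choice[C HC] : forall pi, exists C, 0 <= C /\ forall s s' e,
    (forall i m, `|s i m - s' i m| <= e) -> `|test_stat (permuted s pi) - test_stat (permuted s' pi)| <= C * e.
  by move=> pi; have [C C0 HC] := test_stat_permuted_lipschitz pi; exists C.
have [C1 C10 HC1] := test_stat_permuted_lipschitz [ffun=> 1%g].
exists (\sum_(pi : group_perm N1 M) (C1 + C pi) / e).
  by apply: sumr_ge0 => pi _; apply: divr_ge0; [apply: addr_ge0 => //; case: (HC pi)|exact: ltW].
move=> s s' d sd; apply: (le_trans (clamp01_lip _ _)).
rewrite [X in `|X|](_ : _ = \sum_(pi : group_perm N1 M)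
    (clamp01 ((test_stat s - test_stat (permuted s pi)) / e) -
     clamp01 ((test_stat s' - test_stat (permuted s' pi)) / e))); last first.
  by rewrite sumrB; ring.
rewrite mulr_suml; apply: (le_trans (ler_norm_sum _ _ _)); apply: ler_sum => pi _.
apply: (le_trans (clamp01_lip _ _)); rewrite -mulrBl normrM [`|e^-1|]gtr0_norm ?invr_gt0//.
rewrite [leRHS]mulrAC ler_pM2r ?invr_gt0//.
rewrite [X in `|X|](_ : _ = (test_stat s - test_stat s') - (test_stat (permuted s pi) - test_stat (permuted s' pi))); last by ring.
apply: (le_trans (ler_normB _ _)); rewrite mulrDl lerD//; last by case: (HC pi) => _; apply.
by have := HC1 s s' d sd; rewrite !permuted1.
Qed.

End smooth_test.

(** * Asymptotic exchangeability *)

Section bounded_measurable.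
Context d (T : measurableType d) (R : realType) (P : probability T R).
Implicit Types (f g : T -> R).

Definition bmeas f := measurable_fun setT f /\ exists C, forall x, `|f x| <= C.

Lemma bmeas_integrable f : bmeas f -> P.-integrable setT (EFin \o f).
Proof.
move=> [mf [C fC]]; apply: measurable_bounded_integrable => //.
  apply: (@le_lt_trans _ _ 1%E); last exact: ltry.
  by rewrite le_eqVlt; apply/orP; left; apply/eqP; exact: probability_setT.
exists C; split; first exact: num_real.
by move=> C' CC' x _; exact: (le_trans (fC x) (ltW CC')).
Qed.

Lemma bmeas_cst (c : R) : bmeas (cst c).
Proof. by split; [exact: measurable_cst|exists `|c|]. Qed.

Lemma bmeas_unit f : measurable_fun setT f -> (forall x, 0 <= f x <= 1) -> bmeas f.
Proof.
by move=> mf f01; split => //; exists 1 => x; have /andP[? ?] := f01 x; rewrite ger0_norm.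
Qed.

Lemma bmeasD f g : bmeas f -> bmeas g -> bmeas (fun x => f x + g x).
Proof.
move=> [mf [C fC]] [mg [D gD]]; split; first exact: measurable_funD.
by exists (C + D) => x; rewrite (le_trans (ler_normD _ _))// lerD.
Qed.

Lemma bmeasM f g : bmeas f -> bmeas g -> bmeas (fun x => f x * g x).
Proof.
move=> [mf [C fC]] [mg [D gD]]; split; first exact: measurable_funM.
by exists (C * D) => x; rewrite normrM ler_pM.
Qed.

Lemma bmeasN f : bmeas f -> bmeas (fun x => - f x).
Proof.
move=> [mf [C fC]]; split; first exact: measurableT_comp.
by exists C => x; rewrite normrN.
Qed.

Lemma bmeasB f g : bmeas f -> bmeas g -> bmeas (fun x => f x - g x).
Proof. by move=> bf bg; apply: bmeasD => //; exact: bmeasN. Qed.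

Lemma bmeas_norm f : bmeas f -> bmeas (fun x => `|f x|).
Proof.
move=> [mf [C fC]]; split; first exact: measurableT_comp.
by exists C => x; rewrite normr_id.
Qed.

Lemma bmeas_sum (I : Type) (s : seq I) (F : I -> T -> R) :
  (forall i, bmeas (F i)) -> bmeas (fun x => \sum_(i <- s) F i x).
Proof.
move=> bF; elim: s => [|i s IH].
  by under eq_fun do rewrite big_nil; exact: bmeas_cst.
by under eq_fun do rewrite big_cons; exact: bmeasD.
Qed.

Lemma bmeas_prod (I : Type) (s : seq I) (F : I -> T -> R) :
  (forall i, bmeas (F i)) -> bmeas (fun x => \prod_(i <- s) F i x).
Proof.
move=> bF; elim: s => [|i s IH].
  by under eq_fun do rewrite big_nil; exact: bmeas_cst.
by under eq_fun do rewrite big_cons; exact: bmeasM.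
Qed.

Local Notation E f := (\int[P]_x f x).

Lemma expectation_bmeas f : bmeas f -> ('E_P[f] = (E f)%R%:E)%E.
Proof.
move=> bf; rewrite unlock /Rintegral fineK//.
by apply: integrable_fin_num => //; exact: bmeas_integrable.
Qed.

Lemma RE_cst (c : R) : \int[P]_x c = c.
Proof. by rewrite /Rintegral probability_integral_cst. Qed.

Lemma RE_D f g : bmeas f -> bmeas g -> \int[P]_x (f x + g x) = E f + E g.
Proof. by move=> bf bg; rewrite RintegralD//; exact: bmeas_integrable. Qed.

Lemma RE_B f g : bmeas f -> bmeas g -> \int[P]_x (f x - g x) = E f - E g.
Proof. by move=> bf bg; rewrite RintegralB//; exact: bmeas_integrable. Qed.

Lemma RE_Z (c : R) f : bmeas f -> \int[P]_x (c * f x) = c * E f.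
Proof. by move=> bf; rewrite RintegralZl//; exact: bmeas_integrable. Qed.

Lemma RE_le f g : bmeas f -> bmeas g -> (forall x, f x <= g x) -> E f <= E g.
Proof. by move=> bf bg fg; apply: le_Rintegral => //; exact: bmeas_integrable. Qed.

Lemma RE_norm f : bmeas f -> `|E f| <= \int[P]_x `|f x|.
Proof. by move=> bf; apply: le_normr_Rintegral => //; exact: bmeas_integrable. Qed.

Lemma RE_sum (I : Type) (s : seq I) (F : I -> T -> R) :
  (forall i, bmeas (F i)) -> \int[P]_x (\sum_(i <- s) F i x) = \sum_(i <- s) E (F i).
Proof.
move=> bF; elim: s => [|i s IH].
  rewrite big_nil -[RHS](RE_cst 0); apply: eq_Rintegral => x _; by rewrite big_nil.
rewrite big_cons -IH -RE_D//; last exact: bmeas_sum.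
by apply: eq_Rintegral => x _; rewrite big_cons.
Qed.

Lemma RE_dominated_cvg (f_ : nat -> T -> R) f :
  (forall n, measurable_fun setT (f_ n)) -> measurable_fun setT f ->
  (forall n x, 0 <= f_ n x <= 1) -> (forall x, 0 <= f x <= 1) ->
  {ae P, forall x, f_ n x @[n --> \oo] --> f x} ->
  E (f_ n) @[n --> \oo] --> E f.
Proof.
move=> mf_ mf f_01 f01 ff; apply: fine_cvg; rewrite fineK; last first.
  exact: integral_unit_fin_num.
exact: unit_dominated_cvg.
Qed.

End bounded_measurable.

(** * A partition of unity on the line *)

Section tents.
Context (R : realType).
Implicit Types (q : nat) (y : R).

Lemma clamp01_continuous : continuous (@clamp01 R).
Proof.
move=> x; apply/cvgrPdist_le => e e0.
near=> y; apply: le_trans (clamp01_lip _ _) _.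
by near: y; apply: cvgr_dist_le => //; exact: cvg_id.
Unshelve. all: by end_near. Qed.

(** Maps [[-(q + 1), q + 1]] onto [[0, 2 * (q + 1) ^ 2]] and the grid points to integers. *)
Definition grid_coord q y : R := q.+1%:R * (y + q.+1%:R).

Definition grid_point q (j : nat) : R := j%:R / q.+1%:R - q.+1%:R.

(* The tents form a partition of unity on [-(q + 1), q + 1], subordinate to
   intervals of length [2 / (q + 1)] around the grid points. *)
Definition tent q (j : nat) y : R :=
  clamp01 (grid_coord q y - j%:R + 1) - clamp01 (grid_coord q y - j%:R).

Definition grid_size q : nat := (2 * (q.+1 * q.+1)).+2.

Definition plateau q y : R := \sum_(j < grid_size q) tent q j y.

Lemma grid_coord_continuous q : continuous (grid_coord q).
Proof.
by move=> y; apply: cvgM; [exact: cvg_cst|apply: cvgD; [exact: cvg_id|exact: cvg_cst]].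
Qed.

Lemma clamp_grid_continuous q (c : R) : continuous (fun y => clamp01 (grid_coord q y + c)).
Proof.
move=> y; apply: (@continuous_comp _ _ _ (fun y => grid_coord q y + c) (@clamp01 R)).
  by apply: cvgD; [exact: grid_coord_continuous|exact: cvg_cst].
exact: clamp01_continuous.
Qed.

Lemma tent_continuous q j : continuous (tent q j).
Proof.
move=> y; apply: cvgB; last exact: clamp_grid_continuous.
under eq_fun do rewrite -addrA.
by rewrite /continuous_at -addrA; exact: clamp_grid_continuous.
Qed.

(** The sum of the tents telescopes to a trapezoid. *)
Lemma plateauE q y : plateau q y =
  clamp01 (grid_coord q y + 1) - clamp01 (grid_coord q y - (grid_size q)%:R + 1).
Proof.
rewrite /plateau; elim: (grid_size q) => [|n IH].
  by rewrite big_ord0 subr0 subrr.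
rewrite big_ord_recr IH /= /tent.
rewrite (_ : grid_coord q y - n.+1%:R + 1 = grid_coord q y - n%:R); last first.
  by rewrite -natr1; ring.
by ring.
Qed.

Lemma clamp01_mono : {homo @clamp01 R : x y / x <= y}.
Proof.
move=> x y xy; have [x0|x0] := leP x 0; first by rewrite (clamp01_le0 x0) clamp01_ge0.
have [x1|x1] := leP 1 y; first by rewrite (clamp01_ge1 x1) clamp01_le1.
rewrite !clamp01_id//; first by rewrite (ltW (lt_le_trans x0 xy)) ltW.
by rewrite ltW//= (le_trans xy)// ltW.
Qed.

Lemma diff_clamp01_itv (x y : R) : x <= y -> 0 <= clamp01 y - clamp01 x <= 1.
Proof.
move=> xy; rewrite subr_ge0 clamp01_mono//=.
by have := clamp01_ge0 x; have := clamp01_le1 y; lra.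
Qed.

Lemma tent_itv q j y : 0 <= tent q j y <= 1.
Proof. by apply: diff_clamp01_itv; rewrite lerDl. Qed.

Lemma plateau_itv q y : 0 <= plateau q y <= 1.
Proof.
rewrite plateauE; apply: diff_clamp01_itv; rewrite lerD2r gerBl//.
Qed.

Lemma plateau_continuous q : continuous (plateau q).
Proof.
have -> : plateau q = fun y => clamp01 (grid_coord q y + 1) -
    clamp01 (grid_coord q y + (- (grid_size q)%:R + 1)).
  by apply/funext => y; rewrite plateauE addrA.
by move=> y; apply: cvgB; exact: clamp_grid_continuous.
Qed.

Lemma tent_support q j y : tent q j y != 0 -> `|y - grid_point q j| <= q.+1%:R^-1.
Proof.
have q0 : 0 < q.+1%:R :> R by [].
have -> : y - grid_point q j = (grid_coord q y - j%:R) / q.+1%:R.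
  by rewrite /grid_coord /grid_point; field; rewrite lt0r_neq0.
rewrite /tent; set u := grid_coord q y - j%:R => t0.
rewrite normrM [`|_^-1|]gtr0_norm ?invr_gt0// ler_piMl ?invr_ge0//.
rewrite ler_norml; apply/andP; split; rewrite leNgt; apply: contraNN t0 => u1.
  by rewrite !clamp01_le0 ?subrr//; lra.
by rewrite !clamp01_ge1 ?subrr//; lra.
Qed.

Lemma plateau_eq1 q y : `|y| <= q.+1%:R -> plateau q y = 1.
Proof.
have gs : (grid_size q)%:R = 2 * (q.+1%:R * q.+1%:R) + 2 :> R.
  by rewrite /grid_size -addn2 natrD !natrM.
rewrite plateauE gs /grid_coord; have : 0 < q.+1%:R :> R by [].
set Q := q.+1%:R; move=> q0; rewrite ler_norml => /andP[y0 y1].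
have u0 : 0 <= Q * (y + Q) by apply: mulr_ge0; lra.
have u1 : Q * (y + Q) <= 2 * (Q * Q) by rewrite mulrCA ler_pM2l//; lra.
by rewrite clamp01_ge1 ?clamp01_le0 ?subr0//; lra.
Qed.

Lemma plateau_cvg y : plateau q y @[q --> \oo] --> (1 : R).
Proof.
apply: cvg_near_cst; exists (Num.truncn `|y|) => // q /= yq.
apply: plateau_eq1; apply: (le_trans (ltW (truncnS_gt _))).
by rewrite ler_nat.
Qed.

End tents.

(** A union bound; it reduces the mass missed by a product of plateaus to the masses missed in the
    single cells. *)
Lemma one_sub_prod_le (R : realDomainType) (I : Type) (s : seq I) (t : I -> R) :
  (forall i, 0 <= t i <= 1) ->
  1 - \prod_(i <- s) t i <= \sum_(i <- s) (1 - t i).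
Proof.
move=> t01; elim: s => [|i s IH]; first by rewrite !big_nil subrr.
rewrite !big_cons; have /andP[ti0 ti1] := t01 i.
have p0 : 0 <= \prod_(j <- s) t j by apply: prodr_ge0 => j _; case/andP: (t01 j).
have p1 : \prod_(j <- s) t j <= 1.
  by elim: (s) => [|j r IHr]; rewrite ?big_nil// big_cons; case/andP: (t01 j) => ? ?; rewrite mulr_ile1// prodr_ge0// => k _; case/andP: (t01 k).
apply: le_trans (lerD (lexx _) IH); move: p0 p1; set p := \prod_(j <- s) t j => p0 p1.
by have := mulr_ge0 (_ : 0 <= 1 - t i) (_ : 0 <= 1 - p); rewrite !subr_ge0 => /(_ ti1 p1); lra.
Qed.

Lemma cvg_sumr (R : realType) (I : Type) (s : seq I) (f : I -> nat -> R) (l : I -> R) :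
  (forall i, f i n @[n --> \oo] --> l i) ->
  (\sum_(i <- s) f i n) @[n --> \oo] --> \sum_(i <- s) l i.
Proof.
move=> fl; elim: s => [|i s IH].
  by under eq_fun do rewrite big_nil; rewrite big_nil; exact: cvg_cst.
by under eq_fun do rewrite big_cons; rewrite big_cons; exact: cvgD.
Qed.

Lemma cvg_sumr0 (R : realType) (I : Type) (s : seq I) (f : I -> nat -> R) :
  (forall i, f i n @[n --> \oo] --> (0 : R)) ->
  (\sum_(i <- s) f i n) @[n --> \oo] --> (0 : R).
Proof. by move=> /(@cvg_sumr _ _ s); rewrite big1_eq. Qed.

Section asymptotic_exchangeability.
Context (R : realType) d (S : measurableType d) (Q : probability S R) (N1 M : nat).
Local Notation mx := 'M[R]_(N1, M.+1).
Local Notation cell := ('I_N1 * 'I_M.+1)%type.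
Context (SN : nat -> S -> mx) (Y : 'I_N1 -> S -> R).
Hypothesis mSN : forall N i m, measurable_fun setT (fun s => SN N s i m).
Hypothesis SN0 : forall N s i, SN N s i ord0 = Y i s.

Hypothesis exch : forall (sigma : group_perm N1 M) (h : cell -> R -> R),
  (forall a, continuous (h a)) -> (forall a y, 0 <= h a y <= 1) ->
  \int[Q]_s (\prod_a h a (SN N s a.1 a.2)) -
  \int[Q]_s (\prod_a h a (permuted (SN N s) sigma a.1 a.2)) @[N --> \oo] --> (0 : R).

Let mcont (h : R -> R) (X : S -> R) : continuous h -> measurable_fun setT X ->
  measurable_fun setT (fun s => h (X s)).
Proof. by move=> ch mX; apply: measurableT_comp => //; exact: continuous_measurable_fun. Qed.

Let mY i : measurable_fun setT (Y i).
Proof. by rewrite (_ : Y i = fun s => SN 0 s i ord0)//; apply/funext => s; rewrite SN0. Qed.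

Let mperm N sigma i m : measurable_fun setT (fun s => permuted (SN N s) sigma i m).
Proof. by under eq_fun do rewrite mxE; exact: mSN. Qed.

Let bprod (h : cell -> R -> R) (X : S -> mx) :
  (forall a, continuous (h a)) -> (forall a y, 0 <= h a y <= 1) ->
  (forall i m, measurable_fun setT (fun s => X s i m)) ->
  bmeas (fun s => \prod_a h a (X s a.1 a.2)).
Proof.
move=> ch h01 mX; apply: bmeas_prod => a; apply: bmeas_unit => //.
exact: mcont.
Qed.

(** Exchanging [m] and [0] in row [i] carries the expectation at the cell [(i, m)] to that of the
    treated outcome, which does not depend on [N]. This provides the tightness of the matched
    outcomes. *)
Lemma plateau_cell_cvg q i m :
  \int[Q]_s plateau q (SN N s i m) @[N --> \oo] --> \int[Q]_s plateau q (Y i s).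
Proof.
pose sigma : group_perm N1 M := [ffun j => if j == i then tperm ord0 m else 1%g].
pose h (a : cell) (y : R) := if a == (i, m) then plateau q y else 1.
have := @exch sigma h.
have -> : (fun N => \int[Q]_s (\prod_a h a (SN N s a.1 a.2)) -
    \int[Q]_s (\prod_a h a (permuted (SN N s) sigma a.1 a.2))) =
    (fun N => \int[Q]_s plateau q (SN N s i m) - \int[Q]_s plateau q (Y i s)).
  have hE (s : mx) : \prod_a h a (s a.1 a.2) = plateau q (s i m).
    by rewrite (bigD1 (i, m))//= /h eqxx big1 ?mulr1// => a /negbTE ->.
  apply/funext => N; congr (_ - _); apply: eq_Rintegral => s _; rewrite hE//.
  by rewrite mxE ffunE eqxx tpermR SN0.
move=> H; apply/cvgrPdist_lt => e e0; move: H => /(_ _ _)/cvgrPdist_lt/(_ e e0) H.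
have : \forall N \near \oo, `|0 - (\int[Q]_s plateau q (SN N s i m) - \int[Q]_s plateau q (Y i s))| < e.
  apply: H => [a|a y].
    by rewrite /h; case: eqP => _; [exact: plateau_continuous|exact: cst_continuous].
  by rewrite /h; case: eqP => _; [exact: plateau_itv|rewrite ler01 lexx].
by apply: filterS => N; rewrite sub0r opprB.
Qed.

Variables (F : mx -> R) (sigma : group_perm N1 M).
Hypotheses (F_lip : entrywise_lipschitz F) (F01 : forall s, 0 <= F s <= 1).
Hypothesis mF : forall X : S -> mx,
  (forall i m, measurable_fun setT (fun s => X s i m)) -> measurable_fun setT (F \o X).

Let J q := {ffun cell -> 'I_(grid_size q)}.

Let grid_mx q (j : J q) : mx := \matrix_(i, m) grid_point R q (j (i, m)).

(** Interpolation of [F] at the grid points by tents: a finite combination of product functions, to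
    which [exch] applies. *)
Definition grid_approx q (s : mx) : R :=
  \sum_(j : J q) F (grid_mx j) * \prod_a tent q (j a) (s a.1 a.2).

Let prod_plateau q (s : mx) : R := \prod_a plateau q (s a.1 a.2).

Let prod_plateauE q s : prod_plateau q s = \sum_(j : J q) \prod_a tent q (j a) (s a.1 a.2).
Proof. by rewrite /prod_plateau /plateau bigA_distr_bigA. Qed.

Let prod_plateau_itv q s : 0 <= prod_plateau q s <= 1.
Proof.
apply/andP; split; first by apply: prodr_ge0 => a _; case/andP: (plateau_itv q (s a.1 a.2)).
by apply: Num.Theory.prodr_ile1 => a _; exact: plateau_itv.
Qed.

(** The first term is the oscillation of [F] over the support of a product of tents, the second what
    the tents miss outside a large cube. *)
Lemma grid_approx_error : exists2 C, 0 <= C & forall q s,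
  `|F s - grid_approx q s| <= C / q.+1%:R + (1 - prod_plateau q s).
Proof.
have [C C0 HC] := F_lip; exists C => // q s.
have /andP[p0 p1] := prod_plateau_itv q s; have /andP[f0 f1] := F01 s.
rewrite (_ : F s - _ = (F s * prod_plateau q s - grid_approx q s) + F s * (1 - prod_plateau q s)); last by ring.
apply: (le_trans (ler_normD _ _)); apply: lerD; last first.
  by rewrite ger0_norm ?mulr_ge0 ?subr_ge0// ler_piMl// subr_ge0.
rewrite prod_plateauE /grid_approx mulr_sumr -sumrB.
apply: (le_trans (ler_norm_sum _ _ _)).
apply: (@le_trans _ _ (\sum_(j : J q) C / q.+1%:R * \prod_a tent q (j a) (s a.1 a.2))).
  apply: ler_sum => j _; rewrite -mulrBl normrM.
  have t0 : 0 <= \prod_a tent q (j a) (s a.1 a.2).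
    by apply: prodr_ge0 => a _; case/andP: (tent_itv q (j a) (s a.1 a.2)).
  rewrite [`|\prod_a _|]ger0_norm//.
  have [->|tn0] := eqVneq (\prod_a tent q (j a) (s a.1 a.2)) 0; first by rewrite !mulr0.
  apply: ler_wpM2r => //; apply: HC => i m; rewrite mxE.
  apply: tent_support; apply: contraNneq tn0 => t00.
  by rewrite (bigD1 (i, m))//= t00 mul0r.
by rewrite -mulr_sumr -prod_plateauE ler_piMr// divr_ge0.
Qed.

Let bplateau q (X : S -> mx) : (forall i m, measurable_fun setT (fun s => X s i m)) ->
  bmeas (fun s => prod_plateau q (X s)).
Proof.
move=> mX; apply: (@bprod (fun=> plateau q) X) => // a; last exact: plateau_itv.
exact: plateau_continuous.
Qed.

Let bgrid q (X : S -> mx) : (forall i m, measurable_fun setT (fun s => X s i m)) ->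
  bmeas (fun s => grid_approx q (X s)).
Proof.
move=> mX; apply: bmeas_sum => j; apply: bmeasM; first exact: bmeas_cst.
apply: (@bprod (fun a => tent q (j a)) X) => // a; last exact: tent_itv.
exact: tent_continuous.
Qed.

Let bF (X : S -> mx) : (forall i m, measurable_fun setT (fun s => X s i m)) ->
  bmeas (fun s => F (X s)).
Proof. by move=> mX; apply: bmeas_unit => //; exact: mF. Qed.

Let error_bound C q (X : S -> mx) :
  (forall s, `|F s - grid_approx q s| <= C / q.+1%:R + (1 - prod_plateau q s)) ->
  (forall i m, measurable_fun setT (fun s => X s i m)) ->
  `|\int[Q]_s F (X s) - \int[Q]_s grid_approx q (X s)| <=
  C / q.+1%:R + (1 - \int[Q]_s prod_plateau q (X s)).
Proof.
move=> HC mX; have bX := bF mX; have gX := bgrid q mX; have pX := bplateau q mX.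
have b1 : bmeas (fun s => 1 - prod_plateau q (X s)) by apply: bmeasB => //; exact: bmeas_cst.
rewrite -RE_B//; apply: (le_trans (RE_norm _ (bmeasB bX gX))).
have -> : C / q.+1%:R + (1 - \int[Q]_s prod_plateau q (X s)) =
    \int[Q]_s (C / q.+1%:R + (1 - prod_plateau q (X s))).
  rewrite (@RE_D _ _ _ Q (cst (C / q.+1%:R)))//; last exact: bmeas_cst.
  rewrite (@RE_B _ _ _ Q (cst 1))//; last exact: bmeas_cst.
  by rewrite !RE_cst.
apply: RE_le => [||s]; [exact/bmeas_norm/bmeasB| |exact: HC].
by apply: bmeasD => //; exact: bmeas_cst.
Qed.

Let prod_plateau_permuted q s : prod_plateau q (permuted s sigma) = prod_plateau q s.
Proof.
rewrite /prod_plateau.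
pose f (a : cell) : cell := (a.1, sigma a.1 a.2).
pose g (a : cell) : cell := (a.1, (sigma a.1)^-1%g a.2).
rewrite [RHS](reindex f)/=; first by apply: eq_bigr => a _; rewrite mxE.
by exists g => -[i m] _; rewrite /f /g/= ?permK ?permKV.
Qed.

Lemma asymptotically_exchangeable :
  \int[Q]_s F (SN N s) - \int[Q]_s F (permuted (SN N s) sigma) @[N --> \oo] --> (0 : R).
Proof.
have [C C0 HC] := grid_approx_error.
apply/cvgrPdist_le => e e0.
(* The budget: for each of the two samples, [e / 8] for the oscillation and [e / 4] for the tail; in
   addition, [e / 4] for the difference of the interpolations. *)
have e8 : 0 < e / 8 by lra.
have tail0 : (\sum_(a : cell) (1 - \int[Q]_s plateau q (Y a.1 s))) @[q --> \oo] --> (0 : R).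
  apply: (@cvg_sumr0 R cell _ (fun a q => 1 - \int[Q]_s plateau q (Y a.1 s))) => a.
  rewrite [X in _ --> X](_ : 0 = 1 - 1); last by rewrite subrr.
  apply: cvgB; first exact: cvg_cst.
  rewrite -[X in _ --> X](RE_cst Q 1).
  apply: RE_dominated_cvg => //.
  - by move=> q; apply: mcont => //; exact: plateau_continuous.
  - by move=> q s; exact: plateau_itv.
  - by move=> s; rewrite ler01 lexx.
  - by apply: aeW => s; exact: plateau_cvg.
have Cq0 : C / q.+1%:R @[q --> \oo] --> (0 : R).
  by rewrite -(mulr0 C); apply: cvgM; [exact: cvg_cst|exact: cvg_harmonic].
(* The resolution [q] is chosen from the treated outcomes alone, before [N]. *)
have [q [Cq tq]] : exists q, C / q.+1%:R <= e / 8 /\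
    \sum_(a : cell) (1 - \int[Q]_s plateau q (Y a.1 s)) <= e / 8.
  move/cvgrPdist_le : tail0 => /(_ _ e8) t0; move/cvgrPdist_le : Cq0 => /(_ _ e8) c0.
  have [q _ /(_ q (leqnn q)) [/= ]] := filterI c0 t0.
  rewrite !sub0r !normrN => h1 h2; exists q; split; apply: le_trans (ler_norm _) _ => //.
have tN : \forall N \near \oo, 1 - \int[Q]_s prod_plateau q (SN N s) <= e / 4.
  have : (\sum_(a : cell) (1 - \int[Q]_s plateau q (SN N s a.1 a.2))) @[N --> \oo] -->
      \sum_(a : cell) (1 - \int[Q]_s plateau q (Y a.1 s)).
    apply: (@cvg_sumr R _ _ (fun a N => 1 - \int[Q]_s plateau q (SN N s a.1 a.2))
      (fun a => 1 - \int[Q]_s plateau q (Y a.1 s))) => a.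
    by apply: cvgB; [exact: cvg_cst|exact: plateau_cell_cvg].
  move=> /cvgrPdist_le/(_ _ e8); apply: filterS => N HN.
  apply: (@le_trans _ _ (\sum_(a : cell) (1 - \int[Q]_s plateau q (SN N s a.1 a.2)))); last first.
    by move: HN; rewrite ler_norml => /andP[h _]; lra.
  have bp a : bmeas (fun s => plateau q (SN N s a.1 a.2)).
    apply: bmeas_unit => [|s]; last exact: plateau_itv.
    by apply: mcont => //; exact: plateau_continuous.
  have b1p a : bmeas (fun s => 1 - plateau q (SN N s a.1 a.2)).
    by apply: bmeasB => //; exact: bmeas_cst.
  rewrite -[X in X - _](RE_cst Q 1) -RE_B; [|exact: bmeas_cst|exact: (bplateau q (mSN N))].
  apply: (@le_trans _ _ (\int[Q]_s (\sum_(a : cell) (1 - plateau q (SN N s a.1 a.2))))).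
    apply: RE_le; [|exact: bmeas_sum|].
      by apply: bmeasB; [exact: bmeas_cst|exact: (bplateau q (mSN N))].
    by move=> s; apply: one_sub_prod_le => a; exact: plateau_itv.
  rewrite RE_sum//; apply: ler_sum => a _.
  by rewrite (@RE_B _ _ _ Q (cst 1))//= ?RE_cst//; exact: bmeas_cst.
have gN : (\int[Q]_s grid_approx q (SN N s) - \int[Q]_s grid_approx q (permuted (SN N s) sigma))
    @[N --> \oo] --> (0 : R).
  have E (X : S -> mx) : (forall i m, measurable_fun setT (fun s => X s i m)) ->
      \int[Q]_s grid_approx q (X s) = \sum_(j : J q) F (grid_mx j) *
        \int[Q]_s (\prod_a tent q (j a) (X s a.1 a.2)).
    move=> mX; have bt (j : J q) : bmeas (fun s => \prod_a tent q (j a) (X s a.1 a.2)).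
      apply: (@bprod (fun a => tent q (j a)) X) => // a; last exact: tent_itv.
      exact: tent_continuous.
    rewrite RE_sum => [|j]; last by apply: bmeasM => //; exact: bmeas_cst.
    by apply: eq_bigr => j _; rewrite RE_Z.
  rewrite (_ : (fun N => _) = fun N => \sum_(j : J q) F (grid_mx j) *
      (\int[Q]_s (\prod_a tent q (j a) (SN N s a.1 a.2)) -
       \int[Q]_s (\prod_a tent q (j a) (permuted (SN N s) sigma a.1 a.2)))); last first.
    apply/funext => N; rewrite !E//.
    by rewrite -sumrB; apply: eq_bigr => j _; rewrite mulrBr.
  apply: (@cvg_sumr0 R (J q) _ (fun (j : J q) N => F (grid_mx j) *
      (\int[Q]_s (\prod_a tent q (j a) (SN N s a.1 a.2)) -
       \int[Q]_s (\prod_a tent q (j a) (permuted (SN N s) sigma a.1 a.2))))) => j.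
  rewrite [X in _ --> X](_ : 0 = F (grid_mx j) * 0); last by rewrite mulr0.
  apply: cvgM; first exact: cvg_cst.
  apply: (@exch sigma (fun a => tent q (j a))) => [a|a y]; last exact: tent_itv.
  exact: tent_continuous.
have e4 : 0 < e / 4 by lra.
move/cvgrPdist_le : gN => /(_ _ e4) gN.
near=> N; rewrite sub0r normrN.
have tN' : 1 - \int[Q]_s prod_plateau q (SN N s) <= e / 4 by near: N.
have gN' : `|0 - (\int[Q]_s grid_approx q (SN N s) - \int[Q]_s grid_approx q (permuted (SN N s) sigma))| <= e / 4.
  by near: N.
have h1 := @error_bound C q (SN N) (HC q) (mSN N).
have h2 := @error_bound C q (fun s => permuted (SN N s) sigma) (HC q) (fun i m => mperm N sigma i m).
have E : \int[Q]_s prod_plateau q (permuted (SN N s) sigma) = \int[Q]_s prod_plateau q (SN N s).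
  by apply: eq_Rintegral => s _; rewrite prod_plateau_permuted.
rewrite E in h2.
move: Cq gN' h1 h2; set c := C / _ => Cq; rewrite !ler_norml => /andP[? ?] /andP[? ?] /andP[? ?].
by apply/andP; split; lra.
Unshelve. all: by end_near. Qed.

End asymptotic_exchangeability.

(** * Measurability of the matched sample and of the test *)

Lemma measurable_select d (T : measurableType d) d' (U : measurableType d')
    (J : T -> nat) (f : nat -> T -> U) :
  (forall l, measurable [set w | J w = l]) ->
  (forall l, measurable_fun setT (f l)) -> measurable_fun setT (fun w => f (J w) w).
Proof.
move=> mJ mf _ B mB; rewrite setTI.
have -> : (fun w => f (J w) w) @^-1` B =
    \bigcup_l ([set w | J w = l] `&` f l @^-1` B).
  apply/seteqP; split=> [w fB|w [l _ [<-//]]].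
  by exists (J w).
apply: bigcupT_measurable => l; apply: measurableI => //.
by rewrite -[X in measurable X]setTI; exact: mf.
Qed.

(** The sorted list depends on the relation only through the finite table of its values below [N],
    so the event is a finite union over tables. *)
Lemma measurable_sort d (T : measurableType d) (r : T -> rel nat) (N : nat)
    (D : set (seq nat)) :
  (forall j l, (j < N)%N -> (l < N)%N -> measurable [set w | r w j l]) ->
  measurable [set w | D (sort (r w) (iota 0 N))].
Proof.
move=> mr.
pose rc (c : {ffun 'I_N * 'I_N -> bool}) : rel 'I_N := fun i j => c (i, j).
have srt w : sort (r w) (iota 0 N) = map val (sort (relpre val (r w)) (enum 'I_N)).
  by rewrite -sort_map val_enum_ord.
pose good (c : {ffun 'I_N * 'I_N -> bool}) : set T :=
  [set w | D (map val (sort (rc c) (enum 'I_N)))] `&`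
  \bigcap_(p in [set: 'I_N * 'I_N]) [set w | r w (val p.1) (val p.2) = c p].
have -> : [set w | D (sort (r w) (iota 0 N))] =
    \bigcup_(c in [set: {ffun 'I_N * 'I_N -> bool}]) good c.
  apply/seteqP; split=> w /=.
    rewrite srt => Dw; exists [ffun p => r w (val p.1) (val p.2)] => //; split => /=.
      rewrite (_ : rc _ = relpre val (r w))//.
      by apply/funext => i; apply/funext => j; rewrite /rc ffunE.
    by move=> p _ /=; rewrite ffunE.
  move=> [c _ [/= Dc rwc]]; rewrite srt (_ : (relpre val (r w) : rel 'I_N) = rc c)//.
  apply/funext => i; apply/funext => j; exact: (rwc (i, j) Logic.I).
apply: fin_bigcup_measurable => // c _; apply: measurableI.
  have [Dc|nDc] := pselect (D (map val (sort (rc c) (enum 'I_N)))).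
    by rewrite (_ : mkset _ = setT)//; apply/seteqP; split.
  by rewrite (_ : mkset _ = set0)//; apply/seteqP; split.
apply: fin_bigcap_measurable => // p _; case: (c p).
  by apply: mr; exact: ltn_ord.
rewrite (_ : mkset _ = ~` [set w | r w (val p.1) (val p.2)]).
  by apply: measurableC; apply: mr; exact: ltn_ord.
by apply/seteqP; split=> w /=; [move=> ->|move=> /negP/negbTE].
Qed.

Section matched_measurable.
Context (R : realType) (k : nat) (V : 'M[R]_k).
Local Notation cov := 'rV[R]_k.
Local Notation obs := (R * cov)%type.

Lemma mdistE (a b : cov) : Defs.mdist V a b =
  Num.sqrt (\sum_j (\sum_i (a ord0 i - b ord0 i) * V i j) * (a ord0 j - b ord0 j)).
Proof.
rewrite /Defs.mdist; congr Num.sqrt; rewrite mxE; apply: eq_bigr => j _.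
by rewrite !mxE; congr (_ * _); apply: eq_bigr => i _; rewrite !mxE.
Qed.

Lemma measurable_mdist d (T : measurableType d) (a b : T -> cov) :
  measurable_fun setT a -> measurable_fun setT b ->
  measurable_fun setT (fun w => Defs.mdist V (a w) (b w)).
Proof.
move=> ma mb; under eq_fun do rewrite mdistE.
have mD j : measurable_fun setT (fun w => a w ord0 j - b w ord0 j).
  apply: measurable_funB.
    exact: (measurableT_comp (@measurable_coord _ R k j)).
  exact: (measurableT_comp (@measurable_coord _ R k j)).
apply: measurableT_comp.
  by apply: continuous_measurable_fun; exact: sqrt_continuous.
apply: measurable_sum => j; apply: measurable_funM => //.
by apply: measurable_sum => i; apply: measurable_funM => //; exact: measurable_cst.
Qed.

Context d (T : measurableType d).

(** The type [T] is arbitrary because the lemma is also applied to the sigma-algebra of the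
    covariates. *)
Lemma measurable_neighbours (x : T -> cov) (z : nat -> T -> obs) N (D : set (seq nat)) :
  measurable_fun setT x ->
  (forall j, (j < N)%N -> measurable_fun setT (fun w => (z j w).2)) ->
  measurable [set w | D (neighbours V (x w) (z^~ w) N)].
Proof.
move=> mx mz; apply: measurable_sort => j l jN lN.
rewrite -[X in measurable X]setTI.
have := @measurable_fun_ler _ T R setT (fun w => Defs.mdist V (x w) (z j w).2)
  (fun w => Defs.mdist V (x w) (z l w).2) (measurable_mdist mx (mz j jN)) (measurable_mdist mx (mz l lN)).
move=> /(_ measurableT [set true])/= H; rewrite (_ : [set w | _] = (fun w => Defs.mdist V (x w) (z j w).2 <= Defs.mdist V (x w) (z l w).2) @^-1` [set true])//.
exact: H.
Qed.

Lemma measurable_matched_sample (M N1 N : nat) (c : R) (z1 : 'I_N1 -> T -> obs)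
    (z0 : nat -> T -> obs) i m :
  (forall i, measurable_fun setT (z1 i)) -> (forall j, measurable_fun setT (z0 j)) ->
  measurable_fun setT (fun w => matched_sample V M c (z1^~ w) (z0^~ w) N i m).
Proof.
move=> mz1 mz0; under eq_fun do rewrite mxE.
case: m => -[|m] /= _.
  by apply: measurable_funB => //; exact: (measurableT_comp measurable_fst).
apply: (@measurable_select _ T _ R (fun w => nth 0%N (neighbours V (z1 i w).2 (z0^~ w) N) m)
  (fun l w => (z0 l w).1)).
  move=> l; apply: (@measurable_neighbours (fun w => (z1 i w).2) z0 N (fun t => nth 0%N t m = l)).
    exact: (measurableT_comp measurable_snd).
  by move=> j _; exact: (measurableT_comp measurable_snd).
by move=> l; exact: (measurableT_comp measurable_fst).
Qed.

End matched_measurable.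

Section test_measurable.
Context (R : realType) (N1 M : nat) d (T : measurableType d) (X : T -> 'M[R]_(N1, M.+1)).
Hypothesis mX : forall i m, measurable_fun setT (fun w => X w i m).

Lemma measurable_contrast : measurable_fun setT (fun w => contrast (X w)).
Proof.
apply: measurable_funM; first exact: measurable_cst.
apply: measurable_sum => i; apply: measurable_funB => //.
by apply: measurable_funM; [exact: measurable_cst|apply: measurable_sum => j].
Qed.

End test_measurable.

Section permuted_test_measurable.
Context (R : realType) (N1 M : nat) d (T : measurableType d) (X : T -> 'M[R]_(N1, M.+1)).
Hypothesis mX : forall i m, measurable_fun setT (fun w => X w i m).

Lemma measurable_permuted pi i m : measurable_fun setT (fun w => permuted (X w) pi i m).
Proof. by under eq_fun do rewrite mxE; exact: mX. Qed.

Lemma measurable_test_stat : measurable_fun setT (fun w => test_stat (X w)).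
Proof. by apply: measurableT_comp => //; exact: measurable_contrast. Qed.

Lemma measurable_zap (i : 'I_N1) j m : measurable_fun setT (fun w => zap i (X w) j m).
Proof.
have E w : zap i (X w) j m =
    X w j m - X w i ord0 * ((j == i) && (m == ord0))%:R by rewrite !mxE.
under eq_fun do rewrite E.
apply: measurable_funB => //; apply: measurable_funM => //; exact: measurable_cst.
Qed.

Lemma measurable_contrast_pm b pi : measurable_fun setT (fun w => contrast_pm b pi (X w)).
Proof.
apply: measurable_funD; first exact: measurable_contrast.
apply: measurable_funM; first exact: measurable_cst.
apply: measurable_contrast => i m; exact: measurable_permuted.
Qed.

End permuted_test_measurable.

Lemma measurable_smooth_test (R : realType) (N1 M : nat) d (T : measurableType d)
    (X : T -> 'M[R]_(N1, M.+1)) alpha e :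
  (forall i m, measurable_fun setT (fun w => X w i m)) ->
  measurable_fun setT (fun w => smooth_test alpha e (X w)).
Proof.
move=> mX; have mc : measurable_fun setT (@clamp01 R).
  apply: measurable_maxr; first exact: measurable_cst.
  by apply: measurable_minr => //; exact: measurable_cst.
apply: measurableT_comp => //; apply: measurable_funB; last exact: measurable_cst.
apply: measurable_sum => pi; apply: measurableT_comp => //.
apply: measurable_funM; last exact: measurable_cst.
apply: measurable_funB; apply: measurable_test_stat => // i m.
exact: measurable_permuted.
Qed.

Lemma measurable_perm_test (R : realType) (N1 M : nat) d (T : measurableType d)
    (X : T -> 'M[R]_(N1, M.+1)) alpha (alpha01 : 0 < alpha < 1) :
  (forall i m, measurable_fun setT (fun w => X w i m)) ->
  measurable_fun setT (fun w => (perm_test alpha (X w))%:R : R).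
Proof.
move=> mX.
have -> : (fun w => (perm_test alpha (X w))%:R : R) = \1_[set w |
   (critical_rank N1 M alpha)%:R <= \sum_(pi : group_perm N1 M)
     \1_[set w | test_stat (permuted (X w) pi) < test_stat (X w)] w :> R].
  apply/funext => w; rewrite indicE; congr (nat_of_bool _)%:R.
  rewrite perm_testE//; apply/idP/idP; rewrite inE/= -(ler_nat R) natr_sum.
    by move=> /le_trans; apply; apply: ler_sum => pi _; rewrite indicE; case: ltP => //= h; rewrite mem_set.
  by move=> /le_trans; apply; apply: ler_sum => pi _; rewrite indicE; case: (boolP (_ \in _)) => //; rewrite inE/= => ->.
apply: measurable_indic; rewrite -[X in measurable X]setTI.
apply: (@measurable_fun_ler _ T R setT (cst (critical_rank N1 M alpha)%:R) (fun w =>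
  \sum_(pi : group_perm N1 M) \1_[set w | test_stat (permuted (X w) pi) < test_stat (X w)] w) _ _ measurableT [set true]) => //.
apply: measurable_sum => pi; apply: measurable_indic; rewrite -[X in measurable X]setTI.
apply: (@measurable_fun_ltr _ T R setT (fun w => test_stat (permuted (X w) pi)) (fun w => test_stat (X w)) _ _ measurableT [set true]) => //.
  by apply: measurable_test_stat => i m; exact: measurable_permuted.
exact: measurable_test_stat.
Qed.

(** * The common regression function *)

(** Apply the hypothesis to the event where [f] is negative. *)
Lemma ae_ge0 d (T : measurableType d) (R : realType) (mu : {measure set T -> \bar R})
    (f : T -> R) :
  mu.-integrable setT (EFin \o f) ->
  (forall B, measurable B -> (0 <= \int[mu]_(x in B) (f x)%:E)%E) ->
  {ae mu, forall x, 0 <= f x}.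
Proof.
move=> fi fB; have mEf := measurable_int _ fi.
have mf : measurable_fun setT f by exact/measurable_EFinP.
pose B := f @^-1` [set` `]-oo, 0[].
have mB : measurable B by rewrite -[X in measurable X]setTI; exact: mf.
have Blt x : B x -> f x < 0 by rewrite /B/= in_itv.
have : (\int[mu]_(x in B) `|(f x)%:E| = 0)%E.
  have E : (\int[mu]_(x in B) (f x)%:E = - \int[mu]_(x in B) `|(f x)%:E|)%E.
    rewrite -integral_ge0N//; apply: eq_integral => x; rewrite inE => /Blt fx.
    by rewrite lte0_abs ?lte_fin// oppeK.
  have := fB B mB; rewrite E oppe_ge0 => I0.
  by apply/eqP; rewrite eq_le I0 integral_ge0.
move=> /(ae_eq_integral_abs mu mB (measurable_funTS mEf)).
apply: filterS => x fx0; rewrite leNgt; apply/negP => fx.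
have Bx : B x by rewrite /B/= in_itv.
by have := fx0 Bx => -[fx00]; rewrite fx00 ltxx in fx.
Qed.

Section conditional_expectation.
Context d (Omega : measurableType d) (R : realType) (P : probability Omega R)
  d' (V : measurableType d') (X : {mfun Omega >-> V}).
Variables (Z : Omega -> R) (g : V -> R).
Hypotheses (mZ : measurable_fun setT Z) (Z01 : forall w, 0 <= Z w <= 1).
Hypothesis gZ : is_cond_expectation P X Z g.

Let bZ : P.-integrable setT (EFin \o Z).
Proof.
apply: measurable_bounded_integrable => //.
  apply: (@le_lt_trans _ _ 1%E); last exact: ltry.
  by rewrite le_eqVlt; apply/orP; left; apply/eqP; exact: probability_setT.
exists 1; split; first exact: num_real.
by move=> C C1 x _ /=; have /andP[? ?] := Z01 x; rewrite ger0_norm// (le_trans _ (ltW C1)).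
Qed.

(** A version of a conditional expectation has its values in [[0, 1]] only almost everywhere.
    Clamping it makes the bounds hold everywhere, as [weighted_law_ext] requires of its weights. *)
Lemma cond_expectation_ae_unit : {ae distribution P X, forall x, clamp01 (g x) = g x}.
Proof.
have [mg ig gB] := gZ.
have a0 : {ae distribution P X, forall x, 0 <= g x}.
  apply: ae_ge0 => // B mB; rewrite -gB//; apply: integral_ge0 => w _.
  by rewrite lee_fin; case/andP: (Z01 w).
have i1 : (distribution P X).-integrable setT (EFin \o cst 1).
  exact: finite_measure_integrable_cst.
have i1' : P.-integrable setT (EFin \o cst 1).
  exact: finite_measure_integrable_cst.
have a1 : {ae distribution P X, forall x, 0 <= 1 - g x}.
  apply: ae_ge0 => [|B mB]; first exact: integrableB i1 ig.
  under eq_integral do rewrite EFinB.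
  rewrite (@integralB_EFin _ _ _ _ B (cst 1) g mB); last 2 first.
  - exact: integrableS i1.
  - exact: integrableS ig.
  have mXB : measurable (X @^-1` B) by exact: measurable_funPTI.
  rewrite -gB// [X in (X - _)%E](_ : _ = \int[P]_(w in X @^-1` B) (cst 1 w)%:E)%E; last first.
    rewrite (_ : (fun x : V => _) = cst 1%E)// (_ : (fun x : Omega => _) = cst 1%E)//.
    by rewrite !integral_cst.
  rewrite -(@integralB_EFin _ _ _ _ (X @^-1` B) (cst 1) Z mXB); last 2 first.
  - exact: integrableS i1'.
  - exact: integrableS bZ.
  apply: integral_ge0 => w _; rewrite -EFinB lee_fin subr_ge0.
  by case/andP: (Z01 w).
apply: filterS2 a0 a1 => x g0 g1; rewrite clamp01_id// g0/=.
by rewrite -subr_ge0.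
Qed.

Lemma cond_expectation_unit B : measurable B ->
  (\int[P]_w (Z w * \1_B (X w))%:E = \int[P]_w (clamp01 (g (X w)) * \1_B (X w))%:E)%E.
Proof.
have [mg ig gB] := gZ; move=> mB.
have mXB : measurable (X @^-1` B) by exact: measurable_funPTI.
have mc : measurable_fun setT (fun x => clamp01 (g x)).
  apply: measurable_maxr; first exact: measurable_cst.
  by apply: measurable_minr => //; exact: measurable_cst.
transitivity (\int[distribution P X]_(x in B) (g x)%:E)%E.
  by rewrite -gB// -[RHS]integral_indicM.
transitivity (\int[distribution P X]_(x in B) (clamp01 (g x))%:E)%E.
  apply: ae_eq_integral => //.
  - exact/measurable_EFinP/measurable_funTS.
  - exact/measurable_EFinP/measurable_funTS.
  - by apply: filterS cond_expectation_ae_unit => x ->.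
rewrite -[LHS]integral_indicM ge0_integral_distribution//.
- apply/measurable_EFinP; apply: measurable_funM => //; exact: measurable_indic.
- by move=> x; rewrite lee_fin mulr_ge0// ?clamp01_ge0// indicE.
Qed.

End conditional_expectation.

Lemma measurable_clamp01 (R : realType) : measurable_fun setT (@clamp01 R).
Proof.
apply: measurable_maxr; first exact: measurable_cst.
by apply: measurable_minr => //; exact: measurable_cst.
Qed.

(** * Conditional laws given the treatment, supports and densities *)

Section integral_cond_prob.
Context (R : realType) d (Omega : measurableType d) (P : probability Omega R)
  (W : {mfun Omega >-> bool}) (w : bool).
Hypothesis W_gt0 : (0 < P (W @^-1` [set w]))%E.

Let p := fine (P (W @^-1` [set w])).

Let pE : P (W @^-1` [set w]) = p%:E.
Proof. by rewrite /p fineK// fin_num_measure//; exact: measurable_funPTI. Qed.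

Lemma cond_prob_mass_gt0 : 0 < p.
Proof. by rewrite -lte_fin -pE. Qed.

Lemma cond_probE A : measurable A ->
  cond_prob P W w A = (\int[P]_o (p^-1 * \1_(W @^-1` [set w]) o * \1_A o)%:E)%E.
Proof.
move=> mA; have mW : measurable (W @^-1` [set w]) by exact: measurable_funPTI.
rewrite (_ : (fun o => _) = (fun o => (p^-1)%:E * (\1_(A `&` W @^-1` [set w]) o)%:E)%E); last first.
  by apply/funext => o; rewrite indicI -EFinM -mulrA [X in _ * X]mulrC.
rewrite ge0_integralZl//; last 2 first.
- by apply/measurable_EFinP/measurable_indic; exact: measurableI.
- by rewrite lee_fin invr_ge0 ltW// cond_prob_mass_gt0.
rewrite integral_indic//; last exact: measurableI.
have e : mrestr P (measurable_event W w) setT = p%:E by rewrite /mrestr setTI.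
(* The fallback of [mnormalize], for a total mass that is zero or infinite, is excluded. *)
rewrite setIT /cond_prob /= /mnormalize; case: ifPn => [/orP[]/eqP H|_].
- have : p%:E = 0%E :> \bar R := etrans (esym e) H.
  by move=> [p0]; have := cond_prob_mass_gt0; rewrite p0 ltxx.
- by have : p%:E = +oo%E :> \bar R := etrans (esym e) H.
rewrite muleC; congr (_ * _)%E; congr ((fine _)^-1)%:E; exact: etrans e (esym pE).
Qed.

Lemma integral_cond_prob (h : Omega -> R) : measurable_fun setT h -> (forall o, 0 <= h o) ->
  (\int[cond_prob P W w]_o (h o)%:E =
   \int[P]_o (p^-1 * \1_(W @^-1` [set w]) o * h o)%:E)%E.
Proof.
move=> mh h0; have mW : measurable (W @^-1` [set w]) by exact: measurable_funPTI.
have := @weighted_law_ext R _ _ _ Omega Omega Omega (cond_prob P W w) P (cst 1)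
  (fun o => p^-1 * \1_(W @^-1` [set w]) o) id id (measurable_cst _) _
  (@measurable_id _ _ _) (@measurable_id _ _ _) _ _ h mh h0.
under eq_integral do rewrite mul1r.
apply => //.
- by apply: measurable_funM => //; exact: measurable_indic.
- by move=> o; rewrite mulr_ge0// invr_ge0 ltW// cond_prob_mass_gt0.
move=> A mA; rewrite -cond_probE//.
by under eq_integral do rewrite mul1r; rewrite integral_indic// setIT.
Qed.

End integral_cond_prob.

Section support.
Context (R : realType) (k : nat).
Local Notation cov := 'rV[R]_k.

Lemma closed_msupport (mu : set cov -> \bar R) : closed (msupport mu).
Proof.
rewrite -openC openE => x /= /existsNP[U /not_implyP[oU /not_implyP[Ux /negP U0]]].
rewrite /interior; apply: (@filterS _ _ _ U); last exact: open_nbhs_nbhs.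
by move=> y Uy /(_ U oU Uy); exact/negP.
Qed.

Lemma measurable_msupport (mu : set cov -> \bar R) : measurable (msupport mu).
Proof.
by rewrite -[msupport mu]setCK; apply: measurableC; apply: open_measurable_row; rewrite openC; exact: closed_msupport.
Qed.

Variables (mu : {measure set cov -> \bar R}) (D : set cov) (f : cov -> R).
Hypotheses (mD : measurable D) (fD : is_density mu D f).

Lemma density_outside : mu (~` D) = 0%E.
Proof.
by case: fD => _ _ ->; [rewrite setICl integral_set0|exact: measurableC].
Qed.

Lemma patch_density_ge0 x : 0 <= (f \_ D) x.
Proof. by rewrite patchE; case: ifPn => //; rewrite inE => Dx; case: fD => _ + _; apply. Qed.

Lemma measurable_patch_density : measurable_fun setT (f \_ D).
Proof. by case: fD => mf _ _; exact: (proj1 (measurable_restrictT f mD) mf). Qed.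

Lemma integral_density (h : cov -> R) : measurable_fun setT h -> (forall x, 0 <= h x) ->
  (\int[mu]_x (h x)%:E = \int[lebesgue_row R k]_x ((f \_ D) x * h x)%:E)%E.
Proof.
move=> mh h0; case: (fD) => mf f0 muE.
have := @weighted_law_ext R _ _ _ _ _ _ mu (lebesgue_row R k) (cst 1) (f \_ D) id id
  (measurable_cst _) measurable_patch_density (@measurable_id _ _ _) (@measurable_id _ _ _)
  (fun=> ler01) patch_density_ge0 h mh h0.
under eq_integral do rewrite mul1r.
apply => A mA; under eq_integral do rewrite mul1r.
rewrite integral_indic// setIT muE// [LHS]integral_mkcond; apply: eq_integral => x _.
by rewrite !patchE in_setI indicE; do 2 case: (_ \in _); rewrite /= ?mulr1 ?mulr0 ?mul0r.
Qed.

End support.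

Section density_ratio.
Context (R : realType) (k : nat).
Local Notation cov := 'rV[R]_k.
Variables (mu1 mu0 : {measure set cov -> \bar R}) (D1 D0 : set cov) (f1 f0 : cov -> R) (C : R).
Hypotheses (mD1 : measurable D1) (mD0 : measurable D0) (D10 : D1 `<=` D0).
Hypotheses (f1D : is_density mu1 D1 f1) (f0D : is_density mu0 D0 f0).
Hypotheses (C0 : 0 < C) (f0C : forall x, D1 x -> C <= f0 x).

(* [`^ (-1)] rather than [^-1]: powers are measurable in the library. *)
Definition density_ratio (x : cov) : R := (f1 \_ D1) x * ((f0 \_ D0) x `^ (-1)).

Lemma density_ratio_ge0 x : 0 <= density_ratio x.
Proof. by rewrite mulr_ge0// ?powR_ge0// (patch_density_ge0 f1D). Qed.

Lemma measurable_density_ratio : measurable_fun setT density_ratio.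
Proof.
apply: measurable_funM; first exact: (measurable_patch_density mD1 f1D).
apply: (measurableT_comp (@measurable_powR R (-1))).
exact: (measurable_patch_density mD0 f0D).
Qed.

(** On [D1] the density [f0] is at least [C], so the quotient cancels; off [D1] both integrands
    vanish. *)
Lemma integral_density_ratio (h : cov -> R) : measurable_fun setT h -> (forall x, 0 <= h x) ->
  (\int[mu1]_x (h x)%:E = \int[mu0]_x (density_ratio x * h x)%:E)%E.
Proof.
move=> mh h0; rewrite (integral_density mD1 f1D)// (integral_density mD0 f0D); last 2 first.
- by apply: measurable_funM => //; exact: measurable_density_ratio.
- by move=> x; rewrite mulr_ge0// density_ratio_ge0.
apply: eq_integral => x _; congr EFin; rewrite /density_ratio mulrA; congr (_ * _).
rewrite !patchE; case: ifPn; rewrite ?mul0r ?mulr0// inE => D1x.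
rewrite mem_set ?powR_inv1; last exact: D10.
- by rewrite mulrCA divff ?mulr1// gt_eqF// (lt_le_trans C0)// f0C.
- by rewrite ltW// (lt_le_trans C0)// f0C.
Qed.

End density_ratio.

Section law_extension.
Context (R : realType) d (Omega : measurableType d) (mu : {measure set Omega -> \bar R})
  d' (T : measurableType d') (X : Omega -> T) (a b : Omega -> R).
Hypotheses (mX : measurable_fun setT X) (ma : measurable_fun setT a) (mb : measurable_fun setT b).
Hypotheses (a0 : forall w, 0 <= a w) (b0 : forall w, 0 <= b w).

Lemma same_weighted_law (g : T -> R) : measurable_fun setT g -> (forall x, 0 <= g x) ->
  (forall B, measurable B ->
    (\int[mu]_w (a w * \1_B (X w))%:E = \int[mu]_w (b w * \1_B (X w))%:E)%E) ->
  (\int[mu]_w (a w * g (X w))%:E = \int[mu]_w (b w * g (X w))%:E)%E.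
Proof. by move=> mg g0; apply: weighted_law_ext. Qed.

End law_extension.

Section conditional_independence_transfer.
Context (R : realType) d (Omega : measurableType d) (P : probability Omega R)
  d' (V : measurableType d') (X : {mfun Omega >-> V}) (Y : {RV P >-> R})
  (W : {mfun Omega >-> bool}) (w : bool).
Hypothesis cia : cond_independent P X Y W.

Let a : Omega -> R := \1_(W @^-1` [set w]).

Let mWw : measurable (W @^-1` [set w]). Proof. exact: measurable_funPTI. Qed.

Let ma : measurable_fun setT a. Proof. exact: measurable_indic. Qed.

Let indic01 (A : set Omega) o : 0 <= (\1_A o : R) <= 1.
Proof. by rewrite indicE; case: (_ \in _); rewrite ?lexx ?ler01. Qed.

Let mcl (g : V -> R) : measurable_fun setT g -> measurable_fun setT (fun x => clamp01 (g x)).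
Proof. by move=> mg; exact: (measurableT_comp (@measurable_clamp01 R) mg). Qed.

Let mXc (g : V -> R) : measurable_fun setT g -> measurable_fun setT (fun o => g (X o)).
Proof. by move=> mg; exact: measurableT_comp. Qed.

(** Let [e (X)] be the probability of [W = w] given [X]. Conditional independence replaces the
    indicator [a] by [e (X)] in integrals against functions of [Y] and [X]; then [h (Y)] is replaced
    by [hh (X)], and [e (X)] is turned back into [a]. *)
Lemma cond_independent_transfer (h : R -> R) (hh : V -> R) :
  measurable_fun setT h -> (forall y, 0 <= h y) ->
  measurable_fun setT hh -> (forall x, 0 <= hh x) ->
  (forall C, measurable C -> (\int[P]_o (h (Y o) * \1_C (X o))%:E =
                              \int[P]_o (hh (X o) * \1_C (X o))%:E)%E) ->
  forall C, measurable C ->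
    (\int[P]_o (a o * h (Y o) * \1_C (X o))%:E =
     \int[P]_o (a o * hh (X o) * \1_C (X o))%:E)%E.
Proof.
move=> mh h0 mhh hh0 H C mC.
have m1 (B : set V) : measurable B -> measurable_fun setT (\1_B : V -> R).
  by move=> mB; exact: measurable_indic.
have i0 (T : Type) (B : set T) x : 0 <= (\1_B x : R) by rewrite indicE.
(* Only a version of the probability of [W = w] given [X] is extracted here. *)
have [_ [pe [_ [_ eW _ _]]]] := cia measurableT (I : measurable [set w]).
pose e x := clamp01 (pe x).
have me : measurable_fun setT e by case: eW => mpe _ _; exact: mcl.
have e0 x : 0 <= e x by exact: clamp01_ge0.
have eE (g : V -> R) : measurable_fun setT g -> (forall x, 0 <= g x) ->
    (\int[P]_o (a o * g (X o))%:E = \int[P]_o (e (X o) * g (X o))%:E)%E.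
  move=> mg g0; apply: same_weighted_law => //; first exact: mXc.
  by move=> B mB; exact: (cond_expectation_unit ma (indic01 _) eW).
have key (A : set R) : measurable A ->
    (\int[P]_o ((a o * \1_C (X o)) * \1_A (Y o))%:E =
     \int[P]_o ((e (X o) * \1_C (X o)) * \1_A (Y o))%:E)%E.
  move=> mA.
  have mYA : measurable (Y @^-1` A) by exact: measurable_funPTI.
  have [pA [pB [pAB [eA eB eAB ABE]]]] := cia mA (I : measurable [set w]).
  have mpA : measurable_fun setT pA by case: eA.
  have mpB : measurable_fun setT pB by case: eB.
  have mpAB : measurable_fun setT pAB by case: eAB.
  have mYI : measurable_fun setT (\1_(Y @^-1` A) : Omega -> R) by exact: measurable_indic.
  have mYW : measurable_fun setT (\1_(Y @^-1` A `&` W @^-1` [set w]) : Omega -> R).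
    by apply: measurable_indic; exact: measurableI.
  have aeE : {ae distribution P X, forall x, clamp01 (pAB x) = clamp01 (pA x) * clamp01 (pB x)}.
    have aA := cond_expectation_ae_unit mYI (indic01 _) eA.
    have aB := cond_expectation_ae_unit ma (indic01 _) eB.
    have aAB := cond_expectation_ae_unit mYW (indic01 _) eAB.
    by apply: filterS3 aA aB (filterI aAB ABE) => x -> -> [-> ->].
  transitivity (\int[P]_o (\1_(Y @^-1` A `&` W @^-1` [set w]) o * \1_C (X o))%:E)%E.
    apply: eq_integral => o _; congr EFin; rewrite indicI.
    by rewrite mulrAC; congr (_ * _); exact: mulrC.
  rewrite (cond_expectation_unit mYW (indic01 _) eAB)//.
  transitivity (\int[P]_o (clamp01 (pB (X o)) * (clamp01 (pA (X o)) * \1_C (X o)))%:E)%E.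
    transitivity (\int[distribution P X]_x (clamp01 (pAB x) * \1_C x)%:E)%E.
      rewrite ge0_integral_distribution//.
      - by apply/measurable_EFinP/measurable_funM; [exact: mcl|exact: m1].
      - by move=> x; rewrite lee_fin mulr_ge0// clamp01_ge0.
    transitivity (\int[distribution P X]_x (clamp01 (pB x) * (clamp01 (pA x) * \1_C x))%:E)%E.
      apply: ae_eq_integral => //.
      - by apply/measurable_EFinP/measurable_funM; [exact: mcl|exact: m1].
      - apply/measurable_EFinP/measurable_funM; first exact: mcl.
        by apply: measurable_funM; [exact: mcl|exact: m1].
      - by apply: filterS aeE => x -> _; rewrite mulrA [clamp01 (pB x) * _]mulrC.
    rewrite ge0_integral_distribution//.
    - apply/measurable_EFinP/measurable_funM; first exact: mcl.
      by apply: measurable_funM; [exact: mcl|exact: m1].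
    - by move=> x; rewrite lee_fin !mulr_ge0// clamp01_ge0.
  (* The version [pB] may vary with [A]; passing through [a] exchanges it for the fixed [e]. *)
  transitivity (\int[P]_o (a o * (clamp01 (pA (X o)) * \1_C (X o)))%:E)%E.
    apply/esym; apply: (@same_weighted_law R _ _ P _ V X a (fun o => clamp01 (pB (X o)))
      _ _ _ _ _ (fun x => clamp01 (pA x) * \1_C x)) => //.
    - exact: (mXc (mcl mpB)).
    - by move=> o; exact: clamp01_ge0.
    - by apply: measurable_funM; [exact: mcl|exact: m1].
    - by move=> x; rewrite mulr_ge0// clamp01_ge0.
    - by move=> B mB; exact: (cond_expectation_unit ma (indic01 _) eB).
  rewrite (eE (fun x => clamp01 (pA x) * \1_C x)); last 2 first.
  - by apply: measurable_funM; [exact: mcl|exact: m1].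
  - by move=> x; rewrite mulr_ge0// clamp01_ge0.
  transitivity (\int[P]_o (clamp01 (pA (X o)) * (e (X o) * \1_C (X o)))%:E)%E.
    by apply: eq_integral => o _; rewrite mulrCA.
  transitivity (\int[P]_o (\1_(Y @^-1` A) o * (e (X o) * \1_C (X o)))%:E)%E.
    apply/esym; apply: (@same_weighted_law R _ _ P _ V X (\1_(Y @^-1` A)) (fun o => clamp01 (pA (X o)))
      _ _ _ _ _ (fun x => e x * \1_C x)) => //.
    - exact: (mXc (mcl mpA)).
    - by move=> o; exact: clamp01_ge0.
    - by apply: measurable_funM; [exact: me|exact: m1].
    - by move=> x; rewrite mulr_ge0.
    - by move=> B mB; exact: (cond_expectation_unit mYI (indic01 _) eA).
  by apply: eq_integral => o _; rewrite mulrC.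
transitivity (\int[P]_o ((a o * \1_C (X o)) * h (Y o))%:E)%E.
  by apply: eq_integral => o _; rewrite mulrAC.
rewrite (@same_weighted_law R _ _ P _ R Y (fun o => a o * \1_C (X o)) (fun o => e (X o) * \1_C (X o)))//.
- transitivity (\int[P]_o (h (Y o) * (e (X o) * \1_C (X o)))%:E)%E.
    by apply: eq_integral => o _; rewrite mulrC.
  rewrite (@same_weighted_law R _ _ P _ V X (fun o => h (Y o)) (fun o => hh (X o)) _ _ _ _ _ (fun x => e x * \1_C x))//.
  + transitivity (\int[P]_o (e (X o) * (hh (X o) * \1_C (X o)))%:E)%E.
      by apply: eq_integral => o _; rewrite mulrCA.
    rewrite -(eE (fun x => hh x * \1_C x)).
    * by apply: eq_integral => o _; rewrite mulrA.
    * by apply: measurable_funM => //; exact: m1.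
    * by move=> x; rewrite mulr_ge0.
  + exact: measurableT_comp.
  + exact: mXc.
  + by apply: measurable_funM => //; exact: m1.
  + by move=> x; rewrite mulr_ge0.
- by apply: measurable_funM => //; exact: (mXc (m1 _ mC)).
- by apply: measurable_funM; [exact: mXc|exact: (mXc (m1 _ mC))].
- by move=> o; rewrite mulr_ge0// /a.
- by move=> o; rewrite mulr_ge0.
Qed.

End conditional_independence_transfer.

Section matched_outcomes.
Context (R : realType) d (Omega : measurableType d) (P : probability Omega R) (k : nat).
Local Notation cov := 'rV[R]_k.
Context (Y0 : {RV P >-> R}) (T1 : Omega -> R) (mT1 : measurable_fun setT T1)
  (X : {mfun Omega >-> cov}) (W : {mfun Omega >-> bool}).
Hypothesis W_gt0 : forall w, (0 < P (W @^-1` [set w]))%E.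
Variable f : bool -> cov -> R.
Hypothesis f_density : forall w : bool,
  is_density (distribution (cond_prob P W w) X) (cond_support P X W w) (f w).
Hypothesis cia : cond_independent P X Y0 W.
Hypothesis supports_nested : cond_support P X W true `<=` cond_support P X W false.
Hypothesis f0_bounded_below : exists2 C : R, 0 < C &
  forall x, cond_support P X W true x -> C <= f false x.
Hypothesis homogeneity : exists kappa1 kappa0 : R.-pker cov ~> R,
  [/\ is_cond_distribution (cond_prob P W true) X T1 kappa1,
      is_cond_distribution (cond_prob P W false) X Y0 kappa0 &
      forall x, cond_support P X W true x ->
        forall A, measurable A -> kappa1 x A = kappa0 x A].

Let Pc := cond_prob P W.

Let m1 (B : set cov) : measurable B -> measurable_fun setT (\1_B : cov -> R).
Proof. by move=> mB; exact: measurable_indic. Qed.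

Let mX1 (B : set cov) : measurable B -> measurable_fun setT (fun o => \1_B (X o) : R).
Proof. by move=> mB; apply: (measurableT_comp (m1 mB)). Qed.

Let mY0I (A : set R) : measurable A -> measurable_fun setT (fun o => \1_A (Y0 o) : R).
Proof. by move=> mA; apply: (measurableT_comp (measurable_indic mA)). Qed.

(** The weight is the ratio of the densities of [X] among the treated and among the controls. By
    homogeneity [T1] has, given [X], the conditional law of [Y0] among the controls, so the same
    weight also serves for integrals that involve the outcome. *)
Lemma treated_reweighting : exists2 wt : cov -> R,
  measurable_fun setT wt /\ (forall x, 0 <= wt x) &
  (forall g : cov -> R, measurable_fun setT g -> (forall x, 0 <= g x) ->
     (\int[Pc true]_o (g (X o))%:E = \int[Pc false]_o (wt (X o) * g (X o))%:E)%E) /\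
  (forall (h : R -> R) (B : set cov), measurable_fun setT h -> (forall y, 0 <= h y) ->
     measurable B ->
     (\int[Pc true]_o (h (T1 o) * \1_B (X o))%:E =
      \int[Pc false]_o (wt (X o) * \1_B (X o) * h (Y0 o))%:E)%E).
Proof.
have [C C0 f0C] := f0_bounded_below.
have mD w : measurable (cond_support P X W w) by exact: measurable_msupport.
pose wt := density_ratio (cond_support P X W true) (cond_support P X W false) (f true) (f false).
have mwt : measurable_fun setT wt.
  exact: (measurable_density_ratio (mD true) (mD false) (f_density true) (f_density false)).
have wt0 x : 0 <= wt x by exact: (density_ratio_ge0 _ _ (f_density true)).
have wtE (g : cov -> R) : measurable_fun setT g -> (forall x, 0 <= g x) ->
    (\int[Pc true]_o (g (X o))%:E = \int[Pc false]_o (wt (X o) * g (X o))%:E)%E.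
  move=> mg g0; have := integral_density_ratio (mD true) (mD false) supports_nested
    (f_density true) (f_density false) C0 f0C mg g0.
  have lawE w (u : cov -> R) : measurable_fun setT u -> (forall x, 0 <= u x) ->
      (\int[distribution (Pc w) X]_x (u x)%:E = \int[Pc w]_o (u (X o))%:E)%E.
    move=> mu u0; apply: (@ge0_integral_distribution _ _ _ _ R (Pc w) X (EFin \o u)).
      exact/measurable_EFinP.
    by move=> x; rewrite lee_fin.
  rewrite lawE// lawE//; first exact: measurable_funM.
  by move=> x; rewrite mulr_ge0.
exists wt => //; split => // h B mh h0 mB.
have [kappa1 [kappa0 [K1 K0 K10]]] := homogeneity.
suff key (A : set R) : measurable A ->
    (\int[Pc true]_o (\1_B (X o) * \1_A (T1 o))%:E =
     \int[Pc false]_o ((wt (X o) * \1_B (X o)) * \1_A (Y0 o))%:E)%E.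
  transitivity (\int[Pc true]_o (\1_B (X o) * h (T1 o))%:E)%E.
    by apply: eq_integral => o _; rewrite mulrC.
  apply: (@weighted_law_ext R _ _ _ Omega Omega R (Pc true) (Pc false)
    (fun o => \1_B (X o)) (fun o => wt (X o) * \1_B (X o)) T1 Y0) => //.
  - exact: mX1.
  - by apply: measurable_funM; [exact: measurableT_comp|exact: mX1].
  - by move=> o; rewrite mulr_ge0.
move=> mA; pose kA x := fine (kappa0 x A).
have kAE x : kappa0 x A = (kA x)%:E.
  rewrite /kA fineK// ge0_fin_numE//; apply: (@le_lt_trans _ _ 1%E); last exact: ltry.
  by rewrite -(@prob_kernel _ _ _ _ _ kappa0 x); apply: le_measure; rewrite ?inE.
have kA0 x : 0 <= kA x by rewrite -lee_fin -kAE.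
have mkA : measurable_fun setT kA.
  by apply: measurableT_comp => //; exact: (measurable_kernel kappa0 A mA).
have indE w (Y : Omega -> R) (B' : set cov) : measurable B' -> measurable_fun setT Y ->
    (\int[Pc w]_o (\1_B' (X o) * \1_A (Y o))%:E = Pc w (X @^-1` B' `&` Y @^-1` A))%E.
  move=> mB' mY; transitivity (\int[Pc w]_o (\1_(X @^-1` B' `&` Y @^-1` A) o)%:E)%E.
    by apply: eq_integral => o _; rewrite indicI.
  rewrite integral_indic ?setIT//; apply: measurableI; first exact: measurable_funPTI.
  by rewrite -[X in measurable X]setTI; exact: mY.
have lawE w (B' : set cov) (u : cov -> R) : measurable B' -> measurable_fun setT u ->
    (forall x, 0 <= u x) ->
    (\int[distribution (Pc w) X]_(x in B') (u x)%:E = \int[Pc w]_o (u (X o) * \1_B' (X o))%:E)%E.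
  move=> mB' mu u0; rewrite -[LHS]integral_indicM.
  apply: (@ge0_integral_distribution _ _ _ _ R (Pc w) X (fun x => (u x * \1_B' x)%:E)).
    by apply/measurable_EFinP/measurable_funM.
  by move=> x; rewrite lee_fin mulr_ge0.
have K0E (B' : set cov) : measurable B' ->
    (\int[Pc false]_o (\1_A (Y0 o) * \1_B' (X o))%:E =
     \int[Pc false]_o (kA (X o) * \1_B' (X o))%:E)%E.
  move=> mB'; under eq_integral do rewrite mulrC.
  rewrite indE// K0// -lawE//.
  by apply: eq_integral => x _; exact: kAE.
rewrite indE// K1//.
have -> : (\int[distribution (Pc true) X]_(x in B) kappa1 x A =
    \int[distribution (Pc true) X]_(x in B) (kA x)%:E)%E.
  apply: ae_eq_integral => //.
  - exact: measurable_funTS (measurable_kernel kappa1 A mA).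
  - exact/measurable_funTS/measurable_EFinP.
  (* The two kernels are known to agree on the support of the treated; its complement is null for
     the covariate of the treated. *)
  exists (~` cond_support P X W true); split.
  - exact: measurableC.
  - exact: (density_outside (mD true) (f_density true)).
  - move=> x /= H Dx; apply: H => _; rewrite -kAE; exact: K10.
rewrite lawE// (wtE (fun x => kA x * \1_B x)); last 2 first.
- by apply: measurable_funM => //; exact: m1.
- by move=> x; rewrite mulr_ge0.
transitivity (\int[Pc false]_o (kA (X o) * (wt (X o) * \1_B (X o)))%:E)%E.
  by apply: eq_integral => o _; rewrite mulrCA.
transitivity (\int[Pc false]_o (\1_A (Y0 o) * (wt (X o) * \1_B (X o)))%:E)%E.
  apply/esym; apply: (@same_weighted_law R _ _ (Pc false) _ cov X (fun o => \1_A (Y0 o))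
    (fun o => kA (X o)) _ _ _ _ _ (fun x => wt x * \1_B x)) => //.
  - exact: mY0I.
  - exact: measurableT_comp.
  - by apply: measurable_funM => //; exact: m1.
  - by move=> x; rewrite mulr_ge0.
by apply: eq_integral => o _; rewrite mulrC.
Qed.

Hypothesis smooth : forall h : R -> R, continuous h ->
  (exists C : R, forall y, `|h y| <= C) ->
  exists htilde : cov -> R,
    [/\ is_cond_expectation P X (h \o Y0) htilde,
        {within msupport (distribution P X), continuous htilde} &
        exists C : R, forall x, msupport (distribution P X) x -> `|htilde x| <= C].

(** Smoothness gives a regression under [P], conditional independence carries it to the controls,
    and the reweighting, being a function of [X], carries it on to the treated. Clamping preserves
    continuity on the support and gives the bounds everywhere. *)
Lemma common_regression (h : R -> R) : continuous h -> (forall y, 0 <= h y <= 1) ->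
  exists hh : cov -> R, [/\ measurable_fun setT hh, forall x, 0 <= hh x <= 1,
    {within msupport (distribution P X), continuous hh},
    forall B, measurable B -> (\int[Pc false]_o (h (Y0 o) * \1_B (X o))%:E =
                               \int[Pc false]_o (hh (X o) * \1_B (X o))%:E)%E &
    forall B, measurable B -> (\int[Pc true]_o (h (T1 o) * \1_B (X o))%:E =
                               \int[Pc true]_o (hh (X o) * \1_B (X o))%:E)%E].
Proof.
move=> ch h01.
have mh : measurable_fun setT h by exact: continuous_measurable_fun.
have h0 y : 0 <= h y by case/andP: (h01 y).
have [|ht [Eht cht _]] := smooth ch.
  by exists 1 => y; have /andP[? ?] := h01 y; rewrite ger0_norm.
have mht : measurable_fun setT ht by case: Eht.
pose hh x := clamp01 (ht x).
have mhh : measurable_fun setT hh by exact: (measurableT_comp (@measurable_clamp01 R) mht).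
have hh0 x : 0 <= hh x by exact: clamp01_ge0.
have mhY : measurable_fun setT (h \o Y0) by exact: measurableT_comp.
have cE := cond_expectation_unit mhY (fun w => h01 (Y0 w)) Eht.
have p0 := cond_prob_mass_gt0 (W_gt0 false).
have mWf : measurable (W @^-1` [set false]) by exact: measurable_funPTI.
have cC (B : set cov) : measurable B -> (\int[Pc false]_o (h (Y0 o) * \1_B (X o))%:E =
                               \int[Pc false]_o (hh (X o) * \1_B (X o))%:E)%E.
  move=> mB; rewrite !integral_cond_prob//.
  - under eq_integral do rewrite mulrA -[_ * _ * h _]mulrA -mulrA EFinM.
    under [RHS]eq_integral do rewrite mulrA -[_ * _ * hh _]mulrA -mulrA EFinM.
    rewrite !ge0_integralZl//.
    + congr (_ * _)%E.
      exact: (cond_independent_transfer false cia mh h0 mhh hh0 cE mB).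
    + apply/measurable_EFinP/measurable_funM; last exact: mX1.
      by apply: measurable_funM; [exact: measurable_indic mWf|exact: measurableT_comp].
    + by move=> o _; rewrite lee_fin !mulr_ge0.
    + by rewrite lee_fin invr_ge0 ltW.
    + apply/measurable_EFinP/measurable_funM; last exact: mX1.
      by apply: measurable_funM; [exact: measurable_indic mWf|exact: measurableT_comp].
    + by move=> o _; rewrite lee_fin !mulr_ge0.
    + by rewrite lee_fin invr_ge0 ltW.
  - by apply: measurable_funM; [exact: measurableT_comp|exact: mX1].
  - by move=> o; rewrite mulr_ge0.
  - by apply: measurable_funM; [exact: measurableT_comp|exact: mX1].
  - by move=> o; rewrite mulr_ge0.
exists hh; split => //.
- by move=> x; exact: clamp01_itv.
- move=> x; apply: (@continuous_comp (subspace (msupport (distribution P X))) _ _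
    ht (@clamp01 R) x); [exact: cht|exact: clamp01_continuous].
move=> B mB; have [wt [mwt wt0] [wtE wth]] := treated_reweighting.
rewrite wth//.
transitivity (\int[Pc false]_o (h (Y0 o) * (wt (X o) * \1_B (X o)))%:E)%E.
  by apply: eq_integral => o _; rewrite mulrC.
rewrite (@same_weighted_law R _ _ (Pc false) _ cov X (fun o => h (Y0 o))
    (fun o => hh (X o)) _ _ _ _ _ (fun x => wt x * \1_B x))//.
- rewrite (wtE (fun x => hh x * \1_B x)).
  + by apply: eq_integral => o _; rewrite mulrCA.
  + by apply: measurable_funM => //; exact: m1.
  + by move=> x; rewrite mulr_ge0.
- exact: measurableT_comp.
- by apply: measurable_funM => //; exact: m1.
- by move=> x; rewrite mulr_ge0.
Qed.

End matched_outcomes.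

(** * Moments of the matched sample *)

(** Used mainly to cut the infinite sample down to finitely many observations, since the integral
    lemmas work with a finite index type. Indices outside the image of [f] receive the trivial
    event. *)
Lemma mutually_independent_comp (R : realType) d (S : measurableType d) (Q : probability S R)
    d' (T : measurableType d') (I : finType) (I' : eqType) (Z : I' -> S -> T) (f : I -> I') :
  injective f -> mutually_independent Q Z -> mutually_independent Q (Z \o f).
Proof.
move=> injf indep s B us mB.
pose B' x := if [pick i | f i == x] is Some i then B i else setT.
have B'f i : B' (f i) = B i.
  rewrite /B'; case: pickP => [j /eqP/injf ->//|/(_ i)]; by rewrite eqxx.
have := indep (map f s) B'; rewrite map_inj_uniq// => /(_ us) H.
rewrite (_ : \bigcap_(i in [set` s]) _ = \bigcap_(i in [set` map f s]) Z i @^-1` B' i).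
  rewrite [LHS]H ?big_map; last first.
    by move=> i; rewrite /B'; case: pickP => [j _|_]; [exact: mB|exact: measurableT].
  by apply: eq_bigr => i _; rewrite B'f.
apply/seteqP; split=> x /= H' i /=.
  by move=> /mapP[j js ->]; rewrite B'f; exact: H'.
by move=> si; have := H' (f i); rewrite /= B'f; apply; exact: map_f.
Qed.

Section matched_moments.
Context (R : realType) (k : nat) (V : 'M[R]_k) (c : R) (N1 M : nat).
Local Notation cov := 'rV[R]_k.
Local Notation obs := (R * cov)%type.
Local Notation cell := ('I_N1 * 'I_M.+1)%type.
Context d (S : measurableType d) (Q : probability S R).
Context (Z1 : 'I_N1 -> {RV Q >-> obs}) (Z0 : nat -> {RV Q >-> obs}).
Hypothesis indep : mutually_independent Q (fun i : ('I_N1 + nat)%type =>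
  match i with inl i1 => Z1 i1 : S -> _ | inr i0 => Z0 i0 : S -> _ end).

Definition match_index (N : nat) (s : S) (i : 'I_N1) (m : nat) : nat :=
  nth 0%N (neighbours V (Z1 i s).2 (fun j => Z0 j s) N) m.

Definition matched_cov (N : nat) (s : S) (i : 'I_N1) (m : 'I_M.+1) : cov :=
  if val m is m'.+1 then (Z0 (match_index N s i m') s).2 else (Z1 i s).2.

Local Notation SN N s := (matched_sample V M c (fun i => Z1 i s) (fun j => Z0 j s) N).

Variables (h : cell -> R -> R) (hh : cell -> cov -> R).
Hypotheses (mh : forall a, measurable_fun setT (h a)) (h01 : forall a y, 0 <= h a y <= 1).
Hypotheses (mhh : forall a, measurable_fun setT (hh a)) (hh01 : forall a x, 0 <= hh a x <= 1).
Hypothesis treated_moment : forall a i (B : set cov), measurable B ->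
  (\int[Q]_s (h a ((Z1 i s).1 - c) * \1_B (Z1 i s).2)%:E =
   \int[Q]_s (hh a (Z1 i s).2 * \1_B (Z1 i s).2)%:E)%E.
Hypothesis control_moment : forall a j (B : set cov), measurable B ->
  (\int[Q]_s (h a (Z0 j s).1 * \1_B (Z0 j s).2)%:E =
   \int[Q]_s (hh a (Z0 j s).2 * \1_B (Z0 j s).2)%:E)%E.

Definition matching_is N (g : {ffun 'I_N1 * 'I_M -> 'I_N}) : set S :=
  [set s | forall i (m : 'I_M), match_index N s i m = g (i, m)].

Lemma cell_prod (F : cell -> R) :
  \prod_a F a = (\prod_i F (i, ord0)) * \prod_(x : 'I_N1 * 'I_M) F (x.1, lift ord0 x.2).
Proof.
transitivity (\prod_i \prod_m F (i, m)).
  by rewrite pair_bigA/=; apply: eq_bigr => -[].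
rewrite -(pair_bigA _ (fun i (m : 'I_M) => F (i, lift ord0 m)))/= -big_split/=.
by apply: eq_bigr => i _; rewrite big_ord_recl.
Qed.

Let sample N (l : ('I_N1 + 'I_N)%type) : {RV Q >-> obs} :=
  match l with inl i => Z1 i | inr j => Z0 (val j) end.

Let sample_indep N : mutually_independent Q (fun l => sample (N := N) l : S -> obs).
Proof.
pose f (l : ('I_N1 + 'I_N)%type) : ('I_N1 + nat)%type :=
  match l with inl i => inl i | inr j => inr (val j) end.
have injf : injective f by move=> [i|j] [i'|j']//= [] => [->//|/val_inj ->//].
have := mutually_independent_comp injf indep.
by congr (mutually_independent Q _); apply/funext => -[].
Qed.

Let pX N (l : ('I_N1 + 'I_N)%type) (z : obs) : cov := z.2.

Let mpX N l : measurable_fun setT (pX (N := N) l).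
Proof. exact: measurable_snd. Qed.

(** The neighbours are determined by the covariates, so the event belongs to the sigma-algebra over
    which outcomes may be replaced by regressions. *)
Lemma matching_is_measurable N g :
  measurable (matching_is (N := N) g : set (cov_space (sample (N := N)) (pX (N := N)))).
Proof.
have -> : matching_is g = \bigcap_(x in [set: 'I_N1 * 'I_M])
    [set s | match_index N s x.1 x.2 = g x].
  by apply/seteqP; split=> [s Hs [i m] _|s Hs i m]; [exact: Hs|exact: (Hs (i, m) Logic.I)].
apply: fin_bigcap_measurable => // -[i m] _ /=.
have mX l : measurable_fun setT ((fun s => (sample (N := N) l s).2) :
    cov_space (sample (N := N)) (pX (N := N)) -> cov).
  exact: (measurable_cov (Z := sample (N := N)) (pX := pX (N := N)) l).
apply: (@measurable_neighbours R k V _ (cov_space (sample (N := N)) (pX (N := N)))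
  (fun s => (Z1 i s).2) (fun j s => Z0 j s) N (fun t => nth 0%N t m = g (i, m))).
  exact: (mX (inl i)).
by move=> j jN; exact: (mX (inr (Ordinal jN))).
Qed.

Lemma measurable_matching_is N (g : {ffun 'I_N1 * 'I_M -> 'I_N}) :
  measurable (matching_is g).
Proof. exact: (cov_space_measurable (mpX (N := N)) (matching_is_measurable g)). Qed.

(** The product over cells regrouped by observation: the control [j] collects the factors of all the
    cells matched to it by [g]. *)
Let ha N (g : {ffun 'I_N1 * 'I_M -> 'I_N}) (l : ('I_N1 + 'I_N)%type) (z : obs) : R :=
  match l with
  | inl i => h (i, ord0) (z.1 - c)
  | inr j => \prod_(x | g x == j) h (x.1, lift ord0 x.2) z.1
  end.

Let hb N (g : {ffun 'I_N1 * 'I_M -> 'I_N}) (l : ('I_N1 + 'I_N)%type) (z : obs) : R :=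
  match l with
  | inl i => hh (i, ord0) z.2
  | inr j => \prod_(x | g x == j) hh (x.1, lift ord0 x.2) z.2
  end.

Let control_prod N (g : {ffun 'I_N1 * 'I_M -> 'I_N}) (F : 'I_N1 * 'I_M -> 'I_N -> R) :
  \prod_j \prod_(x | g x == j) F x j = \prod_x F x (g x).
Proof.
rewrite [RHS](partition_big g xpredT)//=; apply: eq_bigr => j _.
by apply: eq_bigr => x /eqP ->.
Qed.

Let prod_itv (I : finType) (A : pred I) (F : I -> R) :
  (forall i, 0 <= F i <= 1) -> 0 <= \prod_(i | A i) F i <= 1.
Proof.
move=> F01; apply/andP; split; first by apply: prodr_ge0 => i _; case/andP: (F01 i).
by apply: Num.Theory.prodr_ile1 => i _; exact: F01.
Qed.

Lemma matched_product N (g : {ffun 'I_N1 * 'I_M -> 'I_N}) s : matching_is g s ->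
  \prod_a h a (SN N s a.1 a.2) = \prod_l ha g l (sample l s).
Proof.
move=> gs; rewrite big_sumType/= cell_prod; congr (_ * _).
  by apply: eq_bigr => i _; rewrite mxE.
rewrite (@control_prod N g (fun x j => h (x.1, lift ord0 x.2) (Z0 j s).1)).
by apply: eq_bigr => -[i m] _; rewrite mxE/= -gs.
Qed.

Lemma matched_cov_product N (g : {ffun 'I_N1 * 'I_M -> 'I_N}) s : matching_is g s ->
  \prod_a hh a (matched_cov N s a.1 a.2) = \prod_l hb g l (sample l s).
Proof.
move=> gs; rewrite big_sumType/= cell_prod; congr (_ * _).
rewrite (@control_prod N g (fun x j => hh (x.1, lift ord0 x.2) (Z0 j s).2)).
by apply: eq_bigr => -[i m] _; rewrite /matched_cov/= gs.
Qed.

(** For a fixed matching the cells are read off fixed independent observations. Injectivity gives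
    each control at most one factor, so that [h] can be replaced by [hh] observation by observation
    in [integral_prod_conditional]. *)
Lemma matched_moment N (g : {ffun 'I_N1 * 'I_M -> 'I_N}) : injective g ->
  (\int[Q]_s ((\prod_a h a (SN N s a.1 a.2)) * \1_(matching_is g) s)%:E =
   \int[Q]_s ((\prod_a hh a (matched_cov N s a.1 a.2)) * \1_(matching_is g) s)%:E)%E.
Proof.
move=> injg.
have mh1 a : measurable_fun setT (fun z : obs => h a z.1).
  exact: (measurableT_comp (mh a)).
have mh2 a : measurable_fun setT (fun z : obs => hh a z.2).
  exact: (measurableT_comp (mhh a)).
have mp j (F : 'I_N1 * 'I_M -> obs -> R) : (forall x, measurable_fun setT (F x)) ->
    measurable_fun setT (fun z => \prod_(x | g x == j) F x z).
  move=> mF; under eq_fun do rewrite big_mkcond.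
  by apply: measurable_prod => x _; case: (g x == j).
have ma l : measurable_fun setT (ha g l).
  case: l => [i|j] /=; last exact: (mp j (fun x z => h (x.1, lift ord0 x.2) z.1)).
  by apply: (measurableT_comp (mh (i, ord0))); apply: measurable_funB.
have mb l : measurable_fun setT (hb g l).
  case: l => [i|j] //=; [exact: mh2|exact: (mp j (fun x z => hh (x.1, lift ord0 x.2) z.2))].
have a01 l z : 0 <= ha g l z <= 1.
  by case: l => [i|j]; [exact: h01|apply: prod_itv => x; exact: h01].
have b01 l z : 0 <= hb g l z <= 1.
  by case: l => [i|j]; [exact: hh01|apply: prod_itv => x; exact: hh01].
have ab l (B : set cov) : measurable B ->
    (\int[Q]_s (ha g l (sample l s) * \1_B (pX (N := N) l (sample l s)))%:E =
     \int[Q]_s (hb g l (sample l s) * \1_B (pX (N := N) l (sample l s)))%:E)%E.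
  move=> mB; case: l => [i|j] /=; first exact: treated_moment.
  have [x0 gx0|nox] := pickP [pred x | g x == j].
    have E x : (g x == j) = (x == x0) by rewrite -(eqP gx0) (inj_eq injg).
    under eq_integral do rewrite (big_pred1 x0 E).
    under [RHS]eq_integral do rewrite (big_pred1 x0 E).
    exact: control_moment.
  under eq_integral do rewrite (big_pred0 _ _ _ _ nox).
  by under [RHS]eq_integral do rewrite (big_pred0 _ _ _ _ nox).
have := integral_prod_conditional (mpX (N := N)) (@sample_indep N) ma mb a01 b01 ab
  (matching_is_measurable g).
move=> H; transitivity (\int[Q]_s ((\prod_l ha g l (sample l s)) * \1_(matching_is g) s)%:E)%E.
  apply: eq_integral => s _; rewrite !indicE; case: (boolP (s \in _)); rewrite ?mulr0// inE => gs.
  by rewrite (matched_product gs).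
rewrite H; apply: eq_integral => s _.
rewrite !indicE; case: (boolP (s \in _)); rewrite ?mulr0// inE => gs.
by rewrite (matched_cov_product gs).
Qed.

End matched_moments.

(** * Convergence of the nearest neighbours *)

Section posdef_metric.
Context (R : realType) (k : nat) (V : 'M[R]_k).
Local Notation cov := 'rV[R]_k.
Local Notation dist := (Defs.mdist V).

Lemma mdist_continuous (x : cov) : continuous (dist x).
Proof.
move=> y; have -> : dist x = fun y => Num.sqrt
    (\sum_j (\sum_i (x ord0 i - y ord0 i) * V i j) * (x ord0 j - y ord0 j)).
  by apply/funext => z; exact: mdistE.
have cD j : {for y, continuous (fun y : cov => x ord0 j - y ord0 j)}.
  by apply: continuousB; [exact: cst_continuous|exact: coord_continuous].
have cs (F : 'I_k -> cov -> R) : (forall i, {for y, continuous (F i)}) ->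
    {for y, continuous (fun y => \sum_i F i y)}.
  move=> cF; elim: (index_enum _) => [|i s IH].
    by rewrite (_ : (fun y => _) = cst 0); [exact: cst_continuous|apply/funext => z; rewrite big_nil].
  rewrite (_ : (fun y => _) = (fun y => F i y + \sum_(i <- s) F i y)).
    exact: continuousD.
  by apply/funext => z; rewrite big_cons.
apply: continuous_comp; last exact: sqrt_continuous.
apply: (cs) => j; apply: continuousM; last exact: cD.
by apply: cs => i; apply: continuousM; [exact: cD|exact: cst_continuous].
Qed.

Lemma mdist_refl (x : cov) : dist x x = 0.
Proof. by rewrite /Defs.mdist subrr !mul0mx mxE sqrtr0. Qed.

Lemma mdist_sub (x y : cov) : dist x y = dist 0 (y - x).
Proof.
by rewrite !mdistE; congr Num.sqrt; apply: eq_bigr => j _; rewrite !mxE !sub0r opprB;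
  congr (_ * _); apply: eq_bigr => i _; rewrite !mxE sub0r opprB.
Qed.

Lemma mdist_scale (t : R) (v : cov) : 0 <= t -> dist 0 (t *: v) = t * dist 0 v.
Proof.
move=> t0; rewrite /Defs.mdist !sub0r -scalerN -!scalemxAl linearZ/= -!scalemxAr scalerA mxE.
by rewrite -expr2 sqrtrM ?sqr_ge0// sqrtr_sqr ger0_norm.
Qed.

Hypotheses (k_gt0 : (0 < k)%N) (V_posdef : posdef V).

Lemma mdist_gt0 (v : cov) : v != 0 -> 0 < dist 0 v.
Proof. by move=> v0; rewrite sqrtr_gt0 sub0r; apply: (proj2 V_posdef); rewrite oppr_eq0. Qed.

(** On the compact unit sphere of the sup norm the continuous function [dist 0] has a positive
    minimum, since [V] is positive definite; homogeneity extends the comparison to all vectors. *)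
Lemma mdist_ball (r : R) : 0 < r -> exists2 eta : R, 0 < eta &
  forall x y : cov, dist x y < eta -> `|y - x| < r.
Proof.
move=> r0; pose K := [set v : cov | `|v| = 1].
have [] := @EVT_min_rV R k (dist 0) K.
(* The sphere is nonempty because [k] is positive. *)
- pose v : cov := const_mx 1.
  have v0 : `|v| != 0.
    rewrite normr_eq0; apply/eqP => /rowP/(_ (Ordinal k_gt0)); rewrite !mxE.
    by apply/eqP; rewrite oner_eq0.
  by exists (`|v|^-1 *: v); rewrite /K/= normrZ normfV normr_id mulVf.
- apply: bounded_closed_compact.
    exists 1; split => // C C1 v /= ->; exact: ltW.
  have -> : K = (fun v : cov => `|v|) @^-1` [set 1] by [].
  by apply: closed_comp => [v _|]; [exact: norm_continuous|exact: closed_eq].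
- by apply: continuous_subspaceT; exact: mdist_continuous.
move=> v0 + v0min; rewrite inE => v01.
have c0 : 0 < dist 0 v0.
  by apply: mdist_gt0; rewrite -normr_eq0 (v01 : `|v0| = 1) oner_eq0.
exists (dist 0 v0 * r); first exact: mulr_gt0.
move=> x y; rewrite mdist_sub; set w := y - x.
have [->|w0] := eqVneq w 0; first by rewrite normr0.
have nw0 : 0 < `|w| by rewrite normr_gt0.
have Ew : w = `|w| *: (`|w|^-1 *: w) by rewrite scalerA mulfV ?scale1r// gt_eqF.
rewrite [X in dist 0 X]Ew mdist_scale ?ltW// => H.
have : dist 0 v0 <= dist 0 (`|w|^-1 *: w).
  by apply: v0min; rewrite inE /K/= normrZ normfV normr_id mulVf// gt_eqF.
rewrite -(ler_pM2l nw0) => /le_lt_trans/(_ H).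
by rewrite mulrC ltr_pM2l.
Qed.

End posdef_metric.

Section nearest_neighbours.
Context (R : realType) (k : nat) (V : 'M[R]_k).
Hypotheses (k_gt0 : (0 < k)%N) (V_posdef : posdef V).
Local Notation cov := 'rV[R]_k.
Local Notation dist := (Defs.mdist V).
Variables (x : cov) (z0 : nat -> R * cov).

Lemma size_neighbours N : size (neighbours V x z0 N) = N.
Proof. by rewrite /neighbours size_sort size_iota. Qed.

Lemma uniq_neighbours N : uniq (neighbours V x z0 N).
Proof. by rewrite /neighbours sort_uniq iota_uniq. Qed.

Lemma nth_neighbours_lt N m : (m < N)%N -> (nth 0 (neighbours V x z0 N) m < N)%N.
Proof.
move=> mN; have := mem_nth 0%N (s := neighbours V x z0 N) (n := m).
by rewrite size_neighbours mN => /(_ isT); rewrite mem_sort mem_iota.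
Qed.

(** Sorting the indices by distance sorts the distances, so this is an instance of [nth_sort_lt],
    whatever the ties. *)
Lemma neighbours_dist N m (eta : R) : (m < N)%N ->
  (dist x (z0 (nth 0%N (neighbours V x z0 N) m)).2 < eta) =
  (m < count (fun j => dist x (z0 j).2 < eta)%R (iota 0 N))%N.
Proof.
move=> mN; pose f j := dist x (z0 j).2.
have E : map f (neighbours V x z0 N) = sort <=%R (map f (iota 0 N)) by rewrite sort_map.
have -> : dist x (z0 (nth 0%N (neighbours V x z0 N) m)).2 = nth 0 (sort <=%R (map f (iota 0 N))) m.
  by rewrite -E (nth_map 0%N) ?size_neighbours.
rewrite (@nth_sort_lt _ _ eta m.+1); last by rewrite size_map size_iota.
by rewrite count_map.
Qed.

Lemma count_infinitely_often (p : pred nat) (M : nat) :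
  (forall n, exists2 j, (n <= j)%N & p j) ->
  \forall N \near \oo, (M <= count p (iota 0 N))%N.
Proof.
move=> inf; elim: M => [|M [N0 _ HN0]]; first exact: nearW.
have [j Nj pj] := inf N0; exists j.+1 => // N /= jN.
have Mj : (M <= count p (iota 0 j))%N := HN0 j Nj.
rewrite -(subnKC jN) iotaD count_cat; apply: leq_trans (leq_addr _ _).
by rewrite -[j.+1]addn1 iotaD count_cat [iota (0 + j) 1]/= [count p [:: _]]/= add0n pj addn0 addn1 ltnS.
Qed.

Lemma neighbours_cvg m : (forall U : set cov, open U -> U x ->
    forall n, exists2 j, (n <= j)%N & U (z0 j).2) ->
  (z0 (nth 0%N (neighbours V x z0 N) m)).2 @[N --> \oo] --> x.
Proof.
move=> inf; apply/cvgrPdist_lt => e e0.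
have [eta eta0 Heta] := mdist_ball k_gt0 V_posdef e0.
pose U := [set y | dist x y < eta].
have oU : open U.
  have -> : U = dist x @^-1` [set y | y < eta] by [].
  by apply: open_comp; [move=> y _; exact: mdist_continuous|exact: open_lt].
have Ux : U x by rewrite /U/= mdist_refl.
have := @count_infinitely_often (fun j => dist x (z0 j).2 < eta) m.+1 (inf U oU Ux).
apply: filterS2 (nbhs_infty_gt m) => N mN cm.
rewrite distrC; apply: Heta; by rewrite neighbours_dist.
Qed.

End nearest_neighbours.

Section infinite_visits.
Context (R : realType) (k : nat) d (S : measurableType d) (Q : probability S R).
Local Notation cov := 'rV[R]_k.
Context (U : nat -> S -> cov) (mU : forall j, measurable_fun setT (U j)).
Variable mu : {measure set cov -> \bar R}.
Hypothesis U_law : forall j A, measurable A -> Q (U j @^-1` A) = mu A.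
Hypothesis U_indep : mutually_independent Q U.

Let mUA j A : measurable A -> measurable (U j @^-1` A).
Proof. by move=> mA; rewrite -[X in measurable X]setTI; exact: mU. Qed.

(** By independence [m] consecutive observations all avoid [B] with probability [r ^ m], where
    [r < 1]; let [m] grow. *)
Lemma visits_infinitely_often (B : set cov) (n : nat) : measurable B -> (0 < mu B)%E ->
  {ae Q, forall s, exists2 j, (n <= j)%N & B (U j s)}.
Proof.
move=> mB B0; pose E j := U j @^-1` (~` B).
have mE j : measurable (E j) by apply: mUA; exact: measurableC.
pose r := fine (Q (E 0%N)).
have fE : Q (E 0%N) \is a fin_num by rewrite fin_num_measure.
have QE j : Q (E j) = r%:E.
  by rewrite /r fineK// /E !U_law//; exact: measurableC.
have r0 : 0 <= r by rewrite fine_ge0.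
have r1 : r < 1.
  rewrite -lte_fin -(QE 0%N) /E preimage_setC probability_setC//; last exact: mUA.
  have Q0 : (0 < Q (U 0%N @^-1` B))%E by rewrite U_law.
  have fQ : Q (U 0%N @^-1` B) \is a fin_num by rewrite fin_num_measure//; exact: mUA.
  by rewrite -(fineK fQ) -EFinB lte_fin gtrBl -lte_fin (fineK fQ).
pose N := \bigcap_j (E (n + j)%N).
have mN : measurable N by exact: bigcapT_measurable.
have QN m : (Q N <= (r ^+ m)%:E)%E.
  apply: (@le_trans _ _ (Q (\bigcap_(j in [set` iota n m]) U j @^-1` (~` B)))).
    apply: le_measure; rewrite ?inE//.
      by apply: fin_bigcap_measurable => // j _; exact: mE.
    move=> s Ns j /=; rewrite mem_iota => /andP[nj _].
    by have := Ns (j - n)%N Logic.I; rewrite subnKC.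
  have := U_indep (B := fun=> ~` B) (iota_uniq n m) (fun=> measurableC mB).
  move=> H; rewrite [leLHS]H.
  have -> : \big[*%E/1%E]_(i <- iota n m) Q (U i @^-1` (~` B)) = (r ^+ m)%:E.
    elim: m n {N mN H} => [|m IH] n'; first by rewrite big_nil.
    by rewrite big_cons IH [Q _]QE -EFinM exprS.
  exact: lexx.
exists N; split => //.
  apply/eqP; rewrite eq_le measure_ge0 andbT.
  have fN : Q N \is a fin_num by rewrite fin_num_measure.
  rewrite -(fineK fN) lee_fin.
  have cr : (r ^+ m) @[m --> \oo] --> (0 : R) by apply: cvg_expr; rewrite ger0_norm.
  rewrite -(cvg_lim (@Rhausdorff R) cr); apply: limr_ge; first exact: cvgP cr.
  by apply: nearW => m; rewrite -lee_fin (fineK fN).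
move=> s /= H j _; apply: contrapT => /= /contrapT Bj; apply: H.
by exists (n + j)%N => //; exact: leq_addr.
Qed.

(** The exceptional event must depend neither on the point nor on the open set, because the point
    will be a random covariate. The countable base of balls with rational centres reduces the claim
    to countably many events. *)
Lemma visits_support : {ae Q, forall s, forall (x : cov) (O : set cov),
  msupport mu x -> open O -> O x -> forall n, exists2 j, (n <= j)%N & O (U j s)}.
Proof.
pose q (p : 'rV[rat]_k * nat) : cov := \row_j ratr (p.1 ord0 j).
pose B (p : 'rV[rat]_k * nat) : set cov := ball (q p) (p.2.+1%:R^-1).
have mB p : measurable (B p) by exact: ball_measurable_row.
have basis (x : cov) (O : set cov) : open O -> O x -> exists2 p, B p x & B p `<=` O.
  move=> oO Ox.
  have /nbhs_ballP[e /= e0 eU] := open_nbhs_nbhs (conj oO Ox).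
  have [m me] : exists m, (m.+1%:R^-1 : R) < e / 2.
    have [m _ H] := near_infty_natSinv_lt (PosNum (divr_gt0 e0 (ltr0n R 2))).
    by exists m; exact: (H m (leqnn m)).
  have m0 : (0 : R) < m.+1%:R^-1 by rewrite invr_gt0.
  have /choice[r rP] (j : 'I_k) : exists r : rat, `|x ord0 j - ratr r| < m.+1%:R^-1.
    have lt : x ord0 j - m.+1%:R^-1 < x ord0 j + m.+1%:R^-1.
      by rewrite ltrBlDr -addrA ltrDl addr_gt0.
    have [r] := rat_in_itvoo lt; rewrite in_itv/= => /andP[r1 r2]; exists r.
    by rewrite distrC ltr_distl r1 r2.
  have xq : B (\row_j r j, m) x.
    split=> // i j; rewrite (ord1 i) /q/= !mxE /ball/= distrC; exact: rP.
  exists (\row_j r j, m) => // y qy; apply: eU.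
  have := ball_triangle (ball_sym xq) qy.
  by apply: le_ball; rewrite [leRHS]splitr lerD// ltW.
pose G (a : nat) (s : S) : Prop :=
  if unpickle a is Some (p, n) then (0 < mu (B p))%E -> exists2 j, (n <= j)%N & B p (U j s)
  else True.
have : {ae Q, forall s, forall a, G a s}.
  apply/ae_foralln => a; rewrite /G; case: unpickle => [[p n]|]; last exact: aeW.
  have [B0|B0] := pselect (0 < mu (B p))%E; last by apply: aeW.
  by apply: filterS (visits_infinitely_often n (mB p) B0).
apply: filterS => s Gs x O Dx oO Ox n.
have [p Bpx BpO] := basis x O oO Ox.
have [a ap] : exists a, unpickle a = Some (p, n) by exists (pickle (p, n)); exact: pickleK.
have := Gs a; rewrite /G ap => H.
have [|j nj Bj] := H; last by exists j => //; exact: BpO.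
by apply: Dx => //; exact: ball_open.
Qed.

End infinite_visits.

Section almost_surely_distinct.
Context (R : realType) d d1 (S : measurableType d) (T : measurableType d1)
  (Q : probability S R) (I : finType).
Context (Z : I -> {RV Q >-> T}) (t0 : T) (u : T -> R) (mu : measurable_fun setT u).
Hypothesis indep : mutually_independent Q (fun i => Z i : S -> T).
Hypothesis atomless : forall i t, Q (Z i @^-1` [set z | u z = t]) = 0%E.

(** Freeze all observations but [i]: then [u (Z i')] is a constant, which [u (Z i)] takes with
    probability zero. *)
Lemma ae_distinct : {ae Q, forall s i i', i != i' -> u (Z i s) <> u (Z i' s)}.
Proof.
suff H i i' : i != i' -> Q [set s | u (Z i s) = u (Z i' s)] = 0%E.
  have {}H i i' : {ae Q, forall s, i != i' -> u (Z i s) <> u (Z i' s)}.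
    have [ii'|ii'] := boolP (i != i'); last by apply: aeW => s; rewrite ?(negbTE ii').
    exists [set s | u (Z i s) = u (Z i' s)]; split; [|exact: H|].
      rewrite (_ : [set s | _] = (fun s => u (Z i s) - u (Z i' s)) @^-1` [set 0]).
        rewrite -[X in measurable X]setTI; apply: measurable_funB => //; exact: measurableT_comp.
      by apply/seteqP; split=> s /= => [->|/eqP]; [rewrite subrr|rewrite subr_eq0 => /eqP].
    by move=> s /= H'; apply: contrapT => H''; apply: H' => _.
  have : {ae Q, forall s, forall n : nat, match unpickle n with
      Some (i, i') => i != i' -> u (Z i s) <> u (Z i' s) | None => True end}.
    by apply/ae_foralln => n; case: unpickle => [[i i']|]; [exact: H|exact: aeW].
  apply: filterS => s Hs i i'.
  have [n np] : exists n, unpickle n = Some (i, i') by exists (pickle (i, i')); exact: pickleK.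
  by have := Hs n; rewrite np.
move=> ii'; apply/eqP; rewrite eq_le measure_ge0 andbT.
pose E : set (others Z i t0 * T) := [set p | u p.2 = u (Z i' p.1)].
have mE : measurable E.
  rewrite (_ : E = (fun p => u p.2 - u (Z i' p.1)) @^-1` [set 0]).
    rewrite -[X in measurable X]setTI; apply: measurable_funB => //.
      exact: (measurableT_comp mu measurable_snd).
    have mo : measurable_fun [set: others Z i t0] (Z i' : others Z i t0 -> T).
      by apply: measurable_others; rewrite eq_sym.
    exact: (measurableT_comp mu (measurableT_comp mo measurable_fst)).
  by apply/seteqP; split=> s /= => [->|/eqP]; [rewrite subrr|rewrite subr_eq0 => /eqP].
apply: (@independent_section_le R _ _ S T Q I Z i t0 indep E 0%E mE) => s.
rewrite (_ : xsection E s = [set z | u z = u (Z i' s)]) ?atomless//.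
by apply/seteqP; split=> z; rewrite /xsection/= inE.
Qed.

End almost_surely_distinct.

Lemma lebesgue_row_hyperplane (R : realType) (k : nat) (t : R) :
  lebesgue_row R k.+1 [set v | v ord0 ord0 = t] = 0%E.
Proof.
rewrite /= /lebesgue_row_step /pushforward.
rewrite (_ : _ @^-1` _ = [set t] `*` setT).
  rewrite product_measure1E//.
  by rewrite [X in (X * _)%E](_ : _ = 0%E) ?mul0e//; exact: lebesgue_measure_set1.
by apply/seteqP; split=> -[y v] /=; rewrite mxE unlift_none; [move=> yt; split|case].
Qed.

Lemma measurable_hyperplane (R : realType) (k : nat) (j : 'I_k) (t : R) :
  measurable [set v : 'rV[R]_k | v ord0 j = t].
Proof.
by rewrite -[X in measurable X]setTI; apply: (@measurable_coord _ R k j measurableT [set t]).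
Qed.

(** * Limits of the moments *)

Lemma within_continuous_cvg (T U : topologicalType) (D : set T) (f : T -> U) (y : nat -> T) (x : T) :
  {within D, continuous f} -> D x -> (forall n, D (y n)) -> y @ \oo --> x ->
  f (y n) @[n --> \oo] --> f x.
Proof.
move=> /subspace_continuousP cf Dx Dy yx.
have yw : y @ \oo --> within D (nbhs x).
  by move=> B /yx; rewrite /= !nbhs_simpl/=; apply: filterS => n; exact.
exact: cvg_comp yw (cf x Dx).
Qed.

Section matched_moment_limit.
Context (R : realType) (k : nat) (V : 'M[R]_k) (c : R) (N1 M : nat).
Hypotheses (k_gt0 : (0 < k)%N) (V_posdef : posdef V).
Local Notation cov := 'rV[R]_k.
Local Notation obs := (R * cov)%type.
Local Notation cell := ('I_N1 * 'I_M.+1)%type.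
Context d (S : measurableType d) (Q : probability S R).
Context (Z1 : 'I_N1 -> {RV Q >-> obs}) (Z0 : nat -> {RV Q >-> obs}).
Hypothesis indep : mutually_independent Q (fun i : ('I_N1 + nat)%type =>
  match i with inl i1 => Z1 i1 : S -> _ | inr i0 => Z0 i0 : S -> _ end).

Local Notation J N s i m := (match_index V Z1 Z0 N s i m).
Local Notation SN N s := (matched_sample V M c (fun i => Z1 i s) (fun j => Z0 j s) N).

Variable D : set cov.

Definition good_sample (s : S) : Prop :=
  [/\ forall i, D (Z1 i s).2, forall j, D (Z0 j s).2,
      forall i i', i != i' -> (Z1 i s).2 <> (Z1 i' s).2 &
      forall i (U : set cov), open U -> U (Z1 i s).2 ->
        forall n, exists2 j, (n <= j)%N & U (Z0 j s).2].

Hypothesis ae_good : {ae Q, forall s, good_sample s}.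

Definition injective_matching N : set S :=
  [set s | exists2 g : {ffun 'I_N1 * 'I_M -> 'I_N}, injective g & matching_is V Z1 Z0 g s].

Lemma matched_cov_cvg s i (m : 'I_M.+1) : good_sample s ->
  matched_cov V Z1 Z0 N s i m @[N --> \oo] --> (Z1 i s).2.
Proof.
move=> [_ _ _ inf]; case: m => -[|m] mM; first exact: cvg_cst.
exact: (neighbours_cvg k_gt0 V_posdef m (inf i)).
Qed.

(** Neighbours of one unit are distinct because the sorted list has no repetition; neighbours of
    different units are eventually distinct because their covariates tend to different limits. *)
Lemma injective_matching_near s : good_sample s ->
  \forall N \near \oo, injective_matching N s.
Proof.
move=> gs; have [_ _ dist inf] := gs.
have diff : \forall N \near \oo, forall x x' : 'I_N1 * 'I_M, x.1 != x'.1 ->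
    J N s x.1 x.2 <> J N s x'.1 x'.2.
  have H (x x' : 'I_N1 * 'I_M) : \forall N \near \oo, x.1 != x'.1 -> J N s x.1 x.2 <> J N s x'.1 x'.2.
    have [xx'|xx'] := boolP (x.1 != x'.1); last by apply: nearW => N; rewrite ?(negbTE xx').
    have c1 := @matched_cov_cvg s x.1 (lift ord0 x.2) gs.
    have c2 := @matched_cov_cvg s x'.1 (lift ord0 x'.2) gs.
    have d0 : (Z1 x.1 s).2 - (Z1 x'.1 s).2 != 0.
      by rewrite subr_eq0; apply/eqP; exact: dist.
    have := cvgr_neq0 _ (cvgB c1 c2) d0.
    move=> [n0 _ Hn]; exists n0 => // N /= n0N _ e; have E (y : 'I_N1 * 'I_M) :
        matched_cov V Z1 Z0 N s y.1 (lift ord0 y.2) = (Z0 (J N s y.1 y.2) s).2 by [].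
    have : matched_cov V Z1 Z0 N s x.1 (lift ord0 x.2) -
      matched_cov V Z1 Z0 N s x'.1 (lift ord0 x'.2) != 0 := Hn N n0N.
    by rewrite !E e subrr eqxx.
  by apply: filter_forall => x; apply: filter_forall => x'; exact: H.
(* From here on the default index of [nth] is not reached. *)
near=> N; have MN : (M <= N)%N by near: N; exact: nbhs_infty_ge.
have JN i (m : 'I_M) : (J N s i m < N)%N by apply: nth_neighbours_lt; exact: leq_trans (ltn_ord m) MN.
exists [ffun x => Ordinal (JN x.1 x.2)]; last by move=> i m; rewrite ffunE.
move=> x x'; rewrite !ffunE => /(congr1 val)/= e.
have [xx'|xx'] := eqVneq x.1 x'.1; last first.
  by exfalso; move: e; apply: (_ : forall x x' : 'I_N1 * 'I_M, x.1 != x'.1 -> J N s x.1 x.2 <> J N s x'.1 x'.2) xx'; near: N.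
case: x x' xx' e => i m [i' m'] /= <- e; congr pair; apply: val_inj => /=.
move/eqP: e; rewrite /match_index nth_uniq ?size_neighbours ?uniq_neighbours//.
- by move/eqP.
- exact: leq_trans (ltn_ord m) MN.
- exact: leq_trans (ltn_ord m') MN.
Unshelve. all: by end_near. Qed.

Variables (h : cell -> R -> R) (hh : cell -> cov -> R).
Hypotheses (mh : forall a, measurable_fun setT (h a)) (h01 : forall a y, 0 <= h a y <= 1).
Hypotheses (mhh : forall a, measurable_fun setT (hh a)) (hh01 : forall a x, 0 <= hh a x <= 1).
Hypothesis chh : forall a, {within D, continuous (hh a)}.
Hypothesis treated_moment : forall a i (B : set cov), measurable B ->
  (\int[Q]_s (h a ((Z1 i s).1 - c) * \1_B (Z1 i s).2)%:E =
   \int[Q]_s (hh a (Z1 i s).2 * \1_B (Z1 i s).2)%:E)%E.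
Hypothesis control_moment : forall a j (B : set cov), measurable B ->
  (\int[Q]_s (h a (Z0 j s).1 * \1_B (Z0 j s).2)%:E =
   \int[Q]_s (hh a (Z0 j s).2 * \1_B (Z0 j s).2)%:E)%E.

Let matching_is_measurableT N (g : {ffun 'I_N1 * 'I_M -> 'I_N}) : measurable (matching_is V Z1 Z0 g).
Proof.
exact: measurable_matching_is.
Qed.

Let mobs2 (Z : {RV Q >-> obs}) : measurable_fun setT (fun s => (Z s).2).
Proof. exact: (measurableT_comp measurable_snd). Qed.

Lemma measurable_matched_cov N i (m : 'I_M.+1) : measurable_fun setT (fun s => matched_cov V Z1 Z0 N s i m).
Proof.
case: m => -[|m] mM; first exact: mobs2.
apply: (@measurable_select _ S _ cov (fun s => J N s i m) (fun l s => (Z0 l s).2)).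
  move=> l; apply: (@measurable_neighbours R k V _ S (fun s => (Z1 i s).2) (fun j s => Z0 j s) N
    (fun t => nth 0%N t m = l)) => [|j _]; exact: mobs2.
by move=> l; exact: mobs2.
Qed.

Let mSN N i m : measurable_fun setT (fun s => SN N s i m).
Proof. by apply: (@measurable_matched_sample R k V _ S M N1 N c (fun i s => Z1 i s) (fun j s => Z0 j s) i m). Qed.

Let Hs N (s : S) : R := \prod_a h a (SN N s a.1 a.2).
Let HHs N (s : S) : R := \prod_a hh a (matched_cov V Z1 Z0 N s a.1 a.2).
Let Hlim (s : S) : R := \prod_a hh a (Z1 a.1 s).2.

Let prod01 (F : cell -> R) : (forall a, 0 <= F a <= 1) -> 0 <= \prod_a F a <= 1.
Proof.
move=> F01; apply/andP; split; first by apply: prodr_ge0 => a _; case/andP: (F01 a).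
by apply: Num.Theory.prodr_ile1 => a _; exact: F01.
Qed.

Let bHs N : bmeas (Hs N).
Proof.
apply: bmeas_unit => [|s]; last by apply: prod01 => a; exact: h01.
by apply: measurable_prod => a _; apply: (measurableT_comp (mh a)).
Qed.

Let bHHs N : bmeas (HHs N).
Proof.
apply: bmeas_unit => [|s]; last by apply: prod01 => a; exact: hh01.
by apply: measurable_prod => a _; apply: (measurableT_comp (mhh a)); exact: measurable_matched_cov.
Qed.

Let mHlim : measurable_fun setT Hlim.
Proof. by apply: measurable_prod => a _; apply: (measurableT_comp (mhh a)); exact: mobs2. Qed.

(** A sample has at most one matching [g], so the events in the sum are disjoint. *)
Let inj1 N s : \1_(injective_matching N) s =
  \sum_(g : {ffun 'I_N1 * 'I_M -> 'I_N} | injectiveb g) \1_(matching_is V Z1 Z0 g) s :> R.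
Proof.
rewrite indicE; case: (boolP (_ \in _)) => [|ns].
  rewrite inE => -[g injg gs]; have gi : injectiveb g by apply/injectiveP.
  rewrite (bigD1 g)//= indicE mem_set// big1 ?addr0// => g' /andP[_ gg'].
  rewrite indicE memNset//= => g's; move/eqP: gg'; apply; apply/ffunP => -[i m].
  by apply: val_inj; rewrite /= -gs -g's.
rewrite big1// => g /injectiveP gi; rewrite indicE memNset// => gs; move/negP: ns; apply.
by rewrite inE; exists g.
Qed.

Let binj N : bmeas (\1_(injective_matching N) : S -> R).
Proof.
rewrite (_ : \1_ _ = fun s => \sum_(g : {ffun 'I_N1 * 'I_M -> 'I_N})
    if injectiveb g then \1_(matching_is V Z1 Z0 g) s else 0).
  apply: bmeas_sum => g; case: (injectiveb g); last exact: bmeas_cst.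
  apply: bmeas_unit => [|s]; first exact: measurable_indic.
  by rewrite indicE; case: (_ \in _); rewrite ?lexx ?ler01.
by apply/funext => s; rewrite inj1 big_mkcond.
Qed.

Let inj_moment N : \int[Q]_s (Hs N s * \1_(injective_matching N) s) =
  \int[Q]_s (HHs N s * \1_(injective_matching N) s).
Proof.
have E (F : S -> R) : bmeas F -> \int[Q]_s (F s * \1_(injective_matching N) s) =
    \sum_(g : {ffun 'I_N1 * 'I_M -> 'I_N}) if injectiveb g then
      \int[Q]_s (F s * \1_(matching_is V Z1 Z0 g) s) else 0.
  move=> bF; transitivity (\int[Q]_s (\sum_(g : {ffun 'I_N1 * 'I_M -> 'I_N})
      if injectiveb g then F s * \1_(matching_is V Z1 Z0 g) s else 0)).
    by apply: eq_Rintegral => s _; rewrite inj1 mulr_sumr big_mkcond.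
  rewrite RE_sum => [|g].
    apply: eq_bigr => g _; case: (injectiveb g) => //; exact: RE_cst.
  case: (injectiveb g); last exact: bmeas_cst.
  apply: bmeasM => //; apply: bmeas_unit => [|s]; first exact: measurable_indic.
  by rewrite indicE; case: (_ \in _); rewrite ?lexx ?ler01.
rewrite !E//; apply: eq_bigr => g _; case: ifP => // /injectiveP gi.
congr fine; exact: (matched_moment V indep mh h01 mhh hh01 treated_moment control_moment gi).
Qed.

(** The matched outcomes need not converge pathwise. On injective matchings their moments equal
    those of the regressions, which converge by continuity and domination; what remains is at most
    the probability that the matching is not injective. *)
Lemma matched_moment_cvg : \int[Q]_s Hs N s @[N --> \oo] --> \int[Q]_s Hlim s.
Proof.
have i01 N s : 0 <= (\1_(injective_matching N) s : R) <= 1.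
  by rewrite indicE; case: (_ \in _); rewrite ?lexx ?ler01.
have c1 : \int[Q]_s \1_(injective_matching N) s @[N --> \oo] --> (1 : R).
  rewrite -[X in _ --> X](RE_cst Q 1); apply: RE_dominated_cvg => //.
  - by move=> N; case: (binj N).
  - by move=> s; rewrite ler01 lexx.
  apply: filterS ae_good => s gs; apply: cvg_near_cst.
  by apply: filterS (injective_matching_near gs) => N Ns; rewrite indicE mem_set.
have c2 : \int[Q]_s (HHs N s * \1_(injective_matching N) s) @[N --> \oo] --> \int[Q]_s Hlim s.
  apply: RE_dominated_cvg => //.
  - by move=> N; case: (bmeasM (bHHs N) (binj N)).
  - move=> N s; have /andP[a0 a1] := i01 N s.
    have /andP[b0 b1] : 0 <= HHs N s <= 1 by apply: prod01 => a; exact: hh01.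
    by rewrite mulr_ge0//= mulr_ile1.
  - by move=> s; apply: prod01 => a; exact: hh01.
  apply: filterS ae_good => s gs; rewrite -[X in _ --> X]mulr1.
  apply: cvgM; last first.
    apply: cvg_near_cst.
    by apply: filterS (injective_matching_near gs) => N Ns; rewrite indicE mem_set.
  have [D1 D0 _ _] := gs.
  rewrite /HHs /Hlim; elim: (index_enum _) => [|a r IH].
    by rewrite big_nil; under eq_fun do rewrite big_nil; exact: cvg_cst.
  rewrite big_cons; under eq_fun do rewrite big_cons.
  apply: cvgM => //.
  apply: (@within_continuous_cvg _ _ D (hh a) (fun N => matched_cov V Z1 Z0 N s a.1 a.2)
    _ (@chh a)) => //; last exact: matched_cov_cvg.
  by move=> N; rewrite /matched_cov; case: (val a.2) => [|m].
have E N : \int[Q]_s Hs N s = \int[Q]_s (HHs N s * \1_(injective_matching N) s) +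
    \int[Q]_s (Hs N s * (1 - \1_(injective_matching N) s)).
  rewrite -inj_moment -RE_D.
  - by apply: eq_Rintegral => s _; ring.
  - exact: bmeasM.
  - by apply: bmeasM => //; apply: bmeasB => //; exact: bmeas_cst.
have -> : (fun N => \int[Q]_s Hs N s) =
    (fun N => \int[Q]_s (HHs N s * \1_(injective_matching N) s) +
      \int[Q]_s (Hs N s * (1 - \1_(injective_matching N) s))) by apply/funext.
rewrite -[X in _ --> X]addr0; apply: cvgD => //.
have b1 N : bmeas (fun s => 1 - \1_(injective_matching N) s : R).
  by apply: bmeasB => //; exact: bmeas_cst.
apply: (@squeeze_cvgr _ _ _ _ (cst 0) (fun N => 1 - \int[Q]_s \1_(injective_matching N) s)).
- apply: nearW => N /=; apply/andP; split.
    apply: Rintegral_ge0 => s _; apply: mulr_ge0.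
      by case/andP: (prod01 (fun a => h01 a (SN N s a.1 a.2))).
    by rewrite subr_ge0; case/andP: (i01 N s).
  rewrite -[X in X - _](RE_cst Q 1) -RE_B//; last exact: bmeas_cst.
  apply: RE_le => //; first exact: bmeasM.
  move=> s; apply: ler_piMl; first by rewrite subr_ge0; case/andP: (i01 N s).
  by case/andP: (prod01 (fun a => h01 a (SN N s a.1 a.2))).
- exact: cvg_cst.
- by rewrite -(subrr 1); apply: cvgB; [exact: cvg_cst|exact: c1].
Qed.

End matched_moment_limit.

(** * Small linear forms *)

Lemma neighbours_eq (R : realType) (k : nat) (V : 'M[R]_k) (x : 'rV[R]_k)
    (z z' : nat -> R * 'rV[R]_k) N : (forall j, (j < N)%N -> z j = z' j) ->
  neighbours V x z N = neighbours V x z' N.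
Proof.
move=> zz'; rewrite /neighbours -val_enum_ord [LHS]sort_map [RHS]sort_map; congr map.
apply: (congr1 (fun r : rel 'I_N => sort r (enum 'I_N))).
by apply/funext => i; apply/funext => j /=; rewrite !zz'.
Qed.

(** The bound is [j <= N] rather than [j < N] because the default index [0] of [nth] is read even
    when [N = 0]. *)
Lemma matched_sample_eq (R : realType) (k : nat) (V : 'M[R]_k) (M N1 : nat) (c : R)
    (z1 z1' : 'I_N1 -> R * 'rV[R]_k) (z z' : nat -> R * 'rV[R]_k) N :
  (forall j, (j <= N)%N -> z j = z' j) -> z1 =1 z1' ->
  matched_sample V M c z1 z N = matched_sample V M c z1' z' N.
Proof.
move=> zz' /funext <-; apply/matrixP => i [[|m] mM]; rewrite !mxE//=.
rewrite (@neighbours_eq _ _ V _ z z')//; last by move=> j /ltnW; exact: zz'.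
congr fst; apply: zz'; have [mN|Nm] := ltnP m N.
  by apply: ltnW; exact: nth_neighbours_lt.
by rewrite nth_default// size_neighbours.
Qed.

Lemma zap_eq (R : realType) (N1 M : nat) (i : 'I_N1) (s s' : 'M[R]_(N1, M.+1)) :
  (forall j m, (j, m) != (i, ord0) -> s j m = s' j m) -> zap i s = zap i s'.
Proof.
move=> ss'; apply/matrixP => j m; rewrite !mxE.
have [/eqP|jm] := eqVneq (j, m) (i, ord0).
  by rewrite xpair_eqE => /andP[/eqP -> /eqP ->]; rewrite !eqxx !mulr1 !subrr.
rewrite (_ : (j == i) && (m == ord0) = false) ?mulr0 ?subr0 ?ss'//.
by apply/negbTE; move: jm; rewrite xpair_eqE.
Qed.

Lemma measurable_norm_lt (R : realType) d (T : measurableType d) (f : T -> R) (e : R) :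
  measurable_fun setT f -> measurable [set w | `|f w| < e].
Proof.
move=> mf; rewrite (_ : [set w | _] = (fun w => `|f w|) @^-1` [set` `]-oo, e[]).
  rewrite -[X in measurable X]setTI.
  by apply: (measurableT_comp (@normr_measurable R setT)).
by apply/seteqP; split=> w /=; rewrite in_itv.
Qed.

Section small_form_probability.
Context (R : realType) (k : nat) (V : 'M[R]_k) (c : R) (N1 M : nat).
Local Notation cov := 'rV[R]_k.
Local Notation obs := (R * cov)%type.
Context d (S : measurableType d) (Q : probability S R).
Context (Z1 : 'I_N1 -> {RV Q >-> obs}) (Z0 : nat -> {RV Q >-> obs}).
Hypothesis indep : mutually_independent Q (fun i : ('I_N1 + nat)%type =>
  match i with inl i1 => Z1 i1 : S -> _ | inr i0 => Z0 i0 : S -> _ end).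
Context d' (Omega : measurableType d') (P : probability Omega R)
  (Y : Omega -> R) (mY : measurable_fun setT Y) (X : {mfun Omega >-> cov})
  (kappa : R.-pker cov ~> R).
Hypothesis YX : is_cond_distribution P X Y kappa.
Variable C : R.
Hypothesis Z1_le : forall i A, measurable A ->
  (Q (Z1 i @^-1` A) <= C%:E * P ((fun o => (Y o, X o)) @^-1` A))%E.
Hypothesis C0 : 0 <= C.

Local Notation SN N s := (matched_sample V M c (fun i => Z1 i s) (fun j => Z0 j s) N).

(** All observations but the treated unit [i] are frozen. Its covariate stays random and determines
    its matches, while its outcome enters the form linearly and nowhere else; so the event places
    the outcome within [e'] of a function [r] of the covariate. After the comparison [Z1_le] with
    the law of [(Y, X)], [concentration_bound] applies. *)
Lemma small_form_probability N (e e' : R) b (pi : group_perm N1 M) i :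
  0 < e' -> (contrast_pm b pi (delta_mx i ord0) != 0 :> R ->
    e <= e' * `|contrast_pm b pi (delta_mx i ord0)|) ->
  (Q [set s | small_form e b pi i (SN N s)] <=
   C%:E * \int[distribution P X]_x concentration kappa e' x)%E.
Proof.
move=> e'0 ee'; set a := contrast_pm b pi (delta_mx i ord0) : R.
have [a0|a0] := eqVneq a 0.
  rewrite (_ : [set s | _] = set0) ?measure0.
    by apply: mule_ge0; rewrite ?lee_fin//; apply: integral_ge0 => x _; case/andP: (concentration01 kappa e' x).
  by apply/seteqP; split=> s //=; rewrite /small_form -/a a0 eqxx.
have aN0 : 0 < `|a| by rewrite normr_gt0.
pose I := ('I_N1 + 'I_N.+1)%type.
pose Zf (l : I) : {RV Q >-> obs} := match l with inl i => Z1 i | inr j => Z0 (val j) end.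
have Zf_indep : mutually_independent Q (fun l => Zf l : S -> obs).
  pose f (l : I) : ('I_N1 + nat)%type := match l with inl i => inl i | inr j => inr (val j) end.
  have injf : injective f by move=> [i1|j] [i'|j']//= [] => [->//|/val_inj ->//].
  have := mutually_independent_comp injf indep.
  by congr (mutually_independent Q _); apply/funext => -[].
pose t0 : obs := (0, 0).
pose O := others Zf (inl i : I) t0.
(* The sample is rebuilt from the other observations [p.1] and a new value [p.2] for unit [i].
   Controls with index beyond [N] are never read and become a constant, so that finitely many
   observations are involved. *)
pose z1 (j : 'I_N1) (p : O * obs) : obs := if j == i then p.2 else Z1 j p.1.
pose z0 (j : nat) (p : O * obs) : obs := if (j < N.+1)%N then Z0 j p.1 else t0.
have mz1 j : measurable_fun setT (z1 j).
  rewrite /z1; case: eqP => [_|/eqP ji]; first exact: measurable_snd.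
  have mo : measurable_fun [set: O] (Zf (inl j) : O -> obs) by exact: measurable_others.
  exact: (measurableT_comp mo measurable_fst).
have mz0 j : measurable_fun setT (z0 j).
  rewrite /z0; have [jN|_] := ltnP j N.+1; last exact: measurable_cst.
  have mo : measurable_fun [set: O] (Zf (inr (Ordinal jN)) : O -> obs).
    exact: measurable_others.
  exact: (measurableT_comp mo measurable_fst).
pose mat (p : O * obs) := matched_sample V M c (z1^~ p) (z0^~ p) N.
have mmat j m : measurable_fun setT (fun p => mat p j m).
  exact: measurable_matched_sample.
pose phi (p : O * obs) : R := (p.2.1 - c) * a + contrast_pm b pi (zap i (mat p)).
have mphi : measurable_fun setT phi.
  apply: measurable_funD.
    apply: measurable_funM; last exact: measurable_cst.
    apply: measurable_funB => //.
    exact: (measurableT_comp measurable_fst measurable_snd).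
  by apply: measurable_contrast_pm => j m; exact: measurable_zap.
pose E : set (O * obs) := [set p | `|phi p| < e].
have mE : measurable E by exact: measurable_norm_lt.
have matE (s : S) : mat ((s : O), Z1 i s) = SN N s.
  apply: matched_sample_eq => j; first by rewrite /z0 -ltnS => ->.
  by rewrite /z1; case: eqP => [->|].
have SN0 s : SN N s i ord0 = (Z1 i s).1 - c by rewrite mxE.
have sub : [set s | small_form e b pi i (SN N s)] `<=` [set s : S | E ((s : O), Z1 i s)].
  move=> s /= /andP[_]; rewrite /E/= /phi matE -/a.
  by rewrite SN0.
have mE' : measurable [set s : S | E ((s : O), Z1 i s)].
  rewrite -[X in measurable X]setTI.
  have mid : measurable_fun [set: S] (fun s : S => (s : O)).
    move=> _ A mA; rewrite setTI.
    exact: (cov_space_measurable (measurable_forget (inl i : I) t0) mA).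
  have mp : measurable_fun [set: S] (fun s : S => ((s : O), Z1 i s)).
    exact: measurable_fun_pair.
  exact: (mp measurableT E mE).
have mS : measurable [set s | small_form e b pi i (SN N s)].
  rewrite (_ : [set s | _] = [set s : S | E ((s : O), Z1 i s)])//.
  apply/seteqP; split => // s /=; rewrite /E/= /phi matE /small_form -/a a0/=.
  by rewrite SN0.
apply: (@le_trans _ _ (Q [set s : S | E ((s : O), Z1 i s)])).
  by apply: le_measure; rewrite ?inE.
apply: (@independent_section_le R _ _ S obs Q I Zf (inl i) t0 Zf_indep E _ mE) => s.
have mxs : measurable (xsection E s) by exact: measurable_xsection.
apply: (le_trans (Z1_le i mxs)); apply: lee_wpmul2l; first by rewrite lee_fin.
pose r (x : cov) : R := c - contrast_pm b pi (zap i (mat (s, (0, x)))) / a.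
have mr : measurable_fun setT r.
  apply: measurable_funB => //; apply: measurable_funM; last exact: measurable_cst.
  apply: measurable_contrast_pm => j m; apply: measurable_zap => j' m'.
  have mpr : measurable_fun setT (fun x : cov => (s, (0, x)) : O * obs).
    by apply: measurable_fun_pair => //; apply: measurable_fun_pair.
  exact: (measurableT_comp (mmat j' m') mpr).
apply: le_trans (concentration_bound mY YX e'0 mr).
apply: le_measure; rewrite ?inE.
- rewrite -[X in measurable X]setTI.
  have mp : measurable_fun setT (fun o => (Y o, X o)) by exact: measurable_fun_pair.
  exact: (mp measurableT _ mxs).
- apply: measurable_norm_lt; apply: measurable_funB; first exact: mY.
  exact: (measurableT_comp mr (measurable_funPT X)).
move=> o; rewrite /xsection/= inE /E/= /phi/= => H.
(* The outcome of unit [i] affects neither the matches nor any entry but its own, which [zap]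
   erases. *)
have zE : zap i (mat (s, (Y o, X o))) = zap i (mat (s, (0, X o))).
  apply: zap_eq => j m jm; rewrite !mxE.
  case: m jm => -[|m] mM jm /=.
    have ji : j != i by apply: contraNneq jm => ->; rewrite xpair_eqE eqxx/=.
    by rewrite /z1 (negbTE ji).
  have zeq p p' : p.1 = p'.1 -> z0^~ p = z0^~ p'.
    by move=> pp; apply/funext => l; rewrite /z0 pp.
  have -> : (z1 j (s, (Y o, X o))).2 = (z1 j (s, (0, X o))).2.
    by rewrite /z1; case: eqP.
  by [].
rewrite -(ltr_pM2r aN0) -normrM; apply: lt_le_trans (ee' a0).
rewrite (_ : (Y o - r (X o)) * a = (Y o - c) * a + contrast_pm b pi (zap i (mat (s, (0, X o))))).
  by rewrite -zE.
by rewrite /r; field.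
Qed.

End small_form_probability.

(** * The asymptotic level *)

Lemma limn_esup_le (R : realType) (u : nat -> \bar R) (l : R) :
  (forall e, 0 < e -> \forall n \near \oo, (u n <= (l + e)%:E)%E) ->
  (limn_esup u <= l%:E)%E.
Proof.
move=> H; apply/lee_addgt0Pr => e e0; rewrite -EFinD.
apply: (@le_trans _ _ (ereal_sup (u @` [set n | (u n <= (l + e)%:E)%E]))).
  by apply: ereal_inf_lbound; exists [set n | (u n <= (l + e)%:E)%E] => //; exact: H.
by apply: ge_ereal_sup => _ [n un <-].
Qed.

Lemma lebesgue_row_coord0 (R : realType) (k : nat) : (0 < k)%N ->
  exists j : 'I_k, forall t, lebesgue_row R k [set v | v ord0 j = t] = 0%E.
Proof.
by case: k => // k _; exists ord0 => t; exact: lebesgue_row_hyperplane.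
Qed.

Section cond_prob_facts.
Context (R : realType) d (Omega : measurableType d) (P : probability Omega R)
  (W : {mfun Omega >-> bool}) (w : bool).
Hypothesis W_gt0 : (0 < P (W @^-1` [set w]))%E.

Local Notation p := (fine (P (W @^-1` [set w]))).

Lemma cond_prob_le A : measurable A -> (cond_prob P W w A <= (p^-1)%:E * P A)%E.
Proof.
move=> mA; have mW : measurable (W @^-1` [set w]) by exact: measurable_funPTI.
have p0 := cond_prob_mass_gt0 W_gt0.
rewrite cond_probE// (_ : P A = \int[P]_o (\1_A o)%:E)%E; last by rewrite integral_indic// setIT.
rewrite -ge0_integralZl//.
- apply: ge0_le_integral => //.
  + by move=> o _; rewrite lee_fin !mulr_ge0// invr_ge0 ltW.
  + apply/measurable_EFinP; apply: measurable_funM; last exact: measurable_indic.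
    by apply: measurable_funM; [exact: measurable_cst|exact: measurable_indic].
  + apply: measurable_funeM; exact/measurable_EFinP/measurable_indic.
  + move=> o _; rewrite -EFinM lee_fin; apply: ler_wpM2r; first by rewrite indicE.
    apply: ler_piMr; first by rewrite invr_ge0 ltW.
    by rewrite indicE; case: (_ \in _).
- exact/measurable_EFinP/measurable_indic.
- by rewrite lee_fin invr_ge0 ltW.
Qed.

Lemma eq_integral_cond_prob (u v : Omega -> R) :
  measurable_fun setT u -> measurable_fun setT v ->
  (forall o, 0 <= u o) -> (forall o, 0 <= v o) -> (forall o, W o = w -> u o = v o) ->
  (\int[cond_prob P W w]_o (u o)%:E = \int[cond_prob P W w]_o (v o)%:E)%E.
Proof.
move=> mu mv u0 v0 uv; rewrite !integral_cond_prob//; apply: eq_integral => o _.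
rewrite indicE; case: (boolP (o \in _)); rewrite ?mulr0 ?mul0r// inE/= => Wo.
by rewrite uv.
Qed.

End cond_prob_facts.

(** Take the least nonzero [|f i|], started from [1] in case there is none. It gives one scale for
    all the small forms. *)
Lemma exists_small_scale (R : realType) (I : finType) (f : I -> R) (e' : R) : 0 < e' ->
  exists2 e, 0 < e & forall i, f i != 0 -> e <= e' * `|f i|.
Proof.
move=> e'0; exists (e' * \big[Num.min/1]_(i | f i != 0) `|f i|).
  apply: mulr_gt0 => //; elim/big_ind: _ => [|x y x0 y0|i]; first exact: ltr01.
    by rewrite lt_min x0.
  by rewrite normr_gt0.
by move=> i fi; rewrite ler_pM2l//; exact: bigmin_le_cond.
Qed.

(** * From the population to the sample *)

Section sample.
Context (R : realType) d (Omega : measurableType d) (P : probability Omega R) (k : nat).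
Local Notation cov := 'rV[R]_k.
Local Notation obs := (R * cov)%type.
Context (Y0 Y1 : {RV P >-> R}) (X : {RV P >-> cov}) (W : {RV P >-> bool}).
Hypothesis W_nondegenerate : (0 < P (W @^-1` [set true]) < 1)%E.

Lemma treatment_gt0 w : (0 < P (W @^-1` [set w]))%E.
Proof.
have /andP[p0 p1] := W_nondegenerate; case: w => //.
have mW : measurable (W @^-1` [set true]) by exact: measurable_funPTI.
rewrite (_ : W @^-1` [set false] = ~` (W @^-1` [set true])).
  rewrite probability_setC//.
  have fW : P (W @^-1` [set true]) \is a fin_num by rewrite fin_num_measure.
  by move: p1; rewrite -(fineK fW) -EFinB !lte_fin subr_gt0.
by apply/seteqP; split=> o /=; case: (W o).
Qed.

Lemma measurable_observed : measurable_fun setT (observed W Y0 Y1).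
Proof.
have mW : measurable_fun setT (fun o => (W o)%:R : R).
  rewrite (_ : (fun o => _) = \1_(W @^-1` [set true])).
    by apply: measurable_indic; exact: measurable_funPTI.
  apply/funext => o; rewrite indicE (_ : (o \in _) = W o)//.
  by apply/idP/idP; rewrite inE.
apply: measurable_funD; apply: measurable_funM => //.
by apply: measurable_funB => //; exact: measurable_cst.
Qed.

Lemma observed_true o : W o = true -> observed W Y0 Y1 o = Y1 o.
Proof. by rewrite /observed => ->; rewrite mul1r subrr mul0r addr0. Qed.

Lemma observed_false o : W o = false -> observed W Y0 Y1 o = Y0 o.
Proof. by rewrite /observed => ->; rewrite mul0r subr0 mul1r add0r. Qed.

Let obsX (o : Omega) : obs := (observed W Y0 Y1 o, X o).

Let m_obsX : measurable_fun setT obsX.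
Proof. by apply: measurable_fun_pair; [exact: measurable_observed|exact: measurable_funPT]. Qed.

Context d' (S : measurableType d') (Q : probability S R).

Lemma integral_sample (w : bool) (Z : {RV Q >-> obs}) (u : obs -> R) :
  (forall A, measurable A -> distribution Q Z A = cond_prob P W w (obsX @^-1` A)) ->
  measurable_fun setT u -> (forall z, 0 <= u z) ->
  (\int[Q]_s (u (Z s))%:E = \int[cond_prob P W w]_o (u (obsX o))%:E)%E.
Proof.
move=> law mu u0.
transitivity (\int[Q]_s (cst 1 s * u (Z s))%:E)%E.
  by apply: eq_integral => s _; rewrite mul1r.
transitivity (\int[cond_prob P W w]_o (cst 1 o * u (obsX o))%:E)%E; last first.
  by apply: eq_integral => o _; rewrite mul1r.
apply: weighted_law_ext => // A mA.
have mZA : measurable (Z @^-1` A) by exact: measurable_funPTI.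
have mXA : measurable (obsX @^-1` A).
  by rewrite -[X in measurable X]setTI; exact: m_obsX.
transitivity (distribution Q Z A).
  transitivity (\int[Q]_s (\1_(Z @^-1` A) s)%:E)%E.
    by apply: eq_integral => s _; rewrite mul1r.
  by rewrite integral_indic// setIT.
rewrite law//; apply/esym.
transitivity (\int[cond_prob P W w]_o (\1_(obsX @^-1` A) o)%:E)%E.
  by apply: eq_integral => o _; rewrite mul1r.
by rewrite integral_indic// setIT.
Qed.

End sample.

Lemma measurable_small_form (R : realType) (N1 M : nat) d (T : measurableType d)
    (X : T -> 'M[R]_(N1, M.+1)) (e : R) b pi i :
  (forall i m, measurable_fun setT (fun s => X s i m)) ->
  measurable [set s | small_form e b pi i (X s)].
Proof.
move=> mX; have [a0|a0] := eqVneq (contrast_pm b pi (delta_mx i ord0)) (0 : R).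
  rewrite (_ : [set s | _] = set0)//.
  by apply/seteqP; split=> s //=; rewrite /small_form a0 eqxx.
pose a : R := contrast_pm b pi (delta_mx i ord0).
rewrite (_ : [set s | _] = [set s | `|X s i ord0 * a + contrast_pm b pi (zap i (X s))| < e]).
  apply: measurable_norm_lt; apply: measurable_funD.
    by apply: measurable_funM; [exact: mX|exact: measurable_cst].
  by apply: measurable_contrast_pm => j m; exact: measurable_zap.
by apply/seteqP; split=> s /=; rewrite /small_form a0.
Qed.

Section asymptotic_level.
Context (R : realType) d (S : measurableType d) (Q : probability S R) (N1 M : nat).
Hypotheses (N1_gt0 : (0 < N1)%N) (M_gt0 : (0 < M)%N).
Local Notation mx := 'M[R]_(N1, M.+1).
Local Notation cell := ('I_N1 * 'I_M.+1)%type.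
Local Notation G := (group_perm N1 M).
Context (SN : nat -> S -> mx) (Y : 'I_N1 -> S -> R).
Hypothesis mSN : forall N i m, measurable_fun setT (fun s => SN N s i m).
Hypothesis SN0 : forall N s i, SN N s i ord0 = Y i s.
Hypothesis exch : forall (sigma : G) (h : cell -> R -> R),
  (forall a, continuous (h a)) -> (forall a y, 0 <= h a y <= 1) ->
  \int[Q]_s (\prod_a h a (SN N s a.1 a.2)) -
  \int[Q]_s (\prod_a h a (permuted (SN N s) sigma a.1 a.2)) @[N --> \oo] --> (0 : R).
Hypothesis small_forms : forall eta, 0 < eta -> exists2 e, 0 < e &
  forall N b (pi : G) i,
    (Q [set s | small_form e b pi i (SN N s)] <= eta%:E)%E.
Variable alpha : R.
Hypothesis alpha01 : 0 < alpha < 1.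

Let btest N : bmeas (fun s => (perm_test alpha (SN N s))%:R : R).
Proof.
apply: bmeas_unit; first exact: measurable_perm_test.
by move=> s; case: perm_test; rewrite ?lexx ler01.
Qed.

Let bsmall e b (pi : G) i N : bmeas (fun s => (small_form e b pi i (SN N s))%:R : R).
Proof.
apply: bmeas_unit => [|s]; last by case: small_form; rewrite ?lexx ler01.
rewrite (_ : (fun s => _) = \1_([set s | small_form e b pi i (SN N s)])).
  by apply: measurable_indic; exact: measurable_small_form.
by apply/funext => s; rewrite indicE mem_setE.
Qed.

Let RE_small e b (pi : G) i N :
  (\int[Q]_s (small_form e b pi i (SN N s))%:R)%R = fine (Q [set s | small_form e b pi i (SN N s)]).
Proof.
rewrite /Rintegral; congr fine.
transitivity (\int[Q]_s (\1_([set s | small_form e b pi i (SN N s)]) s)%:E)%E.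
  by apply: eq_integral => s _; rewrite indicE mem_setE.
by rewrite integral_indic ?setIT//; exact: measurable_small_form.
Qed.

Lemma smooth_test01 e (s : mx) : 0 < e -> 0 <= smooth_test alpha e s <= 1.
Proof. by move=> e0; exact: clamp01_itv. Qed.

(** By asymptotic exchangeability, [K] times the expectation of the smooth test is close to the sum
    of its expectations over the permuted samples. There it lies below the test, and
    [sum_perm_test_le] bounds the sum of the tests by [K * alpha] for every sample. *)
Lemma asymptotic_level :
  (limn_esup (fun N => 'E_Q[fun s => (perm_test alpha (SN N s))%:R]) <= alpha%:E)%E.
Proof.
apply: limn_esup_le => eta eta0.
pose K := #|{: G}|; pose L := #|{: G * (bool * 'I_N1)}|.
(* Half of [eta] is shared among the [L] possible small forms; [L.+1] keeps the divisor positive. *)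
have [|e e0 He] := @small_forms (eta / 2 / L.+1%:R).
  by rewrite !divr_gt0.
pose F := smooth_test alpha e : mx -> R.
have F01 s : 0 <= F s <= 1 by exact: smooth_test01.
have bF (X : S -> mx) : (forall i m, measurable_fun setT (fun s => X s i m)) -> bmeas (fun s => F (X s)).
  by move=> mX; apply: bmeas_unit => //; exact: measurable_smooth_test.
have bFp sigma N : bmeas (fun s => F (permuted (SN N s) sigma)).
  by apply: bF => i m; exact: measurable_permuted.
have cF sigma : \int[Q]_s F (SN N s) - \int[Q]_s F (permuted (SN N s) sigma) @[N --> \oo] --> (0 : R).
  apply: (asymptotically_exchangeable (Y := Y)) => //; first exact: smooth_test_lipschitz.
  by move=> X mX; exact: measurable_smooth_test.
have K0 : (0 : R) < K%:R by rewrite ltr0n; apply/card_gt0P; exists [ffun=> 1%g].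
have near_sum : \forall N \near \oo,
    \sum_(sigma : G) (\int[Q]_s F (SN N s) - \int[Q]_s F (permuted (SN N s) sigma)) < K%:R * (eta / 2).
  have := @cvg_sumr0 R G (index_enum G) _ cF.
  move=> /cvgrPdist_lt/(_ (K%:R * (eta / 2))) H.
  have : 0 < K%:R * (eta / 2) by rewrite mulr_gt0// divr_gt0.
  by move=> /H; apply: filterS => N; rewrite sub0r normrN; exact/le_lt_trans/ler_norm.
apply: filterS near_sum => N HN.
rewrite expectation_bmeas// lee_fin.
pose sf (x : G * (bool * 'I_N1)) s : R := (small_form e x.2.1 x.1 x.2.2 (SN N s))%:R.
have bsf : bmeas (fun s => \sum_x sf x s) by apply: bmeas_sum => x; exact: bsmall.
have sub : \int[Q]_s (perm_test alpha (SN N s))%:R <= \int[Q]_s F (SN N s) + eta / 2.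
  apply: (@le_trans _ _ (\int[Q]_s (F (SN N s) + \sum_x sf x s))).
    apply: RE_le => [//||s]; first by apply: bmeasD => //; exact: bF.
    have -> : \sum_x sf x s = \sum_(pi : G) \sum_(b : bool) \sum_(i < N1) (small_form e b pi i (SN N s))%:R.
      by under [RHS]eq_bigr do rewrite pair_bigA; rewrite [RHS]pair_bigA.
    exact: perm_test_le_smooth.
  rewrite RE_D//; last exact: bF.
  apply: lerD => //; rewrite RE_sum; last by move=> x; exact: bsmall.
  apply: (@le_trans _ _ (\sum_(x : G * (bool * 'I_N1)) (eta / 2 / L.+1%:R))).
    apply: ler_sum => x _; rewrite RE_small -lee_fin fineK ?He//.
    by rewrite fin_num_measure//; exact: measurable_small_form.
  rewrite sumr_const -/L -[leLHS]mulr_natr -mulrA ler_piMr ?divr_ge0 ?(ltW eta0)//.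
  by rewrite mulrC ler_pdivrMr// mul1r ler_nat.
apply: (le_trans sub); rewrite [X in _ <= alpha + X]splitr addrA lerD2r.
rewrite -(ler_pM2l K0).
have permF : \sum_(sigma : G) \int[Q]_s F (permuted (SN N s) sigma) <= K%:R * alpha.
  rewrite -RE_sum//; rewrite -[leRHS](RE_cst Q).
  apply: RE_le => [||s]; [exact: bmeas_sum|exact: bmeas_cst|].
  apply: le_trans (sum_perm_test_le alpha01 (SN N s)).
  by apply: ler_sum => sigma _; exact: smooth_test_le.
move: HN; rewrite sumrB sumr_const -/K -mulr_natl; lra.
Qed.

End asymptotic_level.

Lemma cond_prob_null (R : realType) d (Omega : measurableType d) (P : probability Omega R)
    (W : {mfun Omega >-> bool}) (A : set Omega) :
  (forall w, (0 < P (W @^-1` [set w]))%E) -> measurable A ->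
  (forall w, cond_prob P W w A = 0%E) -> P A = 0%E.
Proof.
move=> W_gt0 mA A0.
have H w : P (A `&` W @^-1` [set w]) = 0%E.
  have mW : measurable (W @^-1` [set w]) by exact: measurable_funPTI.
  have p0 := cond_prob_mass_gt0 (W_gt0 w).
  move: (A0 w); rewrite cond_probE//.
  rewrite (_ : \int[P]_o _ = (fine (P (W @^-1` [set w])))^-1%:E * P (A `&` W @^-1` [set w]))%E.
    move=> /eqP; rewrite mule_eq0 => /orP[|/eqP//].
    by rewrite eqe invr_eq0 gt_eqF.
  under eq_integral do rewrite -mulrA EFinM.
  have mAW : measurable_fun setT (fun o => (\1_(W @^-1` [set w]) o * \1_A o : R)%:E).
    by apply/measurable_EFinP; apply: measurable_funM; exact: measurable_indic.
  rewrite ge0_integralZl//; last by rewrite lee_fin invr_ge0 ltW.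
  congr (_ * _)%E; rewrite -[in RHS](setIT (A `&` _)) -integral_indic//; last exact: measurableI.
  by apply: eq_integral => o _; rewrite indicI /= mulrC.
have mW w : measurable (W @^-1` [set w]) by exact: measurable_funPTI.
apply/eqP; rewrite -measure_le0 -[A]setIT.
rewrite (_ : setT = W @^-1` [set true] `|` W @^-1` [set false]); last first.
  by apply/seteqP; split=> // o _ /=; case: (W o); [left|right].
rewrite setIUr; apply: (@le_trans _ _ (P (A `&` W @^-1` [set true]) + P (A `&` W @^-1` [set false]))%E).
  by apply: measureU2; exact: measurableI.
by rewrite !H adde0.
Qed.

Section sampling.
Context (R : realType) d (Omega : measurableType d) (P : probability Omega R) (k : nat).
Local Notation cov := 'rV[R]_k.
Local Notation obs := (R * cov)%type.
Hypothesis k_gt0 : (0 < k)%N.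
Context (Y0 Y1 : {RV P >-> R}) (X : {RV P >-> cov}) (W : {RV P >-> bool}).
Hypothesis W_gt0 : forall w, (0 < P (W @^-1` [set w]))%E.
Context (f : bool -> cov -> R).
Hypothesis f_density : forall w : bool,
  is_density (distribution (cond_prob P W w) X) (cond_support P X W w) (f w).
Hypothesis X_abs_continuous : distribution P X `<< lebesgue_row R k.
Hypothesis supports_nested : cond_support P X W true `<=` cond_support P X W false.

Local Notation D := (msupport (distribution P X)).

Lemma cond_support_sub w : cond_support P X W w `<=` D.
Proof.
move=> x Dx U oU Ux; have mU : measurable U by exact: open_measurable_row.
have mXU : measurable (X @^-1` U) by exact: measurable_funPTI.
rewrite lt0e measure_ge0 andbT; apply/eqP => U0.
have := Dx U oU Ux; rewrite ltNge => /negP; apply.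
by apply: (le_trans (cond_prob_le (W_gt0 w) mXU)); rewrite (_ : P (X @^-1` U) = 0%E) ?mule0.
Qed.

Lemma cond_support_full w : cond_prob P W w (X @^-1` (~` cond_support P X W w)) = 0%E.
Proof. by apply: density_outside (f_density w); exact: measurable_msupport. Qed.

(** Each conditional law is carried by its support because it has a density there, and both supports
    lie in [D]; the two treatment values exhaust [P]. *)
Lemma support_full : distribution P X (~` D) = 0%E.
Proof.
have mD : measurable D by exact: measurable_msupport.
have mXD : measurable (X @^-1` (~` D)) by apply: measurable_funPTI; exact: measurableC.
apply: (cond_prob_null W_gt0 mXD) => w; apply/eqP; rewrite -measure_le0.
have mN : measurable (X @^-1` (~` cond_support P X W w)).
  by apply: measurable_funPTI; apply: measurableC; exact: measurable_msupport.
rewrite -(cond_support_full w); apply: le_measure; rewrite ?inE//.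
by move=> o /= ND Dw; apply: ND; exact: cond_support_sub Dw.
Qed.

Context d' (S : measurableType d') (Q : probability S R) (N1 : nat).
Context (Z1 : 'I_N1 -> {RV Q >-> obs}) (Z0 : nat -> {RV Q >-> obs}).
Local Notation obsX := (fun o => (observed W Y0 Y1 o, X o)).
Hypothesis Z1_law : forall i A, measurable A ->
  distribution Q (Z1 i) A = cond_prob P W true (obsX @^-1` A).
Hypothesis Z0_law : forall j A, measurable A ->
  distribution Q (Z0 j) A = cond_prob P W false (obsX @^-1` A).
Hypothesis Z_indep : mutually_independent Q (fun i : ('I_N1 + nat)%type =>
  match i with inl i1 => Z1 i1 : S -> _ | inr i0 => Z0 i0 : S -> _ end).

Let measurable_snd_preimage (B : set cov) : measurable B -> measurable [set z : obs | B z.2].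
Proof.
move=> mB; rewrite -[X in measurable X]setTI.
exact: (measurable_snd (T1 := R) (T2 := cov)).
Qed.

Let ae_supported w (Z : {RV Q >-> obs}) :
  (forall A, measurable A -> distribution Q Z A = cond_prob P W w (obsX @^-1` A)) ->
  {ae Q, forall s, cond_support P X W w (Z s).2}.
Proof.
move=> law; have mN : measurable [set z : obs | (~` cond_support P X W w) z.2].
  by apply: measurable_snd_preimage; apply: measurableC; exact: measurable_msupport.
exists (Z @^-1` [set z : obs | (~` cond_support P X W w) z.2]); split=> //.
- exact: measurable_funPTI.
- by rewrite -[LHS]/(distribution Q Z _) law//; exact: cond_support_full.
Qed.

Let Z1_indep : mutually_independent Q (fun i => Z1 i : S -> obs).
Proof. exact: (@mutually_independent_comp _ _ _ _ _ _ _ _ _ inl (@inl_inj _ _) Z_indep). Qed.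

Let Z0_indep : mutually_independent Q (fun j s => (Z0 j s).2).
Proof.
move=> s B us mB.
pose B' (i : ('I_N1 + nat)%type) : set obs := if i is inr j then [set z | B j z.2] else setT.
have := @Z_indep (map inr s) B'; rewrite map_inj_uniq; last by move=> i j [].
move=> /(_ us) H; rewrite big_map in H; rewrite -H.
  congr (Q _); apply/seteqP; split=> t /= Ht.
    by move=> i /= /mapP[j js ->]; exact: Ht.
  by move=> j js; apply: (Ht (inr j)); rewrite /= map_f.
by move=> [i|j] /=; [exact: measurableT|exact: measurable_snd_preimage].
Qed.

(** Absolute continuity makes some coordinate of [X] atomless, which already separates the treated
    covariates. The controls visit every neighbourhood of every point of their own support, which
    contains the support of the treated. *)
Lemma ae_good_sample : {ae Q, forall s, good_sample Z1 Z0 D s}.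
Proof.
have [j0 j00] := lebesgue_row_coord0 R k_gt0.
have mcoord : measurable_fun setT (fun z : obs => z.2 ord0 j0).
  apply: (measurableT_comp (f := fun v : cov => v ord0 j0)) => //.
  exact: measurable_coord.
have null (i : 'I_N1) t : Q (Z1 i @^-1` [set z : obs | z.2 ord0 j0 = t]) = 0%E.
  have mH : measurable [set z : obs | z.2 ord0 j0 = t].
    by rewrite -[X in measurable X]setTI; apply: (mcoord measurableT [set t]).
  rewrite -[LHS]/(distribution Q (Z1 i) _) Z1_law//; apply/eqP; rewrite -measure_le0.
  have mHx := @measurable_hyperplane R k j0 t.
  have -> : 0%E = ((fine (P (W @^-1` [set true])))^-1%:E * distribution P X [set v | v ord0 j0 = t])%E.
    by have /null_content_dominatesP/(_ _ mHx (j00 t)) -> := X_abs_continuous; rewrite mule0.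
  apply: (@cond_prob_le _ _ _ P W true (W_gt0 true) (X @^-1` [set v | v ord0 j0 = t])).
  exact: measurable_funPTI.
have dist := @ae_distinct _ _ _ _ _ Q _ Z1 (0, 0) _ mcoord Z1_indep null.
have vis := @visits_support R k _ S Q (fun j s => (Z0 j s).2)
  (fun j => measurableT_comp measurable_snd (measurable_funPT (Z0 j)))
  (distribution (cond_prob P W false) X) _ Z0_indep.
have {}vis := vis (fun j A mA => @Z0_law j _ (measurable_snd_preimage mA)).
have s1 : {ae Q, forall s, forall i, cond_support P X W true (Z1 i s).2}.
  by apply: filter_forall => i; exact: (ae_supported (Z1_law i)).
have s0 : {ae Q, forall s, forall j, cond_support P X W false (Z0 j s).2}.
  by apply/ae_foralln => j; exact: (ae_supported (@Z0_law j)).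
apply: filterS3 (filterI s1 s0) dist vis => s [h1 h0] ds vs; split.
- by move=> i; exact: cond_support_sub (h1 i).
- by move=> j; exact: cond_support_sub (h0 j).
- by move=> i i' /ds H e; apply: H; rewrite e.
- by move=> i U oU UZ n; exact: (vs _ U (supports_nested (h1 i)) oU UZ n).
Qed.

End sampling.

Section sample_regression.
Context (R : realType) d (Omega : measurableType d) (P : probability Omega R) (k : nat).
Local Notation cov := 'rV[R]_k.
Local Notation obs := (R * cov)%type.
Context (Y0 Y1 : {RV P >-> R}) (X : {RV P >-> cov}) (W : {RV P >-> bool}).
Hypothesis W_gt0 : forall w, (0 < P (W @^-1` [set w]))%E.
Context d' (S : measurableType d') (Q : probability S R).
Local Notation obsX := (fun o => (observed W Y0 Y1 o, X o)).

(** Stated with a shift [c] to serve both groups: the tested effect for the treated, with [T] the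
    centred [Y1], and [0] for the controls, with [T] equal to [Y0]. *)
Lemma sample_regression w (c : R) (T : Omega -> R) (Z : {RV Q >-> obs}) (h : R -> R) (hh : cov -> R)
    (B : set cov) :
  (forall A, measurable A -> distribution Q Z A = cond_prob P W w (obsX @^-1` A)) ->
  measurable_fun setT T -> (forall o, W o = w -> observed W Y0 Y1 o - c = T o) ->
  measurable_fun setT h -> (forall y, 0 <= h y) ->
  measurable_fun setT hh -> (forall x, 0 <= hh x) -> measurable B ->
  (\int[cond_prob P W w]_o (h (T o) * \1_B (X o))%:E =
   \int[cond_prob P W w]_o (hh (X o) * \1_B (X o))%:E)%E ->
  (\int[Q]_s (h ((Z s).1 - c) * \1_B (Z s).2)%:E =
   \int[Q]_s (hh (Z s).2 * \1_B (Z s).2)%:E)%E.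
Proof.
move=> law mT WT mh h0 mhh hh0 mB hE.
have mB2 : measurable_fun setT (fun z : obs => \1_B z.2 : R).
  by apply: (measurableT_comp (measurable_indic mB)); exact: measurable_snd.
have mh1 : measurable_fun setT (fun z : obs => h (z.1 - c) * \1_B z.2).
  apply: measurable_funM => //; apply: (measurableT_comp mh).
  by apply: measurable_funB => //; exact: measurable_fst.
have mh2 : measurable_fun setT (fun z : obs => hh z.2 * \1_B z.2).
  by apply: measurable_funM => //; apply: (measurableT_comp mhh); exact: measurable_snd.
have i0 (x : cov) : 0 <= \1_B x :> R by rewrite indicE.
rewrite (integral_sample law mh1); last by move=> z; rewrite mulr_ge0.
rewrite (integral_sample law mh2); last by move=> z; rewrite mulr_ge0.
rewrite -hE; apply: eq_integral_cond_prob => //.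
- apply: measurable_funM.
    apply: (measurableT_comp mh); apply: measurable_funB => //; exact: measurable_observed.
  by apply: (measurableT_comp (measurable_indic mB)); exact: measurable_funPT.
- apply: measurable_funM; first exact: (measurableT_comp mh).
  by apply: (measurableT_comp (measurable_indic mB)); exact: measurable_funPT.
- by move=> o; rewrite mulr_ge0.
- by move=> o; rewrite mulr_ge0.
- by move=> o Wo; rewrite /= WT.
Qed.

End sample_regression.

(** * The level of the test *)

Unset Implicit Arguments.

Theorem propositionB1 (R : realType)
  (* population *)
  (d : measure_display) (Omega : measurableType d) (P : probability Omega R)
  (k : nat) (k_gt0 : (0 < k)%N)
  (Y0 Y1 : {RV P >-> R}) (X : {RV P >-> 'rV[R]_k}) (W : {RV P >-> bool})
  (W_nondegenerate : (0 < P (W @^-1` [set true]) < 1)%E)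
  (Y0_integrable : P.-integrable setT (EFin \o Y0))
  (Y1_integrable : P.-integrable setT (EFin \o Y1))
  (f : bool -> 'rV[R]_k -> R)
  (f_density : forall w : bool,
    is_density (distribution (cond_prob P W w) X) (cond_support P X W w) (f w))
  (* sample *)
  (d' : measure_display) (S : measurableType d') (Q : probability S R)
  (N1 : nat) (N1_gt0 : (0 < N1)%N)
  (Z1 : 'I_N1 -> {RV Q >-> (R * 'rV[R]_k)%type})
  (Z0 : nat -> {RV Q >-> (R * 'rV[R]_k)%type})
  (Z1_law : forall i A, measurable A ->
    distribution Q (Z1 i) A =
    cond_prob P W true ((fun w => (observed W Y0 Y1 w, X w)) @^-1` A))
  (Z0_law : forall j A, measurable A ->
    distribution Q (Z0 j) A =
    cond_prob P W false ((fun w => (observed W Y0 Y1 w, X w)) @^-1` A))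
  (Z_indep : mutually_independent Q
    (fun (i : ('I_N1 + nat)%type) =>
       match i with inl i1 => Z1 i1 : S -> _ | inr i0 => Z0 i0 : S -> _ end))
  (* CIA *)
  (cia : cond_independent P X Y0 W)
  (* covariates *)
  (X_abs_continuous : distribution P X `<< lebesgue_row R k)
  (supports_nested : cond_support P X W true `<=` cond_support P X W false)
  (supports_compact : forall w : bool, compact (cond_support P X W w))
  (f_differentiable : forall (w : bool) (x : 'rV[R]_k),
    (cond_support P X W w)° x -> differentiable (f w) x)
  (f_bounded : forall w : bool, exists C : R,
    forall x, cond_support P X W true x -> f w x <= C)
  (f0_bounded_below : exists2 C : R, 0 < C &
    forall x, cond_support P X W true x -> C <= f false x)
  (support_thick : exists phi0 rho0 : R, [/\ 0 < phi0, 0 < rho0 &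
    uniformly_thick (cond_support P X W true) phi0 rho0])
  (* smoothness *)
  (smooth : forall h : R -> R, continuous h ->
    (exists C : R, forall y, `|h y| <= C) ->
    exists htilde : 'rV[R]_k -> R,
      [/\ is_cond_expectation P X (h \o Y0) htilde,
          {within msupport (distribution P X), continuous htilde} &
          exists C : R, forall x, msupport (distribution P X) x ->
            `|htilde x| <= C])
  (* homoskedasticity and treatment effect homogeneity *)
  (homogeneity : exists kappa1 kappa0 : R.-pker 'rV[R]_k ~> R,
    [/\ is_cond_distribution (cond_prob P W true) X
          (fun w => Y1 w - att P W Y0 Y1) kappa1,
        is_cond_distribution (cond_prob P W false) X Y0 kappa0 &
        forall x, cond_support P X W true x ->
          forall A, measurable A -> kappa1 x A = kappa0 x A])
  (* continuity of the distribution of Y (given X = x) *)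
  (Y_continuous : exists kappa : R.-pker 'rV[R]_k ~> R,
    is_cond_distribution P X (observed W Y0 Y1) kappa /\
    forall x, msupport (distribution P X) x ->
      forall y : R, kappa x [set y] = 0%E)
  (* test *)
  (V : 'M[R]_k) (V_posdef : posdef V) (M : nat) (M_gt0 : (0 < M)%N)
  (c : R) (H0 : att P W Y0 Y1 = c)
  (alpha : R) (alpha01 : 0 < alpha < 1) :
  (limn_esup (fun N0 : nat =>
     'E_Q[fun s => (perm_test alpha
       (matched_sample V M c (fun i => Z1 i s) (fun j => Z0 j s) N0))%:R])
   <= alpha%:E)%E.
Proof.
have W_gt0 := treatment_gt0 W_nondegenerate.
pose D := msupport (distribution P X).
pose SN N s := matched_sample V M c (fun i => Z1 i s) (fun j => Z0 j s) N.
have mSN N i m : measurable_fun setT (fun s => SN N s i m).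
  by apply: (@measurable_matched_sample R k V _ S M N1 N c (fun i s => Z1 i s) (fun j s => Z0 j s) i m).
have good := ae_good_sample k_gt0 W_gt0 f_density X_abs_continuous supports_nested
  Z1_law Z0_law Z_indep.
have mT1 : measurable_fun setT (fun w => Y1 w - att P W Y0 Y1).
  by apply: measurable_funB => //; exact: measurable_cst.
have regression := common_regression mT1 W_gt0 f_density cia supports_nested
  f0_bounded_below homogeneity smooth.
have moment_cvg (h : 'I_N1 * 'I_M.+1 -> R -> R) (hh : 'I_N1 * 'I_M.+1 -> 'rV[R]_k -> R) :
    (forall a, continuous (h a)) -> (forall a y, 0 <= h a y <= 1) ->
    (forall a, [/\ measurable_fun setT (hh a), forall x, 0 <= hh a x <= 1,
       {within D, continuous hh a},
       forall B, measurable B ->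
         (\int[cond_prob P W false]_o (h a (Y0 o) * \1_B (X o))%:E =
          \int[cond_prob P W false]_o (hh a (X o) * \1_B (X o))%:E)%E &
       forall B, measurable B ->
         (\int[cond_prob P W true]_o (h a (Y1 o - att P W Y0 Y1) * \1_B (X o))%:E =
          \int[cond_prob P W true]_o (hh a (X o) * \1_B (X o))%:E)%E]) ->
    \int[Q]_s (\prod_a h a (SN N s a.1 a.2)) @[N --> \oo] -->
      \int[Q]_s (\prod_a hh a (Z1 a.1 s).2).
  move=> ch h01 Hhh.
  have mh a : measurable_fun setT (h a) by apply: continuous_measurable_fun; exact: ch.
  apply: (matched_moment_cvg k_gt0 V_posdef Z_indep good mh h01).
  - by move=> a; have [] := Hhh a.
  - by move=> a; have [] := Hhh a.
  - by move=> a; have [] := Hhh a.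
  - move=> a i B mB; have [mhh hh01 _ _ tr] := Hhh a.
    apply: (sample_regression W_gt0 (Z1_law i) mT1 _ (mh a) _ mhh _ mB (tr B mB)).
    + by move=> o Wo; rewrite observed_true// H0.
    + by move=> y; case/andP: (h01 a y).
    + by move=> y; case/andP: (hh01 y).
  - move=> a j B mB; have [mhh hh01 _ cr _] := Hhh a.
    transitivity (\int[Q]_s (h a ((Z0 j s).1 - 0) * \1_B (Z0 j s).2)%:E)%E.
      by apply: eq_integral => s _; rewrite subr0.
    apply: (sample_regression W_gt0 (Z0_law j) _ _ (mh a) _ mhh _ mB (cr B mB)) => //.
    + by move=> o Wo; rewrite observed_false// subr0.
    + by move=> y; case/andP: (h01 a y).
    + by move=> y; case/andP: (hh01 y).
have exch (sigma : group_perm N1 M) (h : 'I_N1 * 'I_M.+1 -> R -> R) :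
    (forall a, continuous (h a)) -> (forall a y, 0 <= h a y <= 1) ->
    \int[Q]_s (\prod_a h a (SN N s a.1 a.2)) -
    \int[Q]_s (\prod_a h a (permuted (SN N s) sigma a.1 a.2)) @[N --> \oo] --> (0 : R).
  move=> ch h01; have /choice[hh Hhh] a := regression (h a) (ch a) (h01 a).
  (* Permuting the sample amounts to permuting the test functions by [tau]. The limit does not
     change: all the [hh] of a row are evaluated at the covariate of that row, and [tau] preserves
     rows. *)
  pose tau (a : 'I_N1 * 'I_M.+1) := (a.1, ((sigma a.1)^-1)%g a.2).
  have tau_bij : bijective tau.
    exists (fun a => (a.1, sigma a.1 a.2)) => -[i m]; rewrite /tau/=.
      by rewrite permKV.
    by rewrite permK.
  have cv := moment_cvg h hh ch h01 Hhh.
  have cvt := moment_cvg (h \o tau) (hh \o tau) (fun a => ch (tau a)) (fun a => h01 (tau a))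
    (fun a => Hhh (tau a)).
  have lE : \int[Q]_s (\prod_a (hh \o tau) a (Z1 a.1 s).2) = \int[Q]_s (\prod_a hh a (Z1 a.1 s).2).
    by apply: eq_Rintegral => s _; rewrite [RHS](reindex tau)//; exact: onW_bij.
  have pE N : \int[Q]_s (\prod_a h a (permuted (SN N s) sigma a.1 a.2)) =
      \int[Q]_s (\prod_a (h \o tau) a (SN N s a.1 a.2)).
    apply: eq_Rintegral => s _; rewrite [LHS](reindex tau); last exact: onW_bij.
    by apply: eq_bigr => -[i m] _ /=; rewrite mxE permKV.
  under eq_fun do rewrite pE.
  by rewrite lE in cvt; rewrite -(subrr (\int[Q]_s (\prod_a hh a (Z1 a.1 s).2))); exact: cvgB.
have [kappa [YX atomless]] := Y_continuous.
have mY := measurable_observed Y0 Y1 W.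
have ae_atomless : {ae distribution P X, forall x, forall y, kappa x [set y] = 0%E}.
  exists (~` D); split.
  - by apply: measurableC; exact: measurable_msupport.
  - exact (support_full W_gt0 f_density).
  - by move=> x /= Hx Dx; apply: Hx => y; exact: atomless.
(* Conditioning on treatment increases probabilities by at most this factor. *)
pose C := (fine (P (W @^-1` [set true])))^-1.
have C0 : 0 < C by rewrite invr_gt0; exact: cond_prob_mass_gt0.
have Z1_le i A : measurable A ->
    (Q (Z1 i @^-1` A) <= C%:E * P ((fun o => (observed W Y0 Y1 o, X o)) @^-1` A))%E.
  move=> mA; rewrite -[leLHS]/(distribution Q (Z1 i) A) Z1_law//; apply: cond_prob_le => //.
  rewrite -[X in measurable X]setTI.
  have mYX : measurable_fun setT (fun o => (observed W Y0 Y1 o, X o)) by exact: measurable_fun_pair.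
  exact: (mYX measurableT _ mA).
apply: (@asymptotic_level R _ S Q N1 M N1_gt0 M_gt0 SN (fun i s => (Z1 i s).1 - c)) => //.
  by move=> N s i; rewrite mxE.
move=> eta eta0.
have Ceta : 0 < eta / C by rewrite divr_gt0.
(* The window for the outcome is fixed by the population alone, hence uniformly in [N]; [e] is then
   scaled down to account for the coefficients of the forms. *)
have [m Hm] : exists m, (\int[distribution P X]_x concentration kappa m.+1%:R^-1 x <= (eta / C)%:E)%E.
  have /fine_cvgP[[n1 _ fin] /cvgrPdist_le/(_ _ Ceta)[n2 _ small]] := concentration_cvg0 ae_atomless.
  exists (maxn n1 n2); rewrite -(fineK (fin _ (leq_maxl n1 n2))) lee_fin.
  have := small _ (leq_maxr n1 n2); rewrite sub0r normrN.
  exact/le_trans/ler_norm.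
have m0 : 0 < m.+1%:R^-1 :> R by rewrite invr_gt0.
have [e e0 He] := @exists_small_scale R (bool * group_perm N1 M * 'I_N1)%type
  (fun x => contrast_pm x.1.1 x.1.2 (delta_mx x.2 ord0)) _ m0.
exists e => // N b pi i.
have small := small_form_probability V c Z_indep mY YX Z1_le (ltW C0) N m0 (He (b, pi, i)).
apply: (le_trans small).
rewrite (_ : eta = C * (eta / C)); last by rewrite mulrC divfK// gt_eqF.
by rewrite EFinM; apply: lee_wpmul2l => //; rewrite lee_fin ltW.
Qed.
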